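(* Consider the random walk on random walks $(X_t)_{t\ge 0}$ on $\mathbb{Z}^d$ with particle density $\lambda\in[0,\infty)$ and $d\ge 5$. Then: (a) (Strong law of large numbers) There exists $v\in\mathbb{R}^d$ such that $$\lim_{t\to\infty}\frac{X_t}{t}=v\qquad P_{\mathbb{P}}\text{-almost surely and in }L_1.$$ (b) (Large deviation bounds) For every $\epsilon>0$ there exist constants $C,c>0$ such that $$P_{\mathbb{P}}\left(\left|\frac{X_t}{t}-v\right|>\epsilon\right)\le Ce^{-ct}\qquad\text{for all }t\in\mathbb{N},$$ with $v$ the vector from (a).
   Context: Random walk on random walks (RWRW) model. Fix a probability distribution $p$ on $\mathbb{Z}^d$ of finite range whose covariance matrix is invertible (the particle step law). Let $(N_{x,0})_{x\in\mathbb{Z}^d}$ be i.i.d. Poisson($\lambda$) random variables. For each $x$, place $N_{x,0}$ particles at $x$ at time $0$; all particles move independently in discrete time as random walks with i.i.d. increments of law $p$. Let $N_{x,t}$ be the number of particles at $x$ at time $t$, and set $\omega_t(x)=1$ if $N_{x,t}\ge 1$ and $\omega_t(x)=0$ otherwise. $\mathbb{P}$ denotes the law of $\omega=(\omega_t)$. For $i\in\{0,1\}$ let $\alpha(i,\cdot)$ be a probability distribution on $\mathbb{Z}^d$ with finite range $\mathcal{R}_i=\{z:\alpha(i,z)>0\}$. Given $\omega$, the walk $(X_t)_{t\geq 0}$ on $\mathbb{Z}^d$ (quenched law $P_\omega$) is the time-inhomogeneous Markov chain with $X_0=o$ (the origin) and $P_\omega(X_{t+1}=y+z\mid X_t=y)=\alpha(i,z)$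 if $\omega_t(y)=i$. The joint (annealed) law is $P_{\mathbb{P}}(B\times A)=\int_B P_\omega(A)\,d\mathbb{P}(\omega)$. *)

(* Defs.v *)
From HB Require Import structures.
From mathcomp Require Import all_boot all_order all_algebra finmap.
From mathcomp Require Import all_classical all_reals all_analysis.
Import Order.TTheory GRing.Theory Num.Theory.
Import numFieldNormedType.Exports.

Set Implicit Arguments.
Unset Strict Implicit.
Unset Printing Implicit Defensive.

Local Open Scope classical_set_scope.
Local Open Scope ring_scope.

Section distributions.
Context {R : realType} {d : nat}.
Implicit Types q : 'rV[int]_d -> R.

Definition finite_range_distribution q : Prop :=
  [/\ forall z, 0 <= q z,
      finite_set [set z | 0 < q z] &
      \sum_(z \in [set z | 0 < q z]) q z = 1].

(* The fsbigop sums range over the support, which is finite for a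
   finite-range distribution. *)
Definition mean q (j : 'I_d) : R :=
  \sum_(z \in [set z | 0 < q z]) q z * (z 0 j)%:~R.

Definition covariance_mx q : 'M[R]_d :=
  \matrix_(j, k) \sum_(z \in [set z | 0 < q z])
    q z * (((z 0 j)%:~R - mean q j) * ((z 0 k)%:~R - mean q k)).

End distributions.

(* Configurations omega_t(y) with the product sigma-algebra of the discrete
   sigma-algebras on the factors. *)
Definition env_cylinders (d : nat) : set (set (nat -> 'rV[int]_d -> bool)) :=
  [set A | exists t y, A = [set w : nat -> 'rV[int]_d -> bool | w t y]].

Definition env (d : nat) := g_sigma_algebraType (@env_cylinders d).

(* A named copy of the function type, so that it can carry a [pointedType]
   structure: [g_sigma_algebraType] needs one and 'rV[int]_d has none. *)
Definition trajectory (d : nat) := nat -> 'rV[int]_d.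

HB.instance Definition _ (d : nat) :=
  Choice.copy (trajectory d) (nat -> 'rV[int]_d).
HB.instance Definition _ (d : nat) :=
  isPointed.Build (trajectory d) (fun=> 0).

(* Trajectories of the walk, with the product sigma-algebra. *)
Definition walk_cylinders (d : nat) : set (set (trajectory d)) :=
  [set A | exists t y, A = [set X : trajectory d | X t = y]].

Definition walk_path (d : nat) := g_sigma_algebraType (@walk_cylinders d).

Section independence.
Context {disp : measure_display} {T : measurableType disp} {R : realType}.

Definition mutually_independent (P : probability T R) (I : choiceType)
    (F : I -> set (set T)) : Prop :=
  forall (J : {fset I}) (A : I -> set T),
    (forall i, i \in J -> F i (A i)) ->
    P (\bigcap_(i in [set` J]) A i) = (\prod_(i <- J) P (A i))%E.

(* Random variables with values in a countable set with its discrete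
   sigma-algebra. *)
Definition discrete_rv (U : Type) (X : T -> U) : Prop :=
  forall u, measurable (X @^-1` [set u]).

Definition preimage_events (U : Type) (X : T -> U) : set (set T) :=
  [set X @^-1` B | B in [set: set U]].

End independence.

Section particles.
Context {disp : measure_display} {T : measurableType disp} {R : realType}
  {d : nat}.
Variables (N0 : 'rV[int]_d -> T -> nat)
  (xi : 'rV[int]_d -> nat -> nat -> T -> 'rV[int]_d).

(* [xi x i s] is the increment between times s and s+1 of the i-th particle
   started at x. Increments are defined for all i; the particles present in the
   system are those with i < N0 x. *)
Definition particle_driving (p : 'rV[int]_d -> R) (lambda : R)
    (P : probability T R) : Prop :=
  [/\ forall x, discrete_rv (N0 x),
      forall x i s, discrete_rv (xi x i s),
      (* The library's [poisson_pmf] is not the Dirac mass when the rate is 0,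
         so the mass function is written out. *)
      forall x k, P (N0 x @^-1` [set k]) =
        (lambda ^+ k / k`!%:R * expR (- lambda))%:E,
      forall x i s z, P (xi x i s @^-1` [set z]) = (p z)%:E &
      mutually_independent P
        (fun j : 'rV[int]_d + 'rV[int]_d * nat * nat =>
           match j with
           | inl x => preimage_events (N0 x)
           | inr (x, i, s) => preimage_events (xi x i s)
           end)].

Definition particle_position (om : T) (x : 'rV[int]_d) (i t : nat) :
  'rV[int]_d := x + \sum_(s < t) xi x i s om.

(* N_{y,t}, possibly infinite on a null set. *)
Definition particle_count (om : T) (t : nat) (y : 'rV[int]_d) : \bar R :=
  \esum_(q in [set q : 'rV[int]_d * nat |
    (q.2 < N0 q.1 om)%N /\ particle_position om q.1 q.2 t = y]) 1%E.

Definition occupation (om : T) : env d :=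
  fun t y => (1 <= particle_count om t y)%E.

End particles.

Definition rwrw_law {R : realType} {d : nat} (p : 'rV[int]_d -> R) (lambda : R)
    (P : probability (env d) R) : Prop :=
  exists (disp : measure_display) (T : measurableType disp)
    (mu : probability T R) (N0 : 'rV[int]_d -> T -> nat)
    (xi : 'rV[int]_d -> nat -> nat -> T -> 'rV[int]_d),
    particle_driving N0 xi p lambda mu /\
    forall B : set (env d), measurable B ->
      P B = mu (occupation (R := R) N0 xi @^-1` B).

(* The Markov chain started at the origin whose transition from y to y + z at
   time t has probability alpha(w_t(y), z), with [false] for 0 and [true]
   for 1. *)
Definition quenched_law {R : realType} {d : nat}
    (alpha : bool -> 'rV[int]_d -> R) (w : env d)
    (Q : set (walk_path d) -> \bar R) : Prop :=
  Q [set X | X 0%N = 0] = 1%E /\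
  forall (t : nat) (x : nat -> 'rV[int]_d),
    Q [set X | forall s, (s <= t.+1)%N -> X s = x s] =
    (Q [set X | forall s, (s <= t)%N -> X s = x s] *
     (alpha (w t (x t)) (x t.+1 - x t))%:E)%E.

Definition annealed_law {R : realType} {d : nat} (P : probability (env d) R)
    (K : R.-pker env d ~> walk_path d)
    (PP : probability (env d * walk_path d)%type R) : Prop :=
  forall (B : set (env d)) (A : set (walk_path d)),
    measurable B -> measurable A ->
    PP (B `*` A) = (\int[P]_(w in B) K w A)%E.

(* X_t / t, with value 0 at t = 0. R^d is 'rV[R]_d with the library's norm,
   the maximum norm; all norms on R^d are equivalent. *)
Definition empirical_velocity {R : realType} {d : nat} (X : walk_path d)
    (t : nat) : 'rV[R]_d :=
  t%:R^-1 *: map_mx intr (X t).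

(* Main.v *)
(* Record, at each time, the occupation value under the walk and its next step. Averaging
   over the environment gives a law rho on words of such letters, and the heart of the matter
   is the decoupling bound delta rho(l) rho(l') <= rho(l l') with delta > 0 independent of the
   lengths of l and l'. For fixed space-time sites, the occupied ones form the union of a
   Poisson family of particle traces. The particles that meet sites both before and after a
   given time have bounded total mass, because in dimension d >= 5 the sum of n p^n(0, .) over
   n converges. Discarding them makes past and future independent; and, given that the other
   particles realise the prescribed past, the probabilities that a path through one of its
   sites visits future sites have a bounded sum over these sites: a walk avoids any moving
   target forever with probability at least q > 0, so conditioning on empty past sites costs
   at most 1/q. The product of the complementary probabilities is a positive constant. Time
   shifts preserve the Poisson law, so both marginals are again rho.

   Decoupling alone gives the law of large numbers with exponential tails. Let v+ and v- be
   the largest and smallest asymptotic drifts of an additive functional over all histories.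
   A history h with drift near v+ has a conditional law that dominates delta rho, and the
   density of rho with respect to it is a bounded martingale, hence nearly constant over most
   blocks of a long word; so rho itself has drift near v+, and likewise near v-. Thus v+ = v-,
   and the drift is uniform over histories; a block-wise exponential moment then bounds the
   tails. Borel-Cantelli and dominated convergence give the two limits. *)
From HB Require Import structures.
Require Import Defs.
From mathcomp Require Import all_boot all_order all_algebra.
From mathcomp Require classical_sets.
From mathcomp Require Import boolp reals sequences exp ring lra zify.
Import Order.TTheory GRing.Theory Num.Theory.
Set Implicit Arguments.
Unset Strict Implicit.
Unset Printing Implicit Defensive.
Local Open Scope ring_scope.

(** * Sums over words *)

(** The walk sees the field along its own random path, but the word determines this path. So the
    probability of a word is that of an occupation pattern at fixed space-time sites times a product
    of step weights, and decoupling is only needed at fixed sites. The delicate point is the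
    occupied past sites: such a site may be occupied only by particles that also meet the future,
    and these are to be discarded. They are cut back one site at a time, beginning with the site
    nearest to the present. By the Markov property at site u, meeting the future is independent of
    the trace before u, and the cut costs a factor 1 - c(u), where c(u) is the probability of
    meeting future sites given the avoidance of the empty past sites. The future is treated likewise
    with time reversed. The outcome is [delta] = exp(-2 lambda C) exp(-2C/q^2)^2 with C the heat
    kernel constant and q the avoidance probability; 2 bounds the sum of n (n+1)^(-5/2), as at most
    n pairs of a past and a future time are at distance n. *)

Section words.
Variable A : Type.
Implicit Types (s l : seq A) (n m : nat).

Fixpoint words s n : seq (seq A) :=
  if n is n'.+1 then [seq e :: l | e <- s, l <- words s n'] else [:: [::]].

Variable V : nmodType.
Implicit Type f : seq A -> V.

Lemma big_words0 s f : \sum_(l <- words s 0) f l = f [::].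
Proof. by rewrite big_seq1. Qed.

Lemma big_wordsS s n f :
  \sum_(l <- words s n.+1) f l = \sum_(e <- s) \sum_(l <- words s n) f (e :: l).
Proof. by rewrite /= big_allpairs_dep. Qed.

Lemma big_words_cat s n m f :
  \sum_(l <- words s (n + m)) f l =
  \sum_(l <- words s n) \sum_(l' <- words s m) f (l ++ l').
Proof.
elim: n f => [|n IH] f; first by rewrite big_words0.
by rewrite addSn !big_wordsS; apply: eq_bigr => e _; rewrite IH.
Qed.

Lemma big_wordsSr s n f :
  \sum_(l <- words s n.+1) f l =
  \sum_(l <- words s n) \sum_(e <- s) f (rcons l e).
Proof.
rewrite -addn1 big_words_cat; apply: eq_bigr => l _.
by rewrite big_wordsS; apply: eq_bigr => e _; rewrite big_words0 cats1.
Qed.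

Lemma big_words_rev s n f :
  \sum_(l <- words s n) f (rev l) = \sum_(l <- words s n) f l.
Proof.
elim: n f => [|n IH] f; first by rewrite !big_words0.
rewrite big_wordsS big_wordsSr exchange_big /=.
rewrite -(IH (fun l => \sum_(e <- s) f (rcons l e))).
by apply: eq_bigr => l _; apply: eq_bigr => e _; rewrite rev_cons.
Qed.

End words.

Lemma mem_words (A : eqType) (s l : seq A) n :
  (l \in words s n) = (size l == n) && all (mem s) l.
Proof.
elim: n l => [|n IH] [|a l].
- by [].
- by rewrite inE.
- by apply/allpairsP => -[[? ?] []].
rewrite /= eqSS; apply/allpairsP/idP => [[[e w] [/= es ws [-> ->]]]|].
  by move: ws; rewrite IH es => /andP[-> ->].
move=> /and3P[sl al all_l]; exists (a, l); split=> //.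
by rewrite IH sl.
Qed.

Lemma uniq_words (A : eqType) (s : seq A) n : uniq s -> uniq (words s n).
Proof.
move=> us; elim: n => [|n IH] //=; apply: allpairs_uniq => //.
by move=> [a l] [b k] _ _ [-> ->].
Qed.

Section word_weight.
Variables (R : comPzRingType) (A : Type).
Implicit Types (p : A -> R) (s l : seq A).

Definition weight p l : R := \prod_(z <- l) p z.

Lemma weight_cons p z l : weight p (z :: l) = p z * weight p l.
Proof. by rewrite /weight big_cons. Qed.

Lemma weight_cat p l l' : weight p (l ++ l') = weight p l * weight p l'.
Proof. by rewrite /weight big_cat. Qed.

Lemma weight_rev p l : weight p (rev l) = weight p l.
Proof.
elim: l => // z l IH.
by rewrite rev_cons -cats1 weight_cat !weight_cons IH /weight big_nil mulr1 mulrC.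
Qed.

Lemma sum_weight p s n :
  \sum_(l <- words s n) weight p l = (\sum_(z <- s) p z) ^+ n.
Proof.
elim: n => [|n IH]; first by rewrite big_words0 /weight big_nil.
rewrite big_wordsS exprS mulr_suml; apply: eq_bigr => e _.
by rewrite -IH mulr_sumr; apply: eq_bigr => l _; rewrite weight_cons.
Qed.

End word_weight.

Lemma weight_ge0 (R : numDomainType) (A : Type) (p : A -> R) (l : seq A) :
  (forall z, 0 <= p z) -> 0 <= weight p l.
Proof. by move=> p0; apply: prodr_ge0. Qed.

Lemma eq_words (V : nmodType) (A : Type) (s : seq A) n (f g : seq A -> V) :
  (forall l, size l = n -> f l = g l) ->
  \sum_(l <- words s n) f l = \sum_(l <- words s n) g l.
Proof.
elim: n f g => [|n IH] f g fg; first by rewrite !big_words0 fg.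
rewrite !big_wordsS; apply: eq_bigr => e _.
by apply: IH => l sl; apply: fg => /=; rewrite sl.
Qed.

Lemma ler_words (R : numDomainType) (A : Type) (s : seq A) n (f g : seq A -> R) :
  (forall l, size l = n -> f l <= g l) ->
  \sum_(l <- words s n) f l <= \sum_(l <- words s n) g l.
Proof.
elim: n f g => [|n IH] f g fg; first by rewrite !big_words0 fg.
rewrite !big_wordsS; apply: ler_sum => e _.
by apply: IH => l sl; apply: fg => /=; rewrite sl.
Qed.

(** * Concentration for word processes with decoupling *)

(** Young's inequality; the free parameter [eta] is balanced later over many blocks. *)
Lemma mul_le_sqr (R : realFieldType) (eta x w : R) : 0 < eta -> 0 <= w ->
  w * `|x| <= (eta * (w * x ^+ 2) + w / eta) / 2.
Proof.
move=> eta0 w0; rewrite -[x ^+ 2]real_normK ?num_real //.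
have h : 0 <= (eta * `|x| - 1) ^+ 2 by apply: sqr_ge0.
have -> : (eta * (w * `|x| ^+ 2) + w / eta) / 2 =
  w * `|x| + w / eta / 2 * (eta * `|x| - 1) ^+ 2 by field; rewrite gt_eqF.
by rewrite lerDl mulr_ge0 // divr_ge0 // divr_ge0 // ltW.
Qed.

Section word_process.
Variables (R : realType) (A : Type) (s : seq A).
Implicit Types (rho Q : seq A -> R) (h l : seq A) (f : seq A -> R).

(** Consistency sums over the letters of [s] only, while a word may contain any letters. The last
    clause makes all extensions of a null word null, including those by foreign letters. *)
Definition word_process rho : Prop :=
  [/\ forall l, 0 <= rho l, rho [::] = 1,
      forall l, \sum_(e <- s) rho (rcons l e) = rho l &
      forall l l', rho (l ++ l') <= rho l].

Definition cexp rho h n f : R :=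
  \sum_(l <- words s n) rho (h ++ l) / rho h * f l.

Lemma sum_continuations rho h n : word_process rho ->
  \sum_(l <- words s n) rho (h ++ l) = rho h.
Proof.
move=> [_ _ rhoS _]; elim: n h => [|n IH] h.
  by rewrite big_words0 cats0.
rewrite big_wordsS -(rhoS h); apply: eq_bigr => e _.
by rewrite -IH; apply: eq_bigr => l _; rewrite cat_rcons.
Qed.

Section fixed_process.
Variable rho : seq A -> R.
Hypothesis rhoP : word_process rho.

Lemma process_ge0 l : 0 <= rho l. Proof. by case: rhoP. Qed.
Lemma process_nil : rho [::] = 1. Proof. by case: rhoP. Qed.

Lemma process_eq0 h l : rho h = 0 -> rho (h ++ l) = 0.
Proof.
case: rhoP => r0 _ _ rcat h0; apply/eqP; rewrite eq_le r0 andbT.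
by rewrite -[X in _ <= X]h0.
Qed.

Lemma process_neq0 h l : rho (h ++ l) != 0 -> rho h != 0.
Proof. by apply: contraNneq => /process_eq0 ->. Qed.

Lemma process_ratio_ge0 h l : 0 <= rho l / rho h.
Proof. by rewrite divr_ge0 // process_ge0. Qed.

(** Chain rule for conditional probabilities. It survives a null [h ++ l], where division by zero
    gives 0, because every extension is then null too. *)
Lemma ratioM h l l' :
  rho (h ++ l) / rho h * (rho (h ++ l ++ l') / rho (h ++ l)) =
  rho (h ++ l ++ l') / rho h.
Proof.
have [z|nz] := eqVneq (rho (h ++ l)) 0.
  by rewrite catA (process_eq0 l' z) !(mul0r, mulr0).
by field; rewrite nz (process_neq0 nz).
Qed.

Lemma cexp_cat h n m f :
  cexp rho h (n + m) f =
  cexp rho h n (fun l => cexp rho (h ++ l) m (fun l' => f (l ++ l'))).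
Proof.
rewrite /cexp big_words_cat; apply: eq_bigr => l _.
rewrite mulr_sumr; apply: eq_bigr => l' _.
by rewrite mulrA -catA ratioM.
Qed.

Lemma cexp_cst h n c : 0 < rho h -> cexp rho h n (fun=> c) = c.
Proof.
move=> h0; rewrite /cexp -mulr_suml -mulr_suml sum_continuations //.
by rewrite divff ?mul1r // gt_eqF.
Qed.

Lemma cexpD h n f f' :
  cexp rho h n (fun l => f l + f' l) = cexp rho h n f + cexp rho h n f'.
Proof. by rewrite /cexp -big_split; apply: eq_bigr => l _; rewrite mulrDr. Qed.

Lemma cexpZ h n c f : cexp rho h n (fun l => c * f l) = c * cexp rho h n f.
Proof. by rewrite /cexp mulr_sumr; apply: eq_bigr => l _; rewrite mulrCA. Qed.

Lemma cexpN h n f : cexp rho h n (fun l => - f l) = - cexp rho h n f.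
Proof. by rewrite /cexp -sumrN; apply: eq_bigr => l _; rewrite mulrN. Qed.

Lemma cexpB h n f f' :
  cexp rho h n (fun l => f l - f' l) = cexp rho h n f - cexp rho h n f'.
Proof. by rewrite cexpD cexpN. Qed.

(* Only continuations of positive probability matter: the junk value of a
   conditional expectation given a null word never contributes. *)
Lemma ler_cexp h n f f' :
  (forall l, 0 < rho (h ++ l) -> size l = n -> f l <= f' l) ->
  cexp rho h n f <= cexp rho h n f'.
Proof.
rewrite /cexp; elim: n h f f' => [|n IH] h f f' ff'.
  rewrite !big_words0 cats0; have [z|nz] := eqVneq (rho h) 0.
    by rewrite z !mul0r.
  rewrite ler_wpM2l ?process_ratio_ge0 // ff' // cats0 lt0r nz.
  exact: process_ge0.
rewrite !big_wordsS; apply: ler_sum => e _.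
have [z|nz] := eqVneq (rho (rcons h e)) 0.
  by rewrite !big1 // => l _; rewrite -cat_rcons process_eq0 // !mul0r.

have ge0 : 0 <= rho (rcons h e) / rho h by exact: process_ratio_ge0.
have hz : rho h != 0 by move: nz; rewrite -cats1 => /process_neq0.
have E g : \sum_(l <- words s n) rho (h ++ e :: l) / rho h * g (e :: l) =
    rho (rcons h e) / rho h *
    \sum_(l <- words s n) rho (rcons h e ++ l) / rho (rcons h e) * g (e :: l).
  rewrite mulr_sumr; apply: eq_bigr => l _.
  by rewrite cat_rcons mulrA; congr (_ * _); field; rewrite nz.
rewrite !E; apply: ler_wpM2l => //.
apply: (IH _ (fun l => f (e :: l)) (fun l => f' (e :: l))) => l.
by rewrite cat_rcons => pl sl; apply: ff' => //=; rewrite sl.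
Qed.

End fixed_process.

Lemma after_process rho h : word_process rho -> 0 < rho h ->
  word_process (fun l => rho (h ++ l) / rho h).
Proof.
move=> rhoP h0; have [r0 _ rS rcat] := rhoP; split.
- by move=> l; rewrite divr_ge0.
- by rewrite cats0 divff ?gt_eqF.
- move=> l; rewrite -mulr_suml -(rS (h ++ l)); congr (_ / _).
  by apply: eq_bigr => e _; rewrite rcons_cat.
- by move=> l l'; rewrite ler_wpM2r ?invr_ge0 // catA.
Qed.

Lemma cexp_after rho h l n f : word_process rho -> 0 < rho h ->
  cexp (fun l => rho (h ++ l) / rho h) l n f = cexp rho (h ++ l) n f.
Proof.
move=> rhoP h0; rewrite /cexp; apply: eq_bigr => l' _; rewrite -catA.
have [z|nz] := eqVneq (rho (h ++ l)) 0; first by rewrite z !(mul0r, invr0, mulr0).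
by congr (_ * _); field; rewrite nz gt_eqF.
Qed.

End word_process.

(** * Predictions of two processes with bounded density *)

Section dominated_process.
Variables (R : realType) (A : Type) (s : seq A) (rho Q : seq A -> R) (delta : R).
Hypotheses (rhoP : word_process s rho) (QP : word_process s Q).
Hypotheses (delta_gt0 : 0 < delta) (rhoQ : forall l, delta * rho l <= Q l).

Let density l := rho l / Q l.
Let energy n := \sum_(l <- words s n) Q l * density l ^+ 2.

Let rho_eq0 l : Q l = 0 -> rho l = 0.
Proof.
move=> Q0; apply/eqP; rewrite eq_le (process_ge0 rhoP) andbT.
by rewrite -(pmulr_rle0 _ delta_gt0) -Q0.
Qed.

Let Q_density l : Q l * density l = rho l.
Proof.
have [z|nz] := eqVneq (Q l) 0; first by rewrite rho_eq0 ?z ?mul0r.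
by rewrite /density mulrC divfK.
Qed.

Let density_le l : density l <= delta^-1.
Proof.
have [z|nz] := eqVneq (Q l) 0.
  by rewrite /density z invr0 mulr0 invr_ge0 ltW.
have Q0 : 0 < Q l by rewrite lt0r nz (process_ge0 QP).
by rewrite /density ler_pdivrMr // mulrC ler_pdivlMr // mulrC.
Qed.

(** One factor [density] turns [Q] into [rho], the other is at most 1/delta. *)
Let energy_le n : energy n <= delta^-1.
Proof.
rewrite -[leRHS]mulr1 -(process_nil rhoP) -(sum_continuations [::] n rhoP) mulr_sumr.
apply: ler_sum => l _; rewrite expr2 mulrA Q_density mulrC.
by rewrite ler_wpM2r ?(process_ge0 rhoP).
Qed.

Let energy_ge0 n : 0 <= energy n.
Proof.
by apply: sumr_ge0 => l _; rewrite mulr_ge0 ?sqr_ge0 ?(process_ge0 QP).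
Qed.

(* The density is a martingale under Q, so its increments are orthogonal. *)
Let energy_increment n k :
  \sum_(l <- words s n) \sum_(l' <- words s k)
    Q (l ++ l') * (density (l ++ l') - density l) ^+ 2 =
  energy (n + k) - energy n.
Proof.
rewrite /energy big_words_cat -sumrB; apply: eq_bigr => l _.
rewrite -[X in X * density l ^+ 2](sum_continuations l k QP).
apply/eqP; rewrite -subr_eq0; apply/eqP.
transitivity (- 2 * density l *
    (\sum_(l' <- words s k) rho (l ++ l') -
     \sum_(l' <- words s k) Q (l ++ l') * density l)).
  rewrite mulrBr !mulr_suml !mulr_sumr -!sumrB; apply: eq_bigr => l' _.
  by rewrite -Q_density; ring.
rewrite sum_continuations // -mulr_suml sum_continuations // Q_density.
by rewrite subrr mulr0.
Qed.

(** The number [rho l] times the difference of the two conditional probabilities of [l'] equals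
    [Q (l ++ l')] times the increment of the density. Young's inequality then leaves the energy
    gained between times n and n + k, plus 1/eta. *)
Lemma dominated_cexp_close n k (B eta : R) (f : seq A -> R) :
  0 < eta -> 0 <= B -> (forall l, size l = k -> `|f l| <= B) ->
  \sum_(l <- words s n) rho l * `|cexp s rho l k f - cexp s Q l k f| <=
  B * ((eta * (energy (n + k) - energy n) + eta^-1) / 2).
Proof.
move=> eta0 B0 fB; rewrite -energy_increment.
have -> : eta^-1 = \sum_(l <- words s n) \sum_(l' <- words s k) Q (l ++ l') / eta.
  under eq_bigr do rewrite -mulr_suml sum_continuations //.
  by rewrite -mulr_suml (sum_continuations [::] n QP) (process_nil QP) mul1r.
rewrite mulr_sumr -big_split /= mulr_suml mulr_sumr; apply: ler_sum => l _.
rewrite mulr_sumr -big_split /= mulr_suml mulr_sumr.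
have [z|nz] := eqVneq (rho l) 0.
  rewrite z mul0r; apply: sumr_ge0 => l' _.
  have sq0 := sqr_ge0 (density (l ++ l') - density l).
  have Q0 := process_ge0 QP (l ++ l'); have e0 := ltW eta0.
  by rewrite mulr_ge0 // divr_ge0 // addr_ge0 // ?divr_ge0 // mulr_ge0 // mulr_ge0.
have Qnz : Q l != 0 by apply: contraNneq nz => /rho_eq0 ->.
rewrite -{1}[rho l]ger0_norm ?(process_ge0 rhoP) // -normrM -sumrB mulr_sumr.
apply: le_trans (ler_norm_sum _ _ _) _; apply: ler_words => l' sl'.
rewrite -mulrBl [X in `|X|]mulrA normrM [leLHS]mulrC ler_pM ?fB //.
rewrite (_ : rho l * _ = Q (l ++ l') * (density (l ++ l') - density l)); last first.
  by rewrite [RHS]mulrBr Q_density /density; field; rewrite Qnz.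
rewrite normrM ger0_norm ?(process_ge0 QP) //.
exact/mul_le_sqr/(process_ge0 QP).
Qed.

(** The energies telescope and stay below 1/delta. For [eta] large and then J much larger, the
    average error per block is therefore small. *)
Lemma dominated_drift_close J k (B eta : R) (f : seq A -> R) :
  0 < eta -> 0 <= B -> (forall l, size l = k -> `|f l| <= B) ->
  \sum_(i < J) \sum_(l <- words s (i * k))
    rho l * `|cexp s rho l k f - cexp s Q l k f| <=
  B * ((eta / delta + J%:R / eta) / 2).
Proof.
move=> eta0 B0 fB.
apply: (@le_trans _ _ (\sum_(i < J)
   B * ((eta * (energy (i.+1 * k) - energy (i * k)) + eta^-1) / 2))).
  apply: ler_sum => i _; rewrite mulSn addnC; exact: dominated_cexp_close.
rewrite -mulr_sumr -mulr_suml big_split /= -mulr_sumr sumr_const card_ord.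
rewrite ler_wpM2l // ler_wpM2r ?invr_ge0 // mulr_natl lerD2r ler_wpM2l ?(ltW eta0) //.
rewrite -(big_mkord xpredT (fun i => energy (i.+1 * k) - energy (i * k))).
rewrite (telescope_sumr (fun i => energy (i * k))) //.
by apply: le_trans _ (energy_le (J * k)); rewrite lerBlDr lerDl.
Qed.
End dominated_process.

Definition additive_sum (R : nmodType) (A : Type) (g : A -> R) (l : seq A) : R :=
  \sum_(e <- l) g e.

Lemma additive_sum_cat (R : nmodType) (A : Type) (g : A -> R) (l l' : seq A) :
  additive_sum g (l ++ l') = additive_sum g l + additive_sum g l'.
Proof. by rewrite /additive_sum big_cat. Qed.

Lemma additive_sumN (R : zmodType) (A : Type) (g : A -> R) (l : seq A) :
  additive_sum (fun e => - g e) l = - additive_sum g l.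
Proof. by rewrite /additive_sum sumrN. Qed.

Lemma additive_sum_norm (R : numDomainType) (A : Type) (g : A -> R) B (l : seq A) :
  (forall e, `|g e| <= B) -> `|additive_sum g l| <= (size l)%:R * B.
Proof.
move=> gB; elim: l => [|e l IH]; first by rewrite /additive_sum big_nil normr0 mul0r.
rewrite /additive_sum big_cons /= -add1n natrD mulrDl mul1r.
by apply: le_trans (ler_normD _ _) _; rewrite lerD.
Qed.

(** * Conditional drifts and their extreme values *)

Section drift.
Variables (R : realType) (A : Type) (s : seq A) (rho : seq A -> R).
Hypothesis rhoP : word_process s rho.

Lemma eq_cexp h n (f f' : seq A -> R) :
  (forall l, 0 < rho (h ++ l) -> size l = n -> f l = f' l) ->
  cexp s rho h n f = cexp s rho h n f'.
Proof.
by move=> ff'; apply/eqP; rewrite eq_le !ler_cexp // => l l0 sl; rewrite ff'.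
Qed.

Section one_function.
Variable g : A -> R.

Definition drift k h : R := cexp s rho h k (additive_sum g).

Lemma driftD n k h : drift (n + k) h = drift n h + cexp s rho h n (fun l => drift k (h ++ l)).
Proof.
rewrite /drift cexp_cat // -cexpD //; apply: eq_cexp => l l0 _.
rewrite -[X in _ = X + _](@cexp_cst _ _ s rho rhoP (h ++ l) k) // -cexpD //.
by apply: eq_cexp => l' _ _; rewrite additive_sum_cat.
Qed.

Lemma drift0 h : drift 0 h = 0.
Proof. by rewrite /drift /cexp big_words0 /additive_sum big_nil mulr0. Qed.

Lemma drift_blocks J k h :
  drift (J * k) h = \sum_(i < J) cexp s rho h (i * k) (fun l => drift k (h ++ l)).
Proof.
elim: J => [|J IH]; first by rewrite mul0n drift0 big_ord0.
by rewrite big_ord_recr /= -IH mulSn addnC driftD.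
Qed.


Lemma drift_le_mul J k h U : 0 < rho h ->
  (forall h', 0 < rho h' -> drift k h' <= U) -> drift (J * k) h <= J%:R * U.
Proof.
move=> h0 driftU; rewrite drift_blocks.
apply: (@le_trans _ _ (\sum_(i < J) U)); last first.
  by rewrite sumr_const card_ord mulr_natl.
apply: ler_sum => i _; rewrite -[leRHS](@cexp_cst _ _ s rho rhoP h (i * k)) //.
by apply: ler_cexp => // l l0 _; apply: driftU.
Qed.

Variable B : R.
Hypotheses (B_ge0 : 0 <= B) (gB : forall e, `|g e| <= B).

Lemma drift_bounds k h : 0 < rho h -> - (k%:R * B) <= drift k h <= k%:R * B.
Proof.
move=> h0; apply/andP; split.
  rewrite -[leLHS](@cexp_cst _ _ s rho rhoP h k) //; apply: ler_cexp => // l _ sl.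
  by have := additive_sum_norm l gB; rewrite ler_norml sl => /andP[].
rewrite -[leRHS](@cexp_cst _ _ s rho rhoP h k) //; apply: ler_cexp => // l _ sl.
by have := additive_sum_norm l gB; rewrite ler_norml sl => /andP[].
Qed.

(** The number v is the infimum over k of (sup over h of [drift k h]) / k. Each supremum is then at
    least k v, and some k nearly attains the infimum; [drift_le_mul] later carries that bound to the
    multiples of k. *)
Lemma upper_drift : exists v : R,
  (forall k tau, (0 < k)%N -> 0 < tau ->
     exists2 h, 0 < rho h & k%:R * v - tau < drift k h) /\
  (forall tau, 0 < tau -> exists2 k, (0 < k)%N &
     forall h, 0 < rho h -> drift k h <= k%:R * (v + tau)).
Proof.
have nil0 : 0 < rho [::] by rewrite (process_nil rhoP).
pose values k : R -> Prop := fun x => exists2 h, 0 < rho h & x = drift k h.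
have values_sup k : classical_sets.has_sup (values k).
  split; first by exists (drift k [::]), [::].
  by exists (k%:R * B) => _ [h h0 ->]; case/andP: (drift_bounds k h0).
pose M k := sup (values k).
have MP k h : 0 < rho h -> drift k h <= M k.
  by move=> h0; apply: ub_le_sup; [case: (values_sup k)|exists h].
pose W : R -> Prop := fun x => exists2 k, (0 < k)%N & x = M k / k%:R.
have W_inf : classical_sets.has_inf W.
  split; first by exists (M 1%N / 1%:R), 1%N.
  exists (- B) => _ [k k0 ->]; rewrite ler_pdivlMr ?ltr0n // mulNr mulrC.
  by apply: le_trans (MP k _ nil0); case/andP: (drift_bounds k nil0).
exists (inf W); split=> [k tau k0 tau0|tau tau0].
  have [x [h h0 ->] hx] := sup_adherent tau0 (values_sup k).
  exists h => //; apply: le_lt_trans hx; rewrite lerD2r mulrC -ler_pdivlMr ?ltr0n //.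
  by apply: ge_inf; [case: W_inf|exists k].
have [x [k k0 ->] kx] := inf_adherent tau0 W_inf.
exists k => // h h0; apply: le_trans (MP k h h0) _.
by rewrite mulrC -ler_pdivrMr ?ltr0n // ltW.
Qed.

Variable delta : R.
Hypotheses (delta_gt0 : 0 < delta).
Hypothesis mixing : forall l l', delta * rho l * rho l' <= rho (l ++ l').

(* A history that is nearly optimal over J blocks is nearly optimal on each of
   them. Its law dominates delta * rho, so the blocks stay nearly optimal on
   rho-average; and the two laws predict the block drifts alike. *)
Lemma drift_nil_ge J k (v tau eta : R) : 0 < tau -> 0 < eta ->
  (forall h, 0 < rho h -> drift k h <= k%:R * (v + tau)) ->
  (exists2 h, 0 < rho h & (J * k)%:R * v - k%:R * tau < drift (J * k) h) ->
  (J * k)%:R * v - J%:R * (J.+1%:R * k%:R * tau / delta)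
     - k%:R * B * ((eta / delta + J%:R / eta) / 2) <= drift (J * k) [::].
Proof.
move=> tau0 eta0 driftU [h h0 hJ].
set U := k%:R * (v + tau) in driftU.
pose Q l := rho (h ++ l) / rho h.
have QP : word_process s Q by apply: after_process.
have rhoQ l : delta * rho l <= Q l.
  by rewrite /Q ler_pdivlMr // mulrAC mixing.
have nil0 : 0 < rho [::] by rewrite (process_nil rhoP).
(* The other J - 1 blocks contribute at most U each, and the total falls short of J k v by at most k
   tau. So one block falls short of U by at most J U - J k v + k tau = (J + 1) k tau. *)
have block i : (i < J)%N ->
    cexp s rho h (i * k) (fun l => U - drift k (h ++ l)) <= J.+1%:R * k%:R * tau.
  move=> iJ.
  have JE : (J = i + (1 + (J - i.+1)))%N by rewrite addnA addn1 subnKC.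
  have tot : drift (J * k) h <=
      i%:R * U + (cexp s rho h (i * k) (fun l => drift k (h ++ l)) + (J - i.+1)%:R * U).
    rewrite {1}JE mulnDl mulnDl mul1n driftD lerD ?drift_le_mul //.
    rewrite -[X in _ <= _ + X](@cexp_cst _ _ s rho rhoP h (i * k)) // -cexpD //.
    apply: ler_cexp => // l l0 _; rewrite driftD lerD2l.
    rewrite -[leRHS](@cexp_cst _ _ s rho rhoP (h ++ l) k) //.
    by apply: ler_cexp => // l' l'0 _; apply: drift_le_mul.
  rewrite cexpB cexp_cst // lerBlDl.
  have JU : J%:R * U = i%:R * U + (U + (J - i.+1)%:R * U).
    by rewrite {1}JE !natrD; ring.
  have -> : J.+1%:R * k%:R * tau = J%:R * U - ((J * k)%:R * v - k%:R * tau).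
    by rewrite -natr1 natrM /U; ring.
  lra.
(* The deficits are nonnegative, so passing from [Q] to [rho] costs a factor 1/delta. *)
have block0 i : (i < J)%N ->
    \sum_(l <- words s (i * k)) rho l * (U - drift k (h ++ l)) <=
    J.+1%:R * k%:R * tau / delta.
  move=> iJ; rewrite ler_pdivlMr // mulr_suml.
  apply: le_trans _ (block i iJ); apply: ler_sum => l _.
  have [z|nz] := eqVneq (rho (h ++ l)) 0.
    have -> : rho l = 0.
      apply/eqP; rewrite eq_le (process_ge0 rhoP) andbT.
      by rewrite -(pmulr_rle0 _ delta_gt0); apply: le_trans (rhoQ l) _; rewrite /Q z mul0r.
    by rewrite z !mul0r.
  have l0 : 0 < rho (h ++ l) by rewrite lt0r nz (process_ge0 rhoP).
  by rewrite mulrAC (mulrC (rho l)) ler_wpM2r // subr_ge0 driftU.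
have close := dominated_drift_close rhoP QP delta_gt0 rhoQ J (k := k) eta0
  (mulr_ge0 (ler0n R k) B_ge0) (f := additive_sum g).
have {}close : \sum_(i < J) \sum_(l <- words s (i * k))
    rho l * `|drift k l - drift k (h ++ l)| <=
    k%:R * B * ((eta / delta + J%:R / eta) / 2).
  apply: le_trans _ (close _) => [|l sl]; last by rewrite -sl additive_sum_norm.
  apply: ler_sum => i _; apply: ler_sum => l _.
  by rewrite /drift cexp_after.
rewrite drift_blocks.
have lower (i : 'I_J) : U - J.+1%:R * k%:R * tau / delta -
    \sum_(l <- words s (i * k)) rho l * `|drift k l - drift k (h ++ l)| <=
    cexp s rho [::] (i * k) (fun l => drift k ([::] ++ l)).
  rewrite lerBlDr lerBlDr.
  apply: le_trans _ (lerD (lexx _) (block0 i (ltn_ord i))).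
  rewrite /cexp -!big_split /= (process_nil rhoP).
  rewrite -[leLHS]mul1r -[X in X * _ <= _](process_nil rhoP) -(sum_continuations [::] (i * k) rhoP) mulr_suml.
  apply: ler_sum => l _; rewrite divr1 -!mulrDr ler_wpM2l ?(process_ge0 rhoP) //=.
  have := ler_norm (drift k (h ++ l) - drift k l); rewrite distrC; lra.
apply: le_trans _ (ler_sum _ (fun i _ => lower i)).
rewrite !big_split /= !sumr_const !card_ord sumrN.
have : J%:R * (k%:R * v) <= J%:R * U.
  by rewrite ler_wpM2l // /U ler_wpM2l // lerDl ltW.
rewrite natrM -!mulrA -[U *+ J]mulr_natl -[- _ *+ J]mulr_natl.
lra.
Qed.

End one_function.
End drift.

(** From exp(-x) >= 1 - x follows exp(x) (1 - x) <= 1, while (1 + x + 2x^2)(1 - x) = 1 + x^2 (1 -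
    2x) >= 1. *)
Lemma expR_le_quadratic (R : realType) (x : R) : x <= 1 / 2 ->
  expR x <= 1 + x + 2 * x ^+ 2.
Proof.
move=> x_le; have x1 : 0 < 1 - x by lra.
have /ler_wpM2r : 1 - x <= expR (- x) by have := expR_ge1Dx (- x).
move=> /(_ _ (expR_ge0 x)); rewrite -expRD addNr expR0 mulrC => h.
rewrite -(ler_pM2r x1); apply: le_trans h _; nra.
Qed.

(** * Exponential tails by Chernoff bounds *)

Section concentration.
Variables (R : realType) (A : Type) (s : seq A) (rho : seq A -> R).
Hypothesis rhoP : word_process s rho.
Variable B : R.
Hypothesis B_ge0 : 0 <= B.

Section exponential_moment.
Variable g : A -> R.
Hypothesis gB : forall e, `|g e| <= B.

Lemma cexp_expR_le k h theta U : 0 < rho h -> 0 <= theta ->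
  theta * (k%:R * B) <= 1 / 2 -> drift s rho g k h <= U ->
  cexp s rho h k (fun l => expR (theta * additive_sum g l)) <=
  expR (theta * U + 2 * (theta * (k%:R * B)) ^+ 2).
Proof.
move=> h0 theta0 small driftU; set c := theta * (k%:R * B).
apply: (@le_trans _ _ (cexp s rho h k
    (fun l => 1 + (theta * additive_sum g l + 2 * c ^+ 2)))).
  apply: ler_cexp => // l _ sl.
  have := additive_sum_norm l gB; rewrite sl => /(ler_wpM2l theta0).
  rewrite -/c -{1}[theta]ger0_norm // -normrM => lc.
  have := lc; rewrite ler_norml => /andP[_ lc'].
  apply: le_trans (expR_le_quadratic (le_trans lc' small)) _.
  rewrite -addrA lerD2l lerD2l ler_wpM2l //.
  by rewrite -[leLHS]real_normK ?num_real // lerXn2r ?nnegrE // (le_trans _ lc).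
rewrite !cexpD cexpZ !cexp_cst //; apply: le_trans _ (expR_ge1Dx _).
by rewrite lerD2l lerD2r ler_wpM2l.
Qed.

(** Since the drift bound is uniform over histories, the exponential moments of successive blocks
    multiply as if the blocks were independent. *)
Lemma cexp_expR_blocks n k h theta U : 0 < rho h -> 0 <= theta ->
  theta * (k%:R * B) <= 1 / 2 ->
  (forall h', 0 < rho h' -> drift s rho g k h' <= U) ->
  cexp s rho h (n * k) (fun l => expR (theta * additive_sum g l)) <=
  expR (n%:R * (theta * U + 2 * (theta * (k%:R * B)) ^+ 2)).
Proof.
move=> h0 theta0 small driftU; elim: n h h0 => [|n IH] h h0.
  by rewrite mul0n mul0r /cexp big_words0 cats0 /additive_sum big_nil mulr0
    divff ?mul1r ?gt_eqF.
set c := theta * U + _ in IH *.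
rewrite mulSn cexp_cat //.
apply: (@le_trans _ _ (cexp s rho h k (fun l => expR (n%:R * c) *
    expR (theta * additive_sum g l)))).
  apply: ler_cexp => // l l0 _.
  rewrite (eq_cexp rhoP (f' := fun l' => expR (theta * additive_sum g l) *
    expR (theta * additive_sum g l'))) //; last first.
    by move=> l' _ _; rewrite additive_sum_cat mulrDr expRD.
  by rewrite cexpZ // [leRHS]mulrC ler_wpM2l ?expR_ge0 // IH.
rewrite cexpZ // -natr1 mulrDl mul1r expRD ler_wpM2l ?expR_ge0 //.
exact: cexp_expR_le (driftU h h0).
Qed.

Lemma upper_tail k v eps : (0 < k)%N -> 0 < eps ->
  (forall h, 0 < rho h -> drift s rho g k h <= k%:R * (v + eps / 2)) ->
  exists C c : R, [/\ 0 < C, 0 < c & forall t,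
    \sum_(l <- words s t | t%:R * (v + eps) < additive_sum g l) rho l <=
    C * expR (- c * t%:R)].
Proof.
move=> k0 eps0 driftU.
have kR : 0 < k%:R :> R by rewrite ltr0n.
have nil0 : 0 < rho [::] by rewrite (process_nil rhoP).
(* The first bound gives theta k B <= 1/2, where the quadratic estimate applies; the second makes
   its error 2 (theta k B)^2 at most theta k eps/4. Using B + 1 avoids division by zero. *)
pose theta := Num.min (1 / (2 * k%:R * (B + 1))) (eps / (8 * k%:R * (B + 1) ^+ 2)).
have B1 : 0 < B + 1 by apply: ltr_wpDl.
have theta0 : 0 < theta.
  by rewrite lt_min !divr_gt0 // !mulr_gt0 // exprn_gt0.
have small : theta * (k%:R * B) <= 1 / 2.
  apply: (@le_trans _ _ (theta * (k%:R * (B + 1)))).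
    by rewrite !ler_pM2l // lerDl.
  rewrite -ler_pdivlMr ?mulr_gt0 // ge_min; apply/orP; left.
  by rewrite le_eqVlt; apply/orP; left; apply/eqP; field; rewrite !gt_eqF.
have quad : 2 * (theta * (k%:R * B)) ^+ 2 <= theta * (k%:R * (eps / 4)).
  have h : theta * (8 * k%:R * (B + 1) ^+ 2) <= eps.
    rewrite -ler_pdivlMr ?mulr_gt0 ?exprn_gt0 // ge_min; apply/orP; right.
    by rewrite lexx.
  have -> : 2 * (theta * (k%:R * B)) ^+ 2 =
    theta * (k%:R * (theta * (8 * k%:R * B ^+ 2) / 4)) by field.
  rewrite ler_pM2l // ler_pM2l // ler_pM2r // ?invr_gt0 //.
  apply: le_trans _ h; rewrite ler_pM2l // ler_pM2l ?mulr_gt0 //.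
  by rewrite lerXn2r ?nnegrE // ?lerDl // ltW.
(* The rate per letter: drift v + eps/2 and quadratic error eps/4. The remaining eps/4 up to v + eps
   is the rate of decay. *)
pose w := v + 3 / 4 * eps.
(* The prefactor pays for the incomplete last block: k B for its letters, and k |w| for replacing n
   k by t. *)
exists (expR (theta * k%:R * (B + `|w|))), (theta * eps / 4); split.
- exact: expR_gt0.
- by rewrite divr_gt0 // mulr_gt0.
move=> t; set n := (t %/ k)%N.
have tE : t = (n * k + t %% k)%N by exact: divn_eq.
have rk : (t %% k)%:R <= k%:R :> R by rewrite ler_nat ltnW // ltn_pmod.
have moment : cexp s rho [::] t (fun l => expR (theta * additive_sum g l)) <=
    expR (theta * k%:R * B) * expR (theta * (n%:R * k%:R * w)).
  rewrite tE cexp_cat //.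
  apply: (@le_trans _ _ (cexp s rho [::] (n * k) (fun l => expR (theta * k%:R * B) *
    expR (theta * additive_sum g l)))).
    apply: ler_cexp => // l l0 _.
    rewrite -[leRHS](@cexp_cst _ _ s rho rhoP ([::] ++ l) (t %% k)) //.
    apply: ler_cexp => // l' _ sl'.
    rewrite additive_sum_cat mulrDr expRD mulrC ler_wpM2r ?expR_ge0 //.
    rewrite ler_expR -mulrA ler_wpM2l ?(ltW theta0) //.
    have := additive_sum_norm l' gB; rewrite ler_norml sl' => /andP[_ h].
    by apply: le_trans h _; rewrite ler_wpM2r.
  rewrite cexpZ // ler_wpM2l ?expR_ge0 //.
  apply: le_trans (cexp_expR_blocks n nil0 (ltW theta0) small driftU) _.
  rewrite ler_expR (_ : theta * (n%:R * k%:R * w) =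
    n%:R * (theta * (k%:R * (v + eps / 2)) + theta * (k%:R * (eps / 4)))).
    by rewrite ler_wpM2l // lerD2l.
  by rewrite /w; field.
apply: (@le_trans _ _ (expR (- (theta * (t%:R * (v + eps)))) *
    cexp s rho [::] t (fun l => expR (theta * additive_sum g l)))).
  rewrite /cexp mulr_sumr big_mkcond; apply: ler_sum => l _ /=.
  rewrite (process_nil rhoP) divr1 mulrCA -expRD.
  have r0 := process_ge0 rhoP l.
  case: ifP => [lt|_]; last by rewrite mulr_ge0 ?expR_ge0.
  rewrite -[leLHS]mulr1 ler_wpM2l // -[leLHS]expR0 ler_expR addrC subr_ge0.
  by rewrite ler_wpM2l ?(ltW theta0) ?(ltW lt).
apply: le_trans (ler_wpM2l (expR_ge0 _) moment) _.
rewrite -!expRD ler_expR.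
have nk : n%:R * k%:R = t%:R - (t %% k)%:R :> R.
  by apply/eqP; rewrite eq_sym subr_eq -natrM -natrD -tE.
rewrite nk.
have rw : - ((t %% k)%:R * w) <= k%:R * `|w|.
  apply: (@le_trans _ _ ((t %% k)%:R * `|w|)); last by rewrite ler_wpM2r.
  by rewrite -mulrN ler_wpM2l // -normrN ler_norm.
have := ler_wpM2l (ltW theta0) rw; rewrite /w; lra.
Qed.

End exponential_moment.

Variable g : A -> R.
Hypothesis gB : forall e, `|g e| <= B.
Variable delta : R.
Hypothesis delta_gt0 : 0 < delta.
Hypothesis mixing : forall l l', delta * rho l * rho l' <= rho (l ++ l').

(** Both extreme drifts are compared with the drift of [rho] from the empty history: by
    [drift_nil_ge] for g it is at least about v, and by the same lemma for -g it is at most about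
    -v'. Hence v + v' <= 0. *)
Lemma two_sided_drift : exists v : R, forall eps, 0 < eps ->
  (exists2 k, (0 < k)%N & forall h, 0 < rho h ->
     drift s rho g k h <= k%:R * (v + eps)) /\
  (exists2 k, (0 < k)%N & forall h, 0 < rho h ->
     drift s rho (fun e => - g e) k h <= k%:R * (- v + eps)).
Proof.
have gB' e : `|- g e| <= B by rewrite normrN.
have nil0 : 0 < rho [::] by rewrite (process_nil rhoP).
have [v [near_v below_v]] := upper_drift rhoP gB.
have [v' [near_v' below_v']] := upper_drift rhoP gB'.
suff vv' : v' <= - v.
  exists v => eps eps0; split; first exact: below_v.
  have [k k0 hk] := below_v' _ eps0; exists k => // h h0.
  by apply: le_trans (hk h h0) _; rewrite ler_wpM2l // lerD2r.
apply/ler_addgt0Pr => xi2 xi20; pose xi := xi2 / 2.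
have xi0 : 0 < xi by rewrite divr_gt0.
(* The parameters are fixed in the order [eta], [J], [tau], [k]. The deficit of the near-optimal
   histories becomes half of J k xi through [tau]; the terms J/eta and eta/delta become at most a
   quarter each through [eta] and [J]. *)
pose eta := 2 * (B + 1) / xi.
have B1 : 0 < B + 1 by apply: ltr_wpDl.
have eta0 : 0 < eta by rewrite divr_gt0 // mulr_gt0.
pose J := (Num.truncn (2 * B * eta / (delta * xi))).+1.
pose tau := delta * xi / (2 * J.+1%:R).
have tau0 : 0 < tau by rewrite divr_gt0 // mulr_gt0 // ltr0n.
have [k1 k10 hk1] := below_v _ tau0; have [k2 k20 hk2] := below_v' _ tau0.
(* Each one-sided bound passes to multiples of its block length, so the product serves both. *)
pose k := (k1 * k2)%N; have k0 : (0 < k)%N by rewrite muln_gt0 k10.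
have hk h : 0 < rho h -> drift s rho g k h <= k%:R * (v + tau).
  move=> h0; rewrite /k mulnC natrM -mulrA; exact: drift_le_mul.
have hk' h : 0 < rho h -> drift s rho (fun e => - g e) k h <= k%:R * (v' + tau).
  move=> h0; rewrite /k natrM -mulrA; exact: drift_le_mul.
have J0 : (0 < J)%N by [].
have kt0 : 0 < k%:R * tau by rewrite mulr_gt0 // ltr0n.
have Jk0 : (0 < J * k)%N by rewrite muln_gt0 J0.
have low := drift_nil_ge rhoP B_ge0 gB delta_gt0 mixing tau0 eta0 hk
  (near_v _ _ Jk0 kt0).
have low' := drift_nil_ge rhoP B_ge0 gB' delta_gt0 mixing tau0 eta0 hk'
  (near_v' _ _ Jk0 kt0).
have opp : drift s rho (fun e => - g e) (J * k) [::] = - drift s rho g (J * k) [::].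
  by rewrite /drift -cexpN; apply: eq_bigr => l _; rewrite additive_sumN.
rewrite opp in low'.
have err : J%:R * (J.+1%:R * k%:R * tau / delta) +
    k%:R * B * ((eta / delta + J%:R / eta) / 2) <= (J * k)%:R * xi.
  have e1 : J%:R * (J.+1%:R * k%:R * tau / delta) = (J * k)%:R * (xi / 2).
    by rewrite natrM /tau; field; rewrite gt_eqF //= addrC natr1 pnatr_eq0.
  have e2 : k%:R * B * (J%:R / eta / 2) <= (J * k)%:R * (xi / 4).
    rewrite natrM (_ : k%:R * B * _ = J%:R * k%:R * (B / eta / 2)); last by ring.
    rewrite ler_wpM2l ?mulr_ge0 // /eta.
    have -> : B / (2 * (B + 1) / xi) / 2 = xi / 4 * (B / (B + 1)).
      by field; rewrite !gt_eqF.
    have xi4 : 0 <= xi / 4 by rewrite divr_ge0 // ltW.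
    by rewrite ler_piMr // ler_pdivrMr // mul1r lerDl.
  have e3 : k%:R * B * (eta / delta / 2) <= (J * k)%:R * (xi / 4).
    have : 2 * B * eta / (delta * xi) < J%:R by exact: truncnS_gt.
    rewrite ltr_pdivrMr ?(mulr_gt0 delta_gt0 xi0) // => /ltW hJ.
    have -> : k%:R * B * (eta / delta / 2) = k%:R / (delta * 4) * (2 * B * eta).
      by field; rewrite gt_eqF.
    have -> : (J * k)%:R * (xi / 4) = k%:R / (delta * 4) * (J%:R * (delta * xi)).
      by rewrite natrM; field; rewrite gt_eqF.
    by rewrite ler_wpM2l // divr_ge0 // mulr_ge0 // ltW.
  move: e1 e2 e3; lra.
have Jk : 0 < (J * k)%:R :> R by rewrite ltr0n.
rewrite -(ler_pM2l Jk) mulrDr mulrN.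
have -> : xi2 = 2 * xi by rewrite /xi; field.
move: low low' err; lra.
Qed.

Theorem word_concentration : exists v : R, forall eps, 0 < eps ->
  exists C c : R, [/\ 0 < C, 0 < c & forall t,
    \sum_(l <- words s t | t%:R * eps < `|additive_sum g l - t%:R * v|) rho l <=
    C * expR (- c * t%:R)].
Proof.
have gB' e : `|- g e| <= B by rewrite normrN.
have [v driftP] := two_sided_drift.
exists v => eps eps0; have eps2 : 0 < eps / 2 by rewrite divr_gt0.
have [[k k0 hk] [k' k'0 hk']] := driftP _ eps2.
have [C [c [C0 c0 tail]]] := upper_tail gB k0 eps0 hk.
have [C' [c' [C'0 c'0 tail']]] := upper_tail gB' k'0 eps0 hk'.
exists (C + C'), (Num.min c c'); split; [exact: addr_gt0 | by rewrite lt_min c0 |].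
move=> t.
have decay (x : R) : Num.min c c' <= x -> expR (- x * t%:R) <= expR (- Num.min c c' * t%:R).
  by move=> cx; rewrite ler_expR !mulNr lerN2 ler_wpM2r.
apply: (@le_trans _ _ (C * expR (- c * t%:R) + C' * expR (- c' * t%:R))); last first.
  by rewrite mulrDl lerD // ler_pM2l // decay // ge_min lexx ?orbT.
apply: le_trans _ (lerD (tail t) (tail' t)).
rewrite big_mkcond [X in _ <= X + _]big_mkcond [X in _ <= _ + X]big_mkcond.
rewrite -big_split; apply: ler_sum => l _ /=.
have r0 := process_ge0 rhoP l.
case: ifP => [|_]; last by rewrite addr_ge0 //; case: ifP.
rewrite ltr_normr additive_sumN => /orP[lt|lt].
  rewrite ifT; last by rewrite mulrDr -ltrBrDl.
  by rewrite lerDl; case: ifP.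
rewrite [X in _ + X]ifT; last first.
  by move: lt; rewrite mulrDr mulrN opprB; lra.
by rewrite lerDr; case: ifP.
Qed.

End concentration.

(** * Unions of independent random sets *)

Section random_union.
Variables (R : realType) (T : finType).
Implicit Types (L : seq (R * {set T})) (f g : {set T} -> R) (S U V Z : {set T}).

Definition mass L : R := \sum_(x <- L) x.1.

(* Each [(w, S)] of L is present independently with probability
   [1 - expR (- w)]; [union_mean L f] is the mean of f at the union of the sets
   that are present, and [union_sum] is this mean without its normalisation. *)
Fixpoint union_sum L f : R :=
  if L is x :: L' then
    union_sum L' f + (expR x.1 - 1) * union_sum L' (fun U => f (x.2 :|: U))
  else f set0.

Definition union_mean L f : R := expR (- mass L) * union_sum L f.

Definition nonneg_weights L := all (fun x => 0 <= x.1) L.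

Lemma mass_cons x L : mass (x :: L) = x.1 + mass L.
Proof. by rewrite /mass big_cons. Qed.

Lemma mass_ge0 L : nonneg_weights L -> 0 <= mass L.
Proof. by move=> /allP w0; rewrite /mass big_seq sumr_ge0. Qed.

Lemma nonneg_filter (a : pred _) L : nonneg_weights L -> nonneg_weights (filter a L).
Proof. by move=> w0; rewrite /nonneg_weights all_filter; apply: sub_all w0 => x /= x0; rewrite x0 implybT. Qed.

Lemma nonneg_map (h : {set T} -> {set T}) L :
  nonneg_weights L -> nonneg_weights [seq (x.1, h x.2) | x <- L].
Proof. by rewrite /nonneg_weights all_map. Qed.

Let expB1_ge0 (w : R) : 0 <= w -> 0 <= expR w - 1.
Proof. by move=> w0; rewrite subr_ge0 -[leLHS]expR0 ler_expR. Qed.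

(* P is any property of sets that the possible values of the union share. *)
Section closed.
Variable P : pred {set T}.
Hypotheses (P0 : P set0) (PU : forall S U, P S -> P U -> P (S :|: U)).

Lemma eq_union_sum_in L f g : all (fun x => P x.2) L ->
  (forall U, P U -> f U = g U) -> union_sum L f = union_sum L g.
Proof.
elim: L f g => [|x L IH] f g /=; first by move=> _; apply.
move=> /andP[Px PL] fg; rewrite (IH f g) //; congr (_ + _ * _).
by apply: IH => // U PU'; apply/fg/PU.
Qed.

Lemma ler_union_sum_in L f g : nonneg_weights L -> all (fun x => P x.2) L ->
  (forall U, P U -> f U <= g U) -> union_sum L f <= union_sum L g.
Proof.
elim: L f g => [|x L IH] f g /=; first by move=> _ _; apply.
move=> /andP[x0 w0] /andP[Px PL] fg; rewrite lerD ?IH //.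
rewrite ler_wpM2l ?expB1_ge0 // IH // => U PU'.
exact/fg/PU.
Qed.
End closed.

Lemma eq_union_sum L f g : f =1 g -> union_sum L f = union_sum L g.
Proof. by move=> fg; apply: (@eq_union_sum_in xpredT) => //; rewrite all_predT. Qed.

Lemma ler_union_sum L f g : nonneg_weights L ->
  (forall U, f U <= g U) -> union_sum L f <= union_sum L g.
Proof. by move=> w0 fg; apply: (@ler_union_sum_in xpredT) => //; rewrite all_predT. Qed.

Lemma union_sumD L f g :
  union_sum L (fun U => f U + g U) = union_sum L f + union_sum L g.
Proof. by elim: L f g => //= x L IH f g; rewrite !IH; ring. Qed.

Lemma union_sumZ L c f : union_sum L (fun U => c * f U) = c * union_sum L f.
Proof. by elim: L f => //= x L IH f; rewrite !IH; ring. Qed.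

Lemma union_sum_sum L (I : Type) (r : seq I) (P : pred I) (F : I -> {set T} -> R) :
  union_sum L (fun U => \sum_(i <- r | P i) F i U) =
  \sum_(i <- r | P i) union_sum L (F i).
Proof.
elim: L F => //= x L IH F; rewrite !IH mulr_sumr -big_split.
by [].
Qed.

Lemma union_sum_ge0 L f : nonneg_weights L -> (forall U, 0 <= f U) ->
  0 <= union_sum L f.
Proof.
elim: L f => [|x L IH] f /= => [_|/andP[x0 w0] f0]; first exact.
by rewrite addr_ge0 ?IH // mulr_ge0 ?expB1_ge0 ?IH.
Qed.

Lemma union_sum_cat L1 L2 f :
  union_sum (L1 ++ L2) f = union_sum L1 (fun U => union_sum L2 (fun V => f (U :|: V))).
Proof.
elim: L1 f => [|x L1 IH] f /=.
  by apply: eq_union_sum => U; rewrite set0U.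
rewrite !IH; congr (_ + _ * _).
by apply: eq_union_sum => U; apply: eq_union_sum => V; rewrite setUA.
Qed.

(** Only sets inside V may be present, and each of them contributes 1 + (exp w - 1) = exp w. *)
Lemma union_sum_subset L V : union_sum L (fun U => (U \subset V)%:R) =
  expR (\sum_(x <- L | x.2 \subset V) x.1).
Proof.
elim: L => [|x L IH] /=; first by rewrite sub0set big_nil expR0.
under [X in _ * X]eq_union_sum do rewrite subUset.
rewrite big_cons; case: ifP => xV /=; first by rewrite IH expRD; ring.
rewrite IH (_ : union_sum _ _ = 0) ?mulr0 ?addr0 //.
rewrite -[RHS](mul0r (union_sum L (fun=> 0))) -union_sumZ.
by apply: eq_union_sum => U; rewrite mul0r.
Qed.

(** Moebius inversion: the value at V is a subset sum minus values at proper subsets, which agree by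
    induction on the cardinality. *)
Lemma subset_sums_inj (m m' : {set T} -> R) :
  (forall V, \sum_(W : {set T} | W \subset V) m W = \sum_(W : {set T} | W \subset V) m' W) ->
  m =1 m'.
Proof.
move=> mm' V; have [n] := ubnP #|V|; elim: n V => // n IH V Vn.
have := mm' V; rewrite (bigD1 V) //= [in RHS](bigD1 V) //=.
rewrite (eq_bigr m'); first by move/addIr.
move=> W; rewrite andbC -properEneq => WV; apply: IH.
by rewrite (leq_trans (proper_card WV)).
Qed.

Lemma union_sum_expand L f :
  union_sum L f = \sum_(W : {set T}) f W * union_sum L (fun U => (U == W)%:R).
Proof.
under eq_bigr do rewrite -union_sumZ; rewrite -union_sum_sum.
apply: eq_union_sum => U; rewrite (bigD1 U) //= eqxx mulr1 big1 ?addr0 //.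
by move=> W; rewrite eq_sym => /negbTE ->; rewrite mulr0.
Qed.

Lemma sum_subset_indicator U V :
  \sum_(W : {set T} | W \subset V) ((U == W)%:R : R) = (U \subset V)%:R.
Proof.
case: (boolP (U \subset V)) => UV.
  rewrite (bigD1 U) //= eqxx big1 ?addr0 // => W /andP[_].
  by rewrite eq_sym => /negbTE ->.
rewrite big1 // => W WV; case: eqP => // UW.
by rewrite UW WV in UV.
Qed.

(** By [union_sum_subset] these sums determine the containment sums of the law of the union, hence
    the law itself. Lists may thus be permuted, merged or split like superposed Poisson families. *)
Lemma union_sum_law L1 L2 f :
  (forall V, \sum_(x <- L1 | x.2 \subset V) x.1 = \sum_(x <- L2 | x.2 \subset V) x.1) ->
  union_sum L1 f = union_sum L2 f.
Proof.
move=> LL; rewrite !union_sum_expand; apply: eq_bigr => W _; congr (_ * _).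
move: W; apply: subset_sums_inj => V; rewrite -!union_sum_sum.
by rewrite !(eq_union_sum _ (g := fun U => (U \subset V)%:R)) ?union_sum_subset ?LL //
  => U; apply: sum_subset_indicator.
Qed.

Lemma union_sum_perm L1 L2 f : perm_eq L1 L2 -> union_sum L1 f = union_sum L2 f.
Proof. by move=> LL; apply: union_sum_law => V; apply: perm_big. Qed.

(** A union avoids Z exactly when all its members do, so the constraint merely deletes sets from the
    list. *)
Lemma union_sum_avoid Z L f :
  union_sum L (fun U => [disjoint U & Z]%:R * f U) =
  union_sum [seq x : R * {set T} <- L | [disjoint x.2 & Z]] f.
Proof.
elim: L f => [|x L IH] f /=; first by rewrite disjoints_subset sub0set mul1r.
rewrite IH; case: ifP => /= xZ.
  congr (_ + _ * _); rewrite -IH; apply: eq_union_sum => U.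
  by congr (_%:R * _); rewrite !disjoints_subset subUset -disjoints_subset xZ.
rewrite (_ : union_sum L _ = 0) ?mulr0 ?addr0 //.
rewrite -[RHS](mul0r (union_sum L (fun=> 0))) -union_sumZ.
apply: eq_union_sum => U.
by rewrite disjoints_subset subUset -disjoints_subset xZ !mul0r.
Qed.

Lemma union_sum_const L c : union_sum L (fun=> c) = expR (mass L) * c.
Proof.
elim: L c => [|x L IH] c /=; first by rewrite /mass big_nil expR0 mul1r.
by rewrite IH mass_cons expRD; ring.
Qed.

Lemma union_sum_set0 L f : all (fun x : R * {set T} => x.2 == set0) L ->
  union_sum L f = expR (mass L) * f set0.
Proof.
move=> L0; rewrite -union_sum_const.
apply: (@eq_union_sum_in (pred1 set0)) => //= [S U /eqP-> /eqP->|U /eqP -> //].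
by rewrite setU0.
Qed.

Lemma union_sum_sub (a : pred _) L f : nonneg_weights L -> (forall U, 0 <= f U) ->
  union_sum (filter a L) f <= union_sum L f.
Proof.
elim: L f => //= x L IH f /andP[x0 w0] f0.
case: ifP => _ /=; first by rewrite lerD ?IH // ler_wpM2l ?expB1_ge0 ?IH.
by rewrite -[leLHS]addr0 lerD ?IH // mulr_ge0 ?expB1_ge0 ?union_sum_ge0.
Qed.

(** Every nonempty choice of sets has u in its union, where f vanishes. *)
Lemma union_sum_hit (u : T) L f : all (fun x : R * {set T} => u \in x.2) L ->
  (forall U, u \in U -> f U = 0) -> union_sum L f = f set0.
Proof.
elim: L f => //= x L IH f /andP[ux uL] f0; rewrite (IH f) //.
rewrite (IH (fun U => _)) //; last by move=> U uU; rewrite f0 // inE uU orbT.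
by rewrite setU0 (f0 x.2) // mulr0 addr0.
Qed.

Definition scale_weights (c : R) L := [seq (c * x.1, x.2) | x <- L].

(** Convexity of exp: the tangent at c w, evaluated at w and at 0, is averaged with weights c and 1
    - c. *)
Lemma expB1_scale (c w : R) : 0 <= c <= 1 -> 0 <= w ->
  expR (c * w) - 1 <= c * (expR w - 1).
Proof.
move=> /andP[c0 c1] w0; set e := expR (c * w).
have e0 : 0 <= e by exact: expR_ge0.
have h1 : e * (1 + (1 - c) * w) <= expR w.
  have -> : w = c * w + (1 - c) * w by ring.
  by rewrite expRD ler_wpM2l // -/e (_ : c * w + _ = w) ?expR_ge1Dx //; ring.
have h2 : e * (1 - c * w) <= 1.
  rewrite -[leRHS]expR0 -(subrr (c * w)) expRB -expRN ler_wpM2l //.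
  exact: (expR_ge1Dx (- (c * w))).
have := lerD (ler_wpM2l c0 h1) (ler_wpM2l (_ : 0 <= 1 - c) h2).
rewrite subr_ge0 => /(_ c1); rewrite mulr1.
have -> : c * (e * (1 + (1 - c) * w)) + (1 - c) * (e * (1 - c * w)) = e by ring.
lra.
Qed.

(** The choice of no set contributes [f set0]. Any other choice has a factor exp(c w) - 1 <= c (exp
    w - 1), and its further factors only grow with the weights. *)
Lemma union_sum_scale c L f : 0 <= c <= 1 -> nonneg_weights L -> (forall U, 0 <= f U) ->
  union_sum (scale_weights c L) f - f set0 <= c * (union_sum L f - f set0).
Proof.
move=> c01; have /andP[c0 c1] := c01.
elim: L f => [|x L IH] f /= => [_ _|/andP[x0 w0] f0]; first by rewrite !subrr mulr0.
have le_scale g : (forall U, 0 <= g U) -> union_sum (scale_weights c L) g <= union_sum L g.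
  elim: (L) w0 g {IH} => [|y M IH] //= /andP[y0 w0] g g0.
  rewrite lerD ?IH // ler_pM ?expB1_ge0 ?mulr_ge0 ?IH //.
    by rewrite union_sum_ge0 // /nonneg_weights all_map; apply: sub_all w0 => z z0 /=; rewrite mulr_ge0.
  by rewrite lerD2r ler_expR ler_piMl.
rewrite addrAC [X in c * X]addrAC mulrDr lerD ?IH //.
rewrite mulrA ler_pM ?expB1_scale ?le_scale ?expB1_ge0 ?mulr_ge0 //.
by rewrite union_sum_ge0 // /nonneg_weights all_map; apply: sub_all w0 => z z0 /=; rewrite mulr_ge0.
Qed.

End random_union.

Lemma union_sum_map (R : realType) (T T' : finType) (h : {set T} -> {set T'})
    (L : seq (R * {set T})) (f : {set T'} -> R) :
  h set0 = set0 -> {morph h : S U / S :|: U} ->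
  union_sum [seq (x.1, h x.2) | x <- L] f = union_sum L (f \o h).
Proof.
move=> h0 hU; elim: L f => [|x L IH] f /=; first by rewrite h0.
rewrite !IH; congr (_ + _ * _).
by apply: eq_union_sum => U /=; rewrite hU.
Qed.

Lemma perm_filter3 (X : eqType) (a b : pred X) (s : seq X) :
  perm_eq s ([seq x <- s | ~~ a x] ++ [seq x <- s | a x && ~~ b x] ++
             [seq x <- s | a x && b x]).
Proof.
apply/permP => q; rewrite !count_cat !count_filter.
elim: s => //= x s ->; case: (a x); case: (b x); case: (q x) => //=;
  by rewrite ?add0n ?add1n ?addnS ?addSn.
Qed.

(** * Discarding bridging sets by successive truncation *)

Section truncation.
Variables (R : realType) (T : finType).
Implicit Types (L : seq (R * {set T})) (f : {set T} -> R) (S U V K O Z : {set T}).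
Implicit Types (D : pred {set T}) (c : T -> R) (u : T).

Definition covers O U : R := (O \subset U)%:R.

(** D will select the sets that meet the other half of the time axis. Shrinking K from the whole
    pattern to the empty set removes exactly these sets. *)
Definition truncate D K S := if D S then S :&: K else S.

Definition truncate_list D K L := [seq (x.1, truncate D K x.2) | x <- L].

(* Given that a set of L contains u, the event D has probability p and is
   independent of the trace on K. *)
Definition independent_past L D K u (p : R) :=
  forall V, \sum_(x <- L | [&& u \in x.2, D x.2 & x.2 :&: K \subset V]) x.1 =
    p * \sum_(x <- L | (u \in x.2) && (x.2 :&: K \subset V)) x.1.

Lemma covers_mono O U V : U \subset V -> covers O U <= covers O V.
Proof.
move=> UV; rewrite /covers ler_nat; case: (boolP (O \subset U)) => // OU.
by rewrite (subset_trans OU UV).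
Qed.

(** Removing u from the D-sets matters only if no other set covers u. On K, the D-sets through u
    look like all sets through u with weights scaled by p, so at most p times the weight of covering
    O is lost. *)
Lemma truncation_step L D K u O p : u \notin K ->
  nonneg_weights L -> 0 <= p <= 1 -> independent_past L D K u p ->
  (1 - p) * union_sum (truncate_list D (u |: K) L) (covers O) <=
  union_sum (truncate_list D K L) (covers O).
Proof.
move=> uK w0 p01 indep.
pose L0 := [seq x : R * {set T} <- L | u \notin x.2].
pose N := [seq x : R * {set T} <- L | (u \in x.2) && ~~ D x.2].
pose Nd := [seq x : R * {set T} <- L | (u \in x.2) && D x.2].
pose Du := [seq (x.1, u |: (x.2 :&: K)) | x <- Nd].
pose L0' := truncate_list D K L0.
have perm_parts : perm_eq L (L0 ++ N ++ Nd).
  exact: perm_filter3.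
have N_nonneg : nonneg_weights N by exact: nonneg_filter.
have Du_nonneg : nonneg_weights Du.
  by apply: (nonneg_map (fun S => u |: (S :&: K))); apply: nonneg_filter.
have L0'_nonneg : nonneg_weights L0' by apply: nonneg_map; apply: nonneg_filter.
have truncate_N K' : truncate_list D K' N = N.
  rewrite -[RHS]map_id; apply/eq_in_map => -[w S].
  by rewrite mem_filter /truncate /= => /andP[/andP[_ /negbTE ->]].
(* The weight of covering O when the D-sets through u are cut to [u |: K], and in [Fk] to [K]; [U0]
   is the union of the sets that miss u. *)
pose Fu U0 := union_sum N (fun U1 => union_sum Du (fun U2 => covers O (U0 :|: (U1 :|: U2)))).
pose Fk U0 := union_sum N (fun U1 =>
  union_sum Du (fun U2 => covers O (U0 :|: (U1 :|: (U2 :\ u))))).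
have -> : union_sum (truncate_list D (u |: K) L) (covers O) = union_sum L0' Fu.
  rewrite (union_sum_perm _ (perm_map _ perm_parts)) !map_cat -!/(truncate_list _ _ _).
  rewrite truncate_N union_sum_cat.
  have -> : truncate_list D (u |: K) L0 = L0'.
    apply/eq_in_map => -[w S]; rewrite mem_filter /= => /andP[uS _].
    rewrite /truncate; case: ifP => // _; congr (_, _).
    by rewrite setIUr (_ : S :&: [set u] = set0) ?set0U //; apply/setP => t;
      rewrite !inE andbC; case: eqP => //= ->; apply/negbTE.
  have -> : truncate_list D (u |: K) Nd = Du.
    apply/eq_in_map => -[w S]; rewrite mem_filter /= => /andP[/andP[uS DS] _].
    rewrite /truncate DS setIUr; congr (_, _ :|: _).
    by apply/setP => t; rewrite !inE andbC; case: eqP => // ->.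
  by apply: eq_union_sum => U0; rewrite union_sum_cat.
have -> : union_sum (truncate_list D K L) (covers O) = union_sum L0' Fk.
  rewrite (union_sum_perm _ (perm_map _ perm_parts)) !map_cat -!/(truncate_list _ _ _).
  rewrite truncate_N union_sum_cat.
  apply: eq_union_sum => U0; rewrite union_sum_cat.
  apply: eq_union_sum => U1.
  have -> : truncate_list D K Nd =
      [seq (x.1, x.2 :\ u) | x <- Du].
    rewrite -map_comp; apply/eq_in_map => -[w S]; rewrite mem_filter /= => /andP[/andP[uS DS] _].
    by rewrite /truncate DS setU1K // inE (negbTE uK) andbF.
  rewrite (union_sum_map (h := fun S => S :\ u)) ?set0D // => S U.
  by rewrite setDUl.
have Fk_close U0 : (1 - p) * Fu U0 <= Fk U0.
  pose h U2 : R := (u \in U2)%:R * covers O (U0 :|: U2).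
  have h0 U : 0 <= h U by rewrite mulr_ge0.
  pose Ru := [seq (x.1, u |: (x.2 :&: K)) | x <- N] ++ Du.
  have Ru_nonneg : nonneg_weights Ru.
    rewrite /nonneg_weights all_cat -/(nonneg_weights Du) Du_nonneg andbT.
    by apply: (nonneg_map (fun S => u |: (S :&: K))).
  (* Once a set of [N] is present it covers u and the two cuts agree, so only the empty choice from
     [N] counts. *)
  have diff : Fu U0 - Fk U0 <= union_sum Du h.
    have -> : Fu U0 - Fk U0 = union_sum N (fun U1 => union_sum Du (fun U2 =>
        covers O (U0 :|: (U1 :|: U2)) - covers O (U0 :|: (U1 :|: (U2 :\ u))))).
      rewrite -[- Fk U0]mulN1r -union_sumZ -union_sumD; apply: eq_union_sum => U1.
      by rewrite -union_sumZ -union_sumD; apply: eq_union_sum => U2; rewrite mulN1r.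
    rewrite (@union_sum_hit _ _ u); last 2 first.
    - by apply/allP => -[w S]; rewrite mem_filter /= => /andP[/andP[]].
    - move=> U uU; rewrite -[RHS](mul0r (union_sum Du (fun=> 0))) -union_sumZ.
      apply: eq_union_sum => U2; rewrite mul0r (_ : U :|: (U2 :\ u) = U :|: U2) ?subrr //.
      apply/setP => t; rewrite !inE; case: (t =P u) => [->|] //=.
      by rewrite uU.
    apply: ler_union_sum => // U2; rewrite !set0U /h.
    case: (boolP (u \in U2)) => uU2; first by rewrite mul1r lerBlDr lerDl.
    rewrite mul0r (_ : U2 :\ u = U2) ?subrr //; apply/setP => t; rewrite !inE.
    by case: (t =P u) => // ->; rewrite (negbTE uU2).
  (* Independence enters here: the traces of the D-sets through u carry p times the weight of those
     of all sets through u. *)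
  have law : union_sum Du h = union_sum (scale_weights p Ru) h.
    apply: union_sum_law => V; rewrite /scale_weights !big_map /Ru big_cat /= !big_map.
    rewrite -mulr_sumr -mulr_sumr -mulrDr !big_filter_cond /=.
    under eq_bigl do rewrite subUset sub1set.
    under [X in p * (X + _)]eq_bigl do rewrite subUset sub1set.
    case: (boolP (u \in V)) => uV; last first.
      by rewrite !big_pred0 ?addr0 ?mulr0 // => x; rewrite andbF.
    have := indep V.
    rewrite [X in _ = p * X](bigID (fun x : R * {set T} => D x.2)) /= addrC => e.
    rewrite (eq_bigl (fun x : R * {set T} => [&& u \in x.2, D x.2 & x.2 :&: K \subset V]));
      last by move=> x; rewrite /= andbA.
    rewrite [LHS]e; congr (p * (_ + _)); apply: eq_bigl => x; rewrite /= -!andbA;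
      by do !bool_congr.
  have hset0 : h set0 = 0 by rewrite /h inE mul0r.
  have scale : union_sum (scale_weights p Ru) h <= p * union_sum Ru h.
    by have := union_sum_scale p01 Ru_nonneg h0; rewrite hset0 !subr0.
  (* In [Ru] the sets of [N] are cut to [u |: K]; restoring them can only help to cover O. *)
  have merge : union_sum Ru h <= Fu U0.
    rewrite /Ru union_sum_cat.
    have -> : [seq (x.1, u |: (x.2 :&: K)) | x <- N] = [seq (x.1, x.2 :&: (u |: K)) | x <- N].
      apply/eq_in_map => -[w S]; rewrite mem_filter /= => /andP[/andP[uS _] _].
      by congr (_, _); apply/setP => t; rewrite !inE; case: (t =P u) => //= ->; rewrite uS.
    rewrite (union_sum_map (h := fun S => S :&: (u |: K))) ?set0I //; last first.
      by move=> S U; rewrite setIUl.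
    apply: ler_union_sum => // U1; apply: ler_union_sum => // U2; rewrite /h /=.
    apply: (@le_trans _ _ (covers O (U0 :|: (U1 :&: (u |: K) :|: U2)))).
      by rewrite ler_piMl // lern1; case: (_ \in _).
    by apply: covers_mono; rewrite setUS // setSU // subsetIl.
  have /andP[p0 _] := p01.
  have := ler_wpM2l p0 merge; rewrite law in diff.
  by rewrite mulrBl mul1r => h1; lra.
rewrite -union_sumZ; exact: ler_union_sum.
Qed.
End truncation.

Section patterns.
Variables (R : realType) (T : finType).
Implicit Types (L : seq (R * {set T})) (f : {set T} -> R) (S U V K O Z : {set T}).
Implicit Types (D : pred {set T}) (c : T -> R) (u : T).

(** The sites are removed from the last to the first. When u is removed, the D-sets have already
    been cut to [u] and [pre], so independence is required of the trace on [pre] only. *)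
Lemma truncation_chain L D O c (us : seq T) : uniq us -> nonneg_weights L ->
  (forall u, 0 <= c u <= 1) ->
  (forall pre u post, us = pre ++ u :: post ->
     independent_past L D [set x in pre] u (c u)) ->
  (\prod_(u <- us) (1 - c u)) *
    union_sum (truncate_list D [set x in us] L) (covers R O) <=
  union_sum (truncate_list D set0 L) (covers R O).
Proof.
move=> + w0 c01; elim/last_ind: us => [_ _|us u IH].
  rewrite big_nil mul1r le_eqVlt; apply/orP; left; apply/eqP.
  by congr (union_sum (truncate_list _ _ _) _); apply/setP => x; rewrite !inE.
rewrite rcons_uniq => /andP[u_us us_uniq] indep.
have {}IH := IH us_uniq.
rewrite -cats1 big_cat big_seq1 -mulrA.
have c1 v : 0 <= 1 - c v by have /andP[_] := c01 v; rewrite subr_ge0.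
apply: le_trans _ (IH _); last first.
  by move=> pre v post e; apply: (indep _ _ (rcons post u)); rewrite e rcons_cat.
apply: ler_wpM2l; first by apply: prodr_ge0.
have -> : [set x in us ++ [:: u]] = u |: [set x in us].
  by apply/setP => x; rewrite !inE mem_cat inE orbC.
apply: truncation_step => //; first by rewrite inE.
by apply: (indep us u [::]); rewrite cats1.
Qed.

Definition pattern S V U : R := (U :&: S == V)%:R.

Lemma patternE S V U : V \subset S ->
  pattern S V U = [disjoint U & S :\: V]%:R * covers R V U.
Proof.
move=> VS; rewrite /pattern /covers -natrM mulnb; congr (nat_of_bool _)%:R.
apply/eqP/andP => [<-|[UZ VU]].
  split; last by rewrite subsetIl.
  rewrite -setI_eq0; apply/eqP/setP => x; rewrite !inE.
  by case: (x \in U); case: (x \in S).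
apply/eqP; rewrite eqEsubset subsetI VU VS !andbT.
apply/subsetP => x; rewrite inE => /andP[xU xS]; apply/negPn/negP => xV.
by move/disjointFr: UZ => /(_ _ xU); rewrite !inE xS xV.
Qed.

Lemma pattern_ge0 S V U : 0 <= pattern S V U. Proof. exact: ler0n. Qed.

Lemma mass_filterC (a : pred (R * {set T})) L :
  mass L = mass (filter a L) + mass (filter (predC a) L).
Proof.
by rewrite /mass -big_cat; apply: perm_big; rewrite perm_sym; apply/permPl/perm_filterC.
Qed.

Lemma union_sum_filterC (a : pred (R * {set T})) L f :
  union_sum L f =
  union_sum (filter a L) (fun U => union_sum (filter (predC a) L) (fun V => f (U :|: V))).
Proof.
rewrite -union_sum_cat; apply: union_sum_perm; rewrite perm_sym.
exact/permPl/perm_filterC.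
Qed.

Lemma union_mean_filterC (a : pred (R * {set T})) L f :
  union_mean L f =
  union_mean (filter a L) (fun U => union_mean (filter (predC a) L) (fun V => f (U :|: V))).
Proof.
rewrite /union_mean (mass_filterC a) (union_sum_filterC a) opprD expRD -mulrA.
by rewrite -union_sumZ.
Qed.

Lemma union_mean_const L (x : R) : union_mean L (fun=> x) = x.
Proof. by rewrite /union_mean union_sum_const mulrA -expRD addNr expR0 mul1r. Qed.

Lemma union_mean_ge0 L f : nonneg_weights L -> (forall U, 0 <= f U) -> 0 <= union_mean L f.
Proof. by move=> w0 f0; rewrite mulr_ge0 ?expR_ge0 ?union_sum_ge0. Qed.

Lemma union_meanZ L (x : R) f : union_mean L (fun U => x * f U) = x * union_mean L f.
Proof. by rewrite /union_mean union_sumZ mulrCA. Qed.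

Lemma eq_union_mean_in (P : pred {set T}) L f g : P set0 ->
  (forall S U, P S -> P U -> P (S :|: U)) -> all (fun x => P x.2) L ->
  (forall U, P U -> f U = g U) -> union_mean L f = union_mean L g.
Proof. by move=> P0 PU PL fg; rewrite /union_mean (eq_union_sum_in P0 PU PL fg). Qed.

Lemma eq_union_mean L f g : f =1 g -> union_mean L f = union_mean L g.
Proof. by move=> fg; rewrite /union_mean (eq_union_sum L fg). Qed.

Lemma union_mean_set0 L f : all (fun x : R * {set T} => x.2 == set0) L ->
  union_mean L f = f set0.
Proof.
move=> L0; rewrite -[RHS](union_mean_const L).
apply: (@eq_union_mean_in (pred1 set0)) => //= [S U /eqP-> /eqP->|U /eqP -> //].
by rewrite setU0.
Qed.

(** The sites of S outside V delete sets from the list, and covering V is left to the truncation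
    chain. The D-sets end up empty and leave a factor exp of their mass, which the change of
    normalisation compensates. *)
Lemma pattern_without L D V c (us : seq T) :
  uniq us -> nonneg_weights L -> (forall u, 0 <= c u <= 1) ->
  V \subset [set x in us] ->
  (forall pre u post, us = pre ++ u :: post ->
     independent_past
       [seq x : R * {set T} <- L | [disjoint x.2 & [set x in us] :\: V]]
       D [set x in pre] u (c u)) ->
  (\prod_(u <- us) (1 - c u)) * union_mean L (pattern [set x in us] V) <=
  union_mean [seq x : R * {set T} <- L | ~~ D x.2] (pattern [set x in us] V).
Proof.
move=> us_uniq w0 c01; set S := [set x in us] => VS indep.
set LZ := filter _ L in indep.
have LZ_nonneg : nonneg_weights LZ by exact: nonneg_filter.
have := truncation_chain V us_uniq LZ_nonneg c01 indep; rewrite -/S.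
have -> : union_sum (truncate_list D S LZ) (covers R V) = union_sum LZ (covers R V).
  have capS L' : union_sum L' (covers R V) =
      union_sum [seq (x.1, x.2 :&: S) | x <- L'] (covers R V).
    rewrite (union_sum_map (h := fun U => U :&: S)) ?set0I => [|//|U U'].
      by apply: eq_union_sum => U; rewrite /covers /= subsetI VS andbT.
    by rewrite setIUl.
  rewrite capS [RHS]capS -map_comp; congr union_sum; apply: eq_map => -[w U] /=.
  by rewrite /truncate; case: ifP => // _; rewrite -setIA setIid.
have -> : union_sum (truncate_list D set0 LZ) (covers R V) =
    expR (mass [seq x : R * {set T} <- LZ | D x.2]) *
    union_sum [seq x : R * {set T} <- LZ | ~~ D x.2] (covers R V).
  rewrite (union_sum_perm (L2 := truncate_list D set0 [seq x : R * {set T} <- LZ | D x.2]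
     ++ [seq x : R * {set T} <- LZ | ~~ D x.2])); last first.
    have e : truncate_list D set0 [seq x : R * {set T} <- LZ | ~~ D x.2] =
        [seq x : R * {set T} <- LZ | ~~ D x.2].
      rewrite -[RHS]map_id; apply/eq_in_map => -[w U].
      by rewrite mem_filter /truncate /= => /andP[/negbTE -> _].
    rewrite -[X in _ ++ X]e -map_cat; apply: perm_map.
    rewrite perm_sym; exact/permPl/perm_filterC.
  rewrite union_sum_cat union_sum_set0; last first.
    by apply/allP => x /mapP[[w U]]; rewrite mem_filter /truncate /= => /andP[-> _] ->; rewrite setI0.
  congr (_ * _); last by apply: eq_union_sum => U; rewrite set0U.
  by rewrite /mass big_map.
move=> chain.
have patE L' : union_sum L' (pattern S V) =
    union_sum [seq x : R * {set T} <- L' | [disjoint x.2 & S :\: V]] (covers R V).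
  rewrite -union_sum_avoid; apply: eq_union_sum => U; exact: patternE.
rewrite /union_mean !patE -/LZ mulrCA.
apply: le_trans (ler_wpM2l (expR_ge0 _) chain) _; rewrite mulrA -expRD.
have -> : [seq x : R * {set T} <- [seq x : R * {set T} <- L | ~~ D x.2] | [disjoint x.2 & S :\: V]] =
    [seq x : R * {set T} <- LZ | ~~ D x.2].
  by rewrite -!filter_predI; apply: eq_filter => x /=; rewrite andbC.
apply: ler_wpM2r.
  by apply: union_sum_ge0; [exact: nonneg_filter|move=> U; exact: ler0n].
rewrite ler_expR (mass_filterC (fun x : R * {set T} => D x.2) L) opprD addrAC.
rewrite gerDr addrC subr_le0.
have -> : [seq x : R * {set T} <- LZ | D x.2] =
    [seq x : R * {set T} <- [seq x : R * {set T} <- L | D x.2] | [disjoint x.2 & S :\: V]].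
  by rewrite -!filter_predI; apply: eq_filter => x /=; rewrite andbC.
rewrite [leRHS](mass_filterC (fun x : R * {set T} => [disjoint x.2 & S :\: V])).
by rewrite lerDl mass_ge0 // !nonneg_filter.
Qed.

(** With probability exp of minus their mass, no set meeting both halves is present; the others form
    independent families on S1 and S2. The two products pay for dropping the bridging sets from each
    marginal. *)
Lemma pattern_supermultiplicative L V1 V2 c1 c2 (us1 us2 : seq T) :
  let S1 := [set x in us1] in let S2 := [set x in us2] in
  nonneg_weights L -> uniq us1 -> uniq us2 -> S2 = ~: S1 ->
  (forall u, 0 <= c1 u <= 1) -> (forall u, 0 <= c2 u <= 1) ->
  V1 \subset S1 -> V2 \subset S2 ->
  (forall pre u post, us1 = pre ++ u :: post ->
     independent_past [seq x : R * {set T} <- L | [disjoint x.2 & S1 :\: V1]]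
       (fun S => ~~ [disjoint S & S2]) [set x in pre] u (c1 u)) ->
  (forall pre u post, us2 = pre ++ u :: post ->
     independent_past [seq x : R * {set T} <- L | [disjoint x.2 & S2 :\: V2]]
       (fun S => ~~ [disjoint S & S1]) [set x in pre] u (c2 u)) ->
  expR (- mass [seq x : R * {set T} <- L | ~~ [disjoint x.2 & S1] && ~~ [disjoint x.2 & S2]]) *
  (\prod_(u <- us1) (1 - c1 u)) * (\prod_(u <- us2) (1 - c2 u)) *
  union_mean L (pattern S1 V1) * union_mean L (pattern S2 V2) <=
  union_mean L (fun U => pattern S1 V1 U * pattern S2 V2 U).
Proof.
move=> S1 S2 w0 u1 u2 S2E c101 c201 V1S V2S ind1 ind2.
have := pattern_without u1 w0 c101 V1S ind1.
have := pattern_without u2 w0 c201 V2S ind2.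
rewrite -/S1 -/S2.
under [X in _ <= union_mean X _ -> _]eq_filter do rewrite negbK.
under [X in _ -> _ <= union_mean X _ -> _]eq_filter do rewrite negbK.
set L1 := [seq x : R * {set T} <- L | [disjoint x.2 & S2]].
set L2 := [seq x : R * {set T} <- L | [disjoint x.2 & S1]] => bound2 bound1.
set both := filter _ _.
pose rest := [seq x : R * {set T} <- L | ~~ (~~ [disjoint x.2 & S1] && ~~ [disjoint x.2 & S2])].
(* Empty sets belong to both [L1] and [L2]. Dropping them here makes [L1] and [L2'] a partition of
   [rest] and leaves the union unchanged. *)
pose L2' := [seq x : R * {set T} <- L2 | ~~ [disjoint x.2 & S2]].
have disjU (Z : {set T}) (S U : {set T}) : [disjoint S & Z] -> [disjoint U & Z] ->
    [disjoint S :|: U & Z].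
  by rewrite !disjoints_subset subUset => -> ->.
have disj0 (Z : {set T}) : [disjoint set0 & Z] by rewrite disjoints_subset sub0set.
have pat_drop S V U U' : [disjoint U' & S] -> pattern S V (U :|: U') = pattern S V U.
  by move=> d; rewrite /pattern setIUl (_ : U' :&: S = set0) ?setU0 //;
    apply/eqP; rewrite setI_eq0.
have rest_mean : union_mean rest (fun U => pattern S1 V1 U * pattern S2 V2 U) =
    union_mean L1 (pattern S1 V1) * union_mean L2 (pattern S2 V2).
  rewrite (union_mean_filterC (fun x => [disjoint x.2 & S2]) rest).
  have -> : [seq x : R * {set T} <- rest | [disjoint x.2 & S2]] = L1.
    rewrite /rest /L1 -filter_predI; apply: eq_filter => x /=.
    by case: [disjoint _ & S2]; rewrite ?andbF.
  have -> : filter (predC (fun x : R * {set T} => [disjoint x.2 & S2])) rest = L2'.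
    rewrite /rest /L2' /L2 -!filter_predI; apply: eq_filter => x /=.
    by case: [disjoint _ & S2]; case: [disjoint _ & S1].
  have L2E : union_mean L2 (pattern S2 V2) = union_mean L2' (pattern S2 V2).
    rewrite (union_mean_filterC (fun x => ~~ [disjoint x.2 & S2]) L2).
    apply: eq_union_mean => U; rewrite union_mean_set0 ?setU0 //.
    apply/allP => -[w S]; rewrite !mem_filter /= negbK => /andP[d2 /andP[d1 _]].
    rewrite -subset0; apply/subsetP => x xS; rewrite inE.
    have := disjointFr d1 xS; have := disjointFr d2 xS.
    by rewrite S2E !inE => /negbFE ->.
  rewrite L2E mulrC -union_meanZ.
  apply: (@eq_union_mean_in (fun U => [disjoint U & S2])) => //.
  - exact: disjU.
  - exact: filter_all.
  move=> U dU; rewrite mulrC -union_meanZ.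
  apply: (@eq_union_mean_in (fun U => [disjoint U & S1])) => //.
  - exact: disjU.
  - by apply/allP => -[w S]; rewrite !mem_filter /= => /and3P[].
  move=> U' dU'; rewrite pat_drop // setUC pat_drop //.
have both_le : expR (- mass both) * union_mean rest (fun U => pattern S1 V1 U * pattern S2 V2 U)
    <= union_mean L (fun U => pattern S1 V1 U * pattern S2 V2 U).
  rewrite /union_mean.
  rewrite [mass L](mass_filterC (fun x : R * {set T} => ~~ [disjoint x.2 & S1] && ~~ [disjoint x.2 & S2])).
  rewrite -/both -/rest opprD expRD -mulrA ler_wpM2l ?expR_ge0 // ler_wpM2l ?expR_ge0 //.
  by apply: union_sum_sub => // U; rewrite mulr_ge0 ?pattern_ge0.
have p1 : 0 <= \prod_(u <- us1) (1 - c1 u).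
  by apply: prodr_ge0 => u _; have /andP[_] := c101 u; rewrite subr_ge0.
have p2 : 0 <= \prod_(u <- us2) (1 - c2 u).
  by apply: prodr_ge0 => u _; have /andP[_] := c201 u; rewrite subr_ge0.
have m1 : 0 <= union_mean L (pattern S1 V1).
  by apply: union_mean_ge0 => // U; exact: pattern_ge0.
have m2 : 0 <= union_mean L (pattern S2 V2).
  by apply: union_mean_ge0 => // U; exact: pattern_ge0.
apply: le_trans _ both_le; rewrite rest_mean.
move: (union_mean L (pattern S1 V1)) (union_mean L (pattern S2 V2)) m1 m2 bound1 bound2.
move: (union_mean L1 _) (union_mean L2 _) => n1 n2 m1 m2 m1_ge0 m2_ge0 bound1 bound2.
rewrite -!mulrA ler_wpM2l ?expR_ge0 // mulrA mulrACA.
by apply: ler_pM => //; apply: mulr_ge0.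
Qed.

End patterns.

(** * Heat kernel and avoidance bounds in dimension five *)

Lemma bin_le_middle j l : ('C(j, l) <= 'C(j, j./2))%N.
Proof.
have half_le : (j./2.*2 <= j)%N by rewrite -[leqRHS]odd_double_half leq_addl.
have half_ge : (j <= j./2.*2.+1)%N.
  by rewrite -[leqLHS]odd_double_half -add1n leq_add2r; case: (odd j).
have upper m : ('C(j, j./2 + m) <= 'C(j, j./2))%N.
  elim: m => [|m IH]; first by rewrite addn0.
  apply: leq_trans IH; rewrite addnS -(leq_pmul2l (ltn0Sn (j./2 + m))).
  rewrite mul_bin_left leq_mul2r; apply/orP; right.
  by move: half_ge; rewrite -addnn; lia.
have [jl|lj] := leqP j./2 l; first by rewrite -(subnKC jl).
have le_lj : (l <= j)%N by move: half_le; rewrite -addnn; lia.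
rewrite -bin_sub // -(@subnKC j./2 (j - l)) //.
by move: half_le; rewrite -addnn; lia.
Qed.

(** Wallis' bound C(2n, n) <= 4^n / sqrt(2n + 1), squared to stay within the integers. The induction
    step amounts to (2n + 1)(2n + 3) <= (2n + 2)^2. *)
Lemma central_bin_sqr n : ('C(n.*2, n) ^ 2 * n.*2.+1 <= 16 ^ n)%N.
Proof.
elim: n => [|n IH]; first by rewrite bin0.
have rec : (n.+1 * 'C(n.+1.*2, n.+1) = 2 * n.*2.+1 * 'C(n.*2, n))%N.
  have e1 : (n.+1 * 'C(n.+1.*2, n.+1) = n.+1.*2 * 'C(n.*2.+1, n))%N.
    by rewrite doubleS -mul_bin_diag.
  have e2 : (n.+1 * 'C(n.*2.+1, n) = n.*2.+1 * 'C(n.*2, n))%N.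
    have -> : (n.+1 = n.*2.+1 - n)%N by rewrite -addnn; lia.
    by rewrite -mul_bin_down.
  by rewrite e1 -mul2n -mulnA e2 mulnA.
set c := 'C(_, _) in rec *; set b := 'C(_, _) in rec IH.
rewrite -(leq_pmul2l (ltn0Sn n)) -(leq_pmul2l (ltn0Sn n)).
have -> : (n.+1 * (n.+1 * (c ^ 2 * n.+1.*2.+1)) = (n.+1 * c) ^ 2 * n.+1.*2.+1)%N.
  by rewrite expnMn -!mulnn; lia.
rewrite rec.
have -> : ((2 * n.*2.+1 * b) ^ 2 * n.+1.*2.+1 =
    4 * n.*2.+1 * n.+1.*2.+1 * (b ^ 2 * n.*2.+1))%N.
  by rewrite -!mulnn; lia.
have four : (4 * n.*2.+1 * n.+1.*2.+1 <= n.+1 * n.+1 * 16)%N by rewrite -!addnn; nia.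
by apply: (leq_trans (leq_mul four IH)); rewrite -!mulnA -expnS.
Qed.

Lemma bin_le_sqrt (R : rcfType) j l :
  'C(j, l)%:R / 2 ^+ j <= (Num.sqrt j.+1%:R)^-1 :> R.
Proof.
have [i [b ->]] : exists i b, j = (i.*2 + nat_of_bool b)%N.
  by exists j./2, (odd j); rewrite addnC odd_double_half.
have b0 (x : nat) : (0 : R) <= x%:R by exact: ler0n.
have key n : 'C(n.*2, n)%:R / 2 ^+ n.*2 <= (Num.sqrt n.*2.+1%:R)^-1 :> R.
  rewrite -[leLHS]ger0_norm ?divr_ge0 ?exprn_ge0 // -sqrtr_sqr -sqrtrV ?ler0n //.
  rewrite ler_sqrt ?invr_ge0 // expr_div_n -exprM ler_pdivrMr ?exprn_gt0 //.
  rewrite mulrC ler_pdivlMr ?ltr0n // -natrX -natrM -natrX ler_nat.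
  have -> : (2 ^ (n.*2 * 2) = 16 ^ n)%N.
    by rewrite -muln2 -mulnA mulnC expnM.
  by rewrite central_bin_sqr.
case: b => /=.
  have two : (2 * 'C(i.*2.+1, i) = 'C(i.+1.*2, i.+1))%N.
    have e : 'C(i.*2.+1, i.+1) = 'C(i.*2.+1, i).
      have le_i : (i <= i.*2.+1)%N by rewrite -addnn; lia.
      by rewrite -(bin_sub le_i); congr 'C(_, _); rewrite -addnn; lia.
    by rewrite doubleS binS e mul2n addnn.
  rewrite addn1; apply: (@le_trans _ _ ('C(i.*2.+1, i)%:R / 2 ^+ i.*2.+1)).
    rewrite ler_wpM2r ?invr_ge0 ?exprn_ge0 // ler_nat.
    by have := bin_le_middle i.*2.+1 l; rewrite /= uphalf_double.
  have -> : 'C(i.*2.+1, i)%:R / 2 ^+ i.*2.+1 = 'C(i.+1.*2, i.+1)%:R / 2 ^+ i.+1.*2 :> R.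
    by rewrite -two natrM doubleS [in RHS]exprS; field; rewrite expf_neq0 // pnatr_eq0.
  apply: le_trans (key _) _; rewrite lef_pV2 ?posrE ?sqrtr_gt0 ?ltr0n //.
  by rewrite ler_sqrt ?ler_nat // ?ler0n.
rewrite addn0; apply: le_trans _ (key i).
rewrite ler_wpM2r ?invr_ge0 ?exprn_ge0 // ler_nat.
by have := bin_le_middle i.*2 l; rewrite doubleK.
Qed.

(** * Convolutions and fair coins *)

Section convolution.
Variables (R : realType) (G : zmodType).
Implicit Types (s : seq G) (w : G -> R) (f g : G -> R) (a b y z : G).

Definition convolve s w f : G -> R := fun y => \sum_(z <- s) w z * f (y - z).

Lemma eq_convolve s w f g : f =1 g -> convolve s w f =1 convolve s w g.
Proof. by move=> fg y; apply: eq_bigr => z _; rewrite fg. Qed.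

Lemma convolveC s w s' w' f :
  convolve s w (convolve s' w' f) =1 convolve s' w' (convolve s w f).
Proof.
move=> y; rewrite /convolve; under eq_bigr do rewrite mulr_sumr.
rewrite exchange_big; apply: eq_bigr => z' _; rewrite mulr_sumr.
by apply: eq_bigr => z _; rewrite mulrCA addrAC.
Qed.

Lemma iter_convolve_ext j s w f g : f =1 g ->
  iter j (convolve s w) f =1 iter j (convolve s w) g.
Proof. by move=> fg; elim: j => //= j IH; apply: eq_convolve. Qed.

Lemma iter_convolveC j s w s' w' f :
  iter j (convolve s w) (convolve s' w' f) =1 convolve s' w' (iter j (convolve s w) f).
Proof.
elim: j => //= j IH y; rewrite (eq_convolve _ _ IH); exact: convolveC.
Qed.

Lemma convolve_le s w f (c : R) : (forall z, 0 <= w z) -> (forall y, f y <= c) ->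
  forall y, convolve s w f y <= (\sum_(z <- s) w z) * c.
Proof.
by move=> w0 fc y; rewrite /convolve mulr_suml; apply: ler_sum => z _; rewrite ler_wpM2l.
Qed.

Lemma convolve_ge0 s w f : (forall z, 0 <= w z) -> (forall y, 0 <= f y) ->
  forall y, 0 <= convolve s w f y.
Proof. by move=> w0 f0 y; apply: sumr_ge0 => z _; rewrite mulr_ge0. Qed.

Lemma convolveD s w f g y :
  convolve s w (fun x => f x + g x) y = convolve s w f y + convolve s w g y.
Proof. by rewrite /convolve -big_split; apply: eq_bigr => z _; rewrite mulrDr. Qed.

Lemma convolveZ s w (c : R) f y :
  convolve s w (fun x => c * f x) y = c * convolve s w f y.
Proof. by rewrite /convolve mulr_sumr; apply: eq_bigr => z _; rewrite mulrCA. Qed.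

Lemma iter_convolve_lin j s w (c : R) f g y :
  iter j (convolve s w) (fun x => c * f x + g x) y =
  c * iter j (convolve s w) f y + iter j (convolve s w) g y.
Proof.
elim: j y => //= j IH y.
by rewrite (eq_convolve _ _ IH) convolveD convolveZ.
Qed.

Definition coin a b : (G -> R) -> G -> R := convolve [:: a; b] (fun=> 1 / 2).

Lemma coinE a b f y : coin a b f y = (f (y - a) + f (y - b)) / 2.
Proof. by rewrite /coin /convolve big_cons big_seq1; ring. Qed.

(** Since phi separates a from b, its value at the endpoint tells how many tosses chose b. At level
    l only C(j, l) of the 2^j outcomes lead back to the support of f. *)
Lemma iter_coin_level (phi : {additive G -> R}) a b f (C c : R) j :
  phi b != phi a -> (forall y, f y <= C) -> (forall y, phi y != c -> f y <= 0) ->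
  (forall y l, phi y = c + phi a *+ j + (phi b - phi a) *+ l ->
     iter j (coin a b) f y <= C * ('C(j, l)%:R / 2 ^+ j)) /\
  (forall y, (forall l, phi y != c + phi a *+ j + (phi b - phi a) *+ l) ->
     iter j (coin a b) f y <= 0).
Proof.
move=> ab fC f0; elim: j => [|j [IH IH0]].
  split=> [y [|l]|y h].
  - by rewrite bin0 expr0 divr1 mulr1.
  - rewrite bin0n /= mul0r mulr0 mulr0n addr0 => e; apply: f0.
    by rewrite e -subr_eq0 addrAC subrr add0r mulrn_eq0 /= subr_eq0.
  - by apply: f0; have := h 0%N; rewrite !mulr0n !addr0.
have shift_a y v : phi y = c + phi a *+ j.+1 + v -> phi (y - a) = c + phi a *+ j + v.
  by rewrite raddfB mulrS => ->; ring.
have shift_b y v : phi y = c + phi a *+ j.+1 + v ->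
    phi (y - b) = c + phi a *+ j + v - (phi b - phi a).
  by rewrite raddfB mulrS => ->; ring.
split=> [y l e|y h].
  have ha := IH _ _ (shift_a _ _ e).
  rewrite iterS coinE exprS.
  case: l e ha => [|l] e ha.
    have hb : iter j (coin a b) f (y - b) <= 0.
      apply: IH0 => l; rewrite (shift_b _ _ e) mulr0n addr0 -subr_eq0.
      rewrite (_ : _ - _ = - ((phi b - phi a) *+ l.+1)); last by rewrite mulrS; ring.
      by rewrite oppr_eq0 mulrn_eq0 /= subr_eq0.
    move: ha hb; rewrite !bin0 => ha hb.
    rewrite (_ : C * _ = C * (1%:R / 2 ^+ j) / 2); last first.
      by field; rewrite expf_neq0 // pnatr_eq0.
    by rewrite ler_pM2r ?invr_gt0 // -[leRHS]addr0 lerD.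
  have hb : iter j (coin a b) f (y - b) <= C * ('C(j, l)%:R / 2 ^+ j).
    by apply: IH; rewrite (shift_b _ _ e) mulrS; ring.
  rewrite binS natrD.
  rewrite (_ : C * _ = (C * ('C(j, l.+1)%:R / 2 ^+ j) + C * ('C(j, l)%:R / 2 ^+ j)) / 2).
    by rewrite ler_pM2r ?invr_gt0 // lerD.
  by field; rewrite expf_neq0 // pnatr_eq0.
rewrite iterS coinE pmulr_lle0 ?invr_gt0 // -[leRHS]addr0 lerD //; apply: IH0 => l.
  apply/negP => /eqP e; have := h l; rewrite -subr_eq0 (_ : _ - _ = 0) ?eqxx //.
  by move: e; rewrite raddfB mulrS => e; rewrite -[phi y](subrK (phi a)) e; ring.
apply/negP => /eqP e; have := h l.+1; rewrite -subr_eq0 (_ : _ - _ = 0) ?eqxx //.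
by move: e; rewrite raddfB !mulrS => e; rewrite -[phi y](subrK (phi b)) e; ring.
Qed.

Lemma iter_coin_le (phi : {additive G -> R}) a b f (C c : R) j y :
  phi b != phi a -> 0 <= C -> (forall y, f y <= C) ->
  (forall y, phi y != c -> f y <= 0) ->
  iter j (coin a b) f y <= C / Num.sqrt j.+1%:R.
Proof.
move=> ab C0 fC f0; have [level none] := iter_coin_level j ab fC f0.
case: (pselect (exists l, phi y = c + phi a *+ j + (phi b - phi a) *+ l)) => [[l e]|h].
  by apply: le_trans (level y l e) _; rewrite ler_wpM2l // bin_le_sqrt.
apply: (@le_trans _ _ 0); last by rewrite divr_ge0 ?sqrtr_ge0.
by apply: none => l; apply/eqP => e; apply: h; exists l.
Qed.

Lemma iter_coin_support (phi : {additive G -> R}) a b f (c : R) j :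
  phi b = phi a -> (forall y, phi y != c -> f y = 0) ->
  forall y, phi y != c + phi a *+ j -> iter j (coin a b) f y = 0.
Proof.
move=> ab f0; elim: j => [|j IH] y; first by rewrite mulr0n addr0; apply: f0.
move=> h; have h' : phi y - phi a != c + phi a *+ j.
  by apply: contraNneq h; rewrite mulrS => e; rewrite -[phi y](subrK (phi a)) e; apply/eqP; ring.
by rewrite iterS coinE !IH ?raddfB ?ab // addr0 mul0r.
Qed.

(* coins [:: (a1, b1); ...] [:: j1; ...] applies ji tosses of the i-th coin. *)
Fixpoint coins (ab : seq (G * G)) (js : seq nat) f : G -> R :=
  match ab, js with
  | (a, b) :: ab', j :: js' => coins ab' js' (iter j (coin a b) f)
  | _, _ => f
  end.

Definition flatness (js : seq nat) : R := \prod_(j <- js) (Num.sqrt j.+1%:R)^-1.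

Lemma coins_convolveC ab js s w f :
  coins ab js (convolve s w f) =1 convolve s w (coins ab js f).
Proof.
have ext : forall ab js f g, f =1 g -> coins ab js f =1 coins ab js g.
  elim=> [|[a b] ab' IH] [|j js'] f' g' fg //=.
  by apply: IH; apply: iter_convolve_ext.
elim: ab js f => [|[a b] ab IH] [|j js] f //= y.
by rewrite (ext _ _ _ _ (iter_convolveC j _ _ s w f)) IH.
Qed.

Lemma coins_iterC ab js s w f n :
  coins ab js (iter n (convolve s w) f) =1 iter n (convolve s w) (coins ab js f).
Proof.
elim: n => //= n IH y; rewrite coins_convolveC; exact: eq_convolve.
Qed.

(** Only the i-th coin spreads the values of [phi i]; the others shift its level by a constant. So f
    stays on one level of every remaining functional, and each coin yields its own factor. *)
Lemma coins_flat (I : eqType) (a b : I -> G) (phi : I -> {additive G -> R})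
    (r : seq I) (js : seq nat) f (C : R) :
  uniq r -> size js = size r -> 0 <= C ->
  (forall i, phi i (b i) != phi i (a i)) ->
  (forall i j, i != j -> phi i (b j) = phi i (a j)) ->
  (forall y, 0 <= f y <= C) ->
  (forall i, i \in r -> exists c, forall y, phi i y != c -> f y = 0) ->
  forall y, coins [seq (a i, b i) | i <- r] js f y <= C * flatness js.
Proof.
move=> + + + phi_ii phi_ij; elim: r js f C => [|i r IH] [|j js] f C //=.
  move=> _ _ _ fC _ y; rewrite /flatness big_nil mulr1.
  by have /andP[] := fC y.
move=> /andP[ir ur] [sjs] C0 fC supp y.
have [c0 supp0] := supp i (mem_head _ _).
rewrite /flatness big_cons mulrA; apply: IH => //.
- by rewrite divr_ge0 ?sqrtr_ge0.
- move=> y'; apply/andP; split.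
    elim: (j) y' => [|n IHn] y' /=; first by have /andP[] := fC y'.
    by apply: convolve_ge0 => // z; rewrite divr_ge0.
  apply: (iter_coin_le (phi := phi i) (c := c0)) => // [y''|y'' h].
    by have /andP[] := fC y''.
  by rewrite supp0.
- move=> i' i'r; have [c supp'] := supp i' (mem_behead (s := i :: r) i'r).
  exists (c + phi i' (a i) *+ j); apply: iter_coin_support => //.
  by apply: phi_ij; apply: contraNneq ir => <-.
Qed.

End convolution.

Section inverse_sqrt.
Variable R : rcfType.
Implicit Types x y theta : R.

Definition rsqrt x : R := (Num.sqrt x)^-1.

Lemma rsqrt_ge0 x : 0 <= rsqrt x.
Proof. by rewrite invr_ge0 sqrtr_ge0. Qed.

Lemma ler_rsqrt x y : 0 < x -> x <= y -> rsqrt y <= rsqrt x.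
Proof.
move=> x0 xy; have y0 : 0 < y by exact: lt_le_trans xy.
by rewrite lef_pV2 ?posrE ?sqrtr_gt0 // ler_sqrt // ltW.
Qed.

Lemma rsqrt_sqr x : 0 < x -> rsqrt x ^+ 2 = x^-1.
Proof. by move=> x0; rewrite exprVn sqr_sqrtr // ltW. Qed.

Lemma rsqrtM x y : 0 <= x -> rsqrt (x * y) = rsqrt x * rsqrt y.
Proof. by move=> x0; rewrite /rsqrt sqrtrM // invfM. Qed.

(** This replaces a random number of tosses by a deterministic one. By convexity of x^(-1/2) the
    left side is at least the value at x + theta; giving away half of theta reverses the inequality
    once x >= 1. *)
Lemma rsqrt_step x theta : 1 <= x -> 0 <= theta <= 1 ->
  theta * rsqrt (x + 1) + (1 - theta) * rsqrt x <= rsqrt (x + theta / 2).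
Proof.
move=> x1 /andP[t0 t1].
have x0 : 0 < x by exact: lt_le_trans x1.
set a := Num.sqrt x; set b := Num.sqrt (x + 1); set e := Num.sqrt (x + theta / 2).
have xe0 : 0 < x + theta / 2 by rewrite ltr_wpDr // divr_ge0.
have a0 : 0 < a by rewrite sqrtr_gt0.
have b0 : 0 < b by rewrite sqrtr_gt0 addr_gt0.
have e0 : 0 < e by rewrite sqrtr_gt0.
have aa : a ^+ 2 = x by rewrite sqr_sqrtr // ltW.
have bb : b ^+ 2 = x + 1 by rewrite sqr_sqrtr // ltW // addr_gt0.
have ee : e ^+ 2 = x + theta / 2 by rewrite sqr_sqrtr // ltW.
have ae : a <= e by rewrite ler_sqrt ?(ltW xe0) // lerDl divr_ge0.
have ab : a <= b by rewrite ler_sqrt ?lerDl // addr_ge0 // ltW.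
rewrite /rsqrt -/a -/b -/e.
have h1 : a^-1 - b^-1 = (a * b * (a + b))^-1.
  rewrite (_ : (a * b * (a + b))^-1 = (b ^+ 2 - a ^+ 2) * (a * b * (a + b))^-1).
    by field; rewrite !gt_eqF ?addr_gt0.
  by rewrite aa bb addrAC subrr add0r mul1r.
have h2 : a^-1 - e^-1 = theta / 2 * (a * e * (a + e))^-1.
  rewrite (_ : theta / 2 = e ^+ 2 - a ^+ 2); last by rewrite aa ee addrAC subrr add0r.
  by field; rewrite !gt_eqF ?addr_gt0.
suff : theta / 2 * (a * e * (a + e))^-1 <= theta * (a * b * (a + b))^-1.
  by rewrite -h1 -h2; lra.
rewrite -mulrA ler_wpM2l // -invfM lef_pV2 ?posrE ?mulr_gt0 ?addr_gt0 //.
have ab2 : a * b <= 2 * a ^+ 2.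
  have : 0 <= (a - b) ^+ 2 by apply: sqr_ge0.
  rewrite (_ : (a - b) ^+ 2 = a ^+ 2 + b ^+ 2 - 2 * (a * b)); last by ring.
  by rewrite bb aa; lra.
have ae2 : a ^+ 2 <= e * a by rewrite expr2 ler_pM2r.
have h : b * (a + b) <= 2 * (e * (a + e)).
  have -> : b * (a + b) = a * b + b ^+ 2 by ring.
  have -> : 2 * (e * (a + e)) = 2 * (e * a) + 2 * e ^+ 2 by ring.
  by move: ab2 ae2; rewrite aa bb ee; lra.
have -> : a * b * (a + b) = a * (b * (a + b)) by ring.
have -> : 2 * (a * e * (a + e)) = a * (2 * (e * (a + e))) by ring.
by rewrite ler_pM2l.
Qed.

End inverse_sqrt.

Section heat_kernel.
Variables (R : realType) (G : zmodType) (s : seq G) (p : G -> R).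
Hypotheses (s_uniq : uniq s) (p_ge0 : forall z, 0 <= p z).
Hypothesis p_sum : \sum_(z <- s) p z = 1.
Implicit Types (f g : G -> R).

Lemma iter_convolveE n f y : iter n (convolve s p) f y =
  \sum_(l <- words s n) weight p l * f (y - \sum_(z <- l) z).
Proof.
elim: n y => [|n IH] y.
  by rewrite big_words0 /weight !big_nil mul1r subr0.
rewrite big_wordsS /= /convolve; apply: eq_bigr => z _.
rewrite IH mulr_sumr; apply: eq_bigr => l _.
by rewrite weight_cons big_cons opprD addrA mulrA.
Qed.

Lemma iter_convolve_le n f (c : R) : (forall y, f y <= c) ->
  forall y, iter n (convolve s p) f y <= c.
Proof.
move=> fc; elim: n => //= n IH y.
by have := convolve_le s p_ge0 IH y; rewrite p_sum mul1r.
Qed.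

Variable theta : R.
Hypothesis theta01 : 0 < theta <= 1.

(** Here p is theta times the fair coin plus a nonnegative rest of mass 1 - theta, so each step is a
    toss with probability theta. The rest commutes with the tosses, which lets the induction on m
    carry the number k of tosses gained so far. *)
Lemma one_direction (a b : G) m k f (C : R) : a \in s -> b \in s -> a != b ->
  theta / 2 <= p a -> theta / 2 <= p b -> 0 <= C ->
  (forall j y, iter j (coin a b) f y <= C * rsqrt (k.+1 + j)%:R) ->
  forall y, iter m (convolve s p) f y <= C * rsqrt (k.+1%:R + theta / 2 * m%:R).
Proof.
move=> sa sb ab pa pb; have /andP[t0 t1] := theta01.
pose p' z := p z - theta / 2 * ((z == a)%:R + (z == b)%:R).
have p'_ge0 z : 0 <= p' z.
  rewrite /p'; have [->|za] := eqVneq z a.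
    by rewrite (negbTE ab) addr0 mulr1 subr_ge0.
  by have [->|zb] := eqVneq z b; rewrite add0r ?mulr1 ?mulr0 ?subr0 ?subr_ge0.
have sum_at c : c \in s -> forall F : G -> R, \sum_(z <- s) (z == c)%:R * F z = F c.
  move=> sc F; rewrite (bigD1_seq c) //= eqxx mul1r big1 ?addr0 // => z /negbTE ->.
  by rewrite mul0r.
have p'_sum : \sum_(z <- s) p' z = 1 - theta.
  rewrite /p' sumrB p_sum -mulr_sumr big_split /=.
  have one c : c \in s -> \sum_(z <- s) (z == c)%:R = 1 :> R.
    by move=> sc; rewrite -[RHS](sum_at c sc (fun=> 1)); apply: eq_bigr => z _; rewrite mulr1.
  by rewrite !one //; field.
have split_p f0 : convolve s p f0 =1 (fun y => theta * coin a b f0 y + convolve s p' f0 y).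
  move=> y; rewrite coinE /convolve.
  rewrite -(sum_at a sa (fun z => f0 (y - z))) -(sum_at b sb (fun z => f0 (y - z))).
  rewrite -big_split mulr_suml mulr_sumr -big_split; apply: eq_bigr => z _ /=.
  by rewrite /p'; field.
elim: m k f C => [|m IH] k f C C0 fC y.
  by rewrite mulr0 addr0; have := fC 0%N y; rewrite addn0.
rewrite iterSr (iter_convolve_ext _ _ _ (split_p f)) iter_convolve_lin.
set x := k.+1%:R + theta / 2 * m%:R.
have x1 : 1 <= x by rewrite ler_wpDr ?ler1n // mulr_ge0 // divr_ge0 // ltW.
have h1 : iter m (convolve s p) (coin a b f) y <= C * rsqrt (x + 1).
  rewrite (_ : x + 1 = k.+2%:R + theta / 2 * m%:R); last by rewrite /x -[k.+2%:R]natr1; ring.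
  apply: IH => // j y'; rewrite -iterSr; apply: le_trans (fC _ _) _.
  by rewrite -(addSnnS k.+1).
have h2 : iter m (convolve s p) (convolve s p' f) y <= (1 - theta) * C * rsqrt x.
  apply: IH; first by rewrite mulr_ge0 // subr_ge0.
  move=> j y'; rewrite iter_convolveC -p'_sum -mulrA; exact: convolve_le.
apply: (@le_trans _ _ (C * (theta * rsqrt (x + 1) + (1 - theta) * rsqrt x))).
  have := ler_wpM2l (ltW t0) h1; lra.
rewrite ler_wpM2l // (_ : _ + _ * m.+1%:R = x + theta / 2); last by rewrite /x -natr1; ring.
by apply: rsqrt_step => //; rewrite ltW.
Qed.

(** Each coin is given its own block of m steps; the tosses of the other coins commute with these
    steps. *)
Lemma all_directions (I : eqType) (a b : I -> G) (r : seq I) m f (C : R) :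
  (forall i, [/\ a i \in s, b i \in s, a i != b i, theta / 2 <= p (a i) & theta / 2 <= p (b i)]) ->
  0 <= C ->
  (forall js, size js = size r ->
     forall y, coins [seq (a i, b i) | i <- r] js f y <= C * flatness R js) ->
  forall y, iter (size r * m) (convolve s p) f y <=
    C * rsqrt (1 + theta / 2 * m%:R) ^+ size r.
Proof.
move=> dir; elim: r f C => [|i r IH] f C C0 fC y.
  rewrite mul0n expr0 mulr1 /=.
  by have := fC [::] erefl y; rewrite /flatness big_nil mulr1.
rewrite /= mulSn addnC iterD exprS mulrA; apply: IH => [|js sjs {}y].
  by rewrite mulr_ge0 // rsqrt_ge0.
rewrite coins_iterC mulrAC; have [sa sb ab pa pb] := dir i.
have fl0 : 0 <= flatness R js by apply: prodr_ge0 => j _; rewrite invr_ge0 sqrtr_ge0.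
apply: (one_direction m (k := 0) sa sb ab pa pb) => [|j y'].
  by rewrite mulr_ge0.
rewrite -(coins_iterC [seq (a i, b i) | i <- r]) add1n.
have := fC (j :: js) (congr1 S sjs) y'; rewrite /= /flatness big_cons.
by rewrite [X in _ <= C * X -> _]mulrC mulrA.
Qed.

Definition hit_prob n y : R := \sum_(l <- words s n) weight p l * (\sum_(z <- l) z == y)%:R.

Lemma hit_probE n y : hit_prob n y = iter n (convolve s p) (fun z => (z == 0)%:R) y.
Proof.
rewrite iter_convolveE; apply: eq_bigr => l _; rewrite subr_eq0.
by rewrite eq_sym.
Qed.

(** Five directions gain a factor of order n^(-1/2) each, in a fifth of the time; the [n %% 5] spare
    steps cannot raise a maximum. The 10 is 5 blocks times the 2 lost in [rsqrt_step]. *)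
Theorem heat_kernel_bound (a b : 'I_5 -> G) (phi : 'I_5 -> {additive G -> R}) :
  (forall i, [/\ a i \in s, b i \in s, theta / 2 <= p (a i) & theta / 2 <= p (b i)]) ->
  (forall i, phi i (b i) != phi i (a i)) ->
  (forall i j, i != j -> phi i (b j) = phi i (a j)) ->
  forall n y, hit_prob n y <= rsqrt (theta / 10) ^+ 5 * (n.+1%:R ^- 2 * rsqrt n.+1%:R).
Proof.
move=> dir phi_ii phi_ij n y; have /andP[t0 t1] := theta01.
pose m := (n %/ 5)%N.
have -> : hit_prob n y = iter (n %% 5 + size (enum 'I_5) * m) (convolve s p)
    (fun z => (z == 0)%:R) y.
  by rewrite hit_probE size_enum_ord mulnC addnC -divn_eq.
have base : forall y', iter (size (enum 'I_5) * m) (convolve s p) (fun z => (z == 0)%:R) y' <=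
    1 * rsqrt (1 + theta / 2 * m%:R) ^+ size (enum 'I_5).
  apply: (all_directions (a := a) (b := b)) => // [i|js sjs y'].
    have [sa sb pa pb] := dir i; split=> //.
    by apply: contraNneq (phi_ii i) => ->.
  apply: (@coins_flat _ _ _ a b phi (enum 'I_5) js _ 1) => //; first exact: enum_uniq.
    by move=> z; rewrite ler0n lern1; case: eqP.
  by move=> i _; exists 0 => z; case: (z =P 0) => // ->; rewrite raddf0 eqxx.
rewrite iterD; apply: le_trans (iter_convolve_le (n %% 5) base y) _.
rewrite size_enum_ord mul1r.
have -> : n.+1%:R ^- 2 * rsqrt n.+1%:R = rsqrt n.+1%:R ^+ 5 :> R.
  by rewrite -[in LHS]exprVn -(rsqrt_sqr (ltr0Sn R n)) -exprM -exprSr.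
rewrite -exprMn lerXn2r ?nnegrE ?mulr_ge0 ?rsqrt_ge0 //.
rewrite -rsqrtM; last by rewrite divr_ge0 // ltW.
apply: ler_rsqrt; first by rewrite mulr_gt0 ?divr_gt0 // ltr0Sn.
have hn : n.+1%:R <= 5 * (m%:R + 1) :> R.
  rewrite natr1 -natrM ler_nat; rewrite {1}(divn_eq n 5) -/m.
  by have := ltn_pmod n (isT : (0 < 5)%N); lia.
have := ler_wpM2l (ltW t0) hn; lra.
Qed.

End heat_kernel.

Section heat_sums.
Variable R : rcfType.

(** This is (n+1)^(-5/2), the decay of the heat kernel in dimension five. *)
Definition heat n : R := n.+1%:R ^- 2 * rsqrt n.+1%:R.

Lemma heat_ge0 n : 0 <= heat n.
Proof. by rewrite mulr_ge0 ?rsqrt_ge0 // invr_ge0 exprn_ge0. Qed.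

(** The left side is at most (n+1)^(-3/2), which the increment of -2 n^(-1/2) dominates. *)
Lemma mulrn_heat_le n : (0 < n)%N ->
  n%:R * heat n <= 2 * (rsqrt n%:R - rsqrt n.+1%:R).
Proof.
move=> n0; set a := Num.sqrt n%:R : R; set b := Num.sqrt n.+1%:R : R.
have a0 : 0 < a by rewrite sqrtr_gt0 ltr0n.
have b0 : 0 < b by rewrite sqrtr_gt0 ltr0n.
have aa : a ^+ 2 = n%:R by rewrite sqr_sqrtr.
have bb : b ^+ 2 = n%:R + 1 by rewrite sqr_sqrtr // natr1.
have ab : a <= b by rewrite ler_sqrt // ler_nat.
rewrite /heat /rsqrt -/a -/b -natr1 -bb -aa.
have -> : 2 * (a^-1 - b^-1) = 2 * (a * b * (a + b))^-1.
  congr (_ * _); rewrite (_ : (a * b * (a + b))^-1 = (b ^+ 2 - a ^+ 2) * (a * b * (a + b))^-1).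
    by field; rewrite !gt_eqF ?addr_gt0.
  by rewrite bb aa addrAC subrr add0r mul1r.
apply: (@le_trans _ _ (b ^+ 3)^-1).
  rewrite (_ : (b ^+ 3)^-1 = b ^+ 2 * ((b ^+ 2) ^- 2 / b)); last by field; rewrite gt_eqF.
  have b0' := ltW b0; have a0' := ltW a0.
  by rewrite ler_wpM2r ?lerXn2r ?nnegrE // divr_ge0 // invr_ge0 !exprn_ge0.
rewrite ler_pdivlMr ?mulr_gt0 ?addr_gt0 // mulrC ler_pdivrMr ?exprn_gt0 //.
have : a * b <= b ^+ 2 by rewrite expr2 ler_pM2r.
have h : a + b <= 2 * b by lra.
move=> h2; have -> : 2 * b ^+ 3 = b ^+ 2 * (2 * b) by ring.
by rewrite ler_pM // ?mulr_ge0 ?addr_ge0 // ltW.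
Qed.

Lemma sum_mulrn_heat N : \sum_(1 <= j < N) j%:R * heat j <= 2.
Proof.
case: N => [|[|N]]; try by rewrite big_geq.
apply: (@le_trans _ _ (\sum_(1 <= j < N.+2) 2 * (rsqrt j%:R - rsqrt j.+1%:R))).
  by apply: ler_sum_nat => j /andP[j1 _]; apply: mulrn_heat_le.
rewrite -mulr_sumr -[X in _ * X]opprK -sumrN.
under eq_bigr do rewrite opprB.
rewrite (telescope_sumr (fun j => rsqrt j%:R)) // opprB ler_piMr //.
by rewrite lerBlDr /rsqrt sqrtr1 invr1 lerDl rsqrt_ge0.
Qed.

(** As K <= j on this range, K times the tail is below the bounded sum of j [heat j]. *)
Lemma heat_tail K N : (0 < K)%N -> \sum_(K <= j < N) heat j <= 2 / K%:R.
Proof.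
move=> K0; have KR : 0 < K%:R :> R by rewrite ltr0n.
rewrite ler_pdivlMr // mulr_suml; apply: le_trans _ (sum_mulrn_heat N).
have [KN|NK] := leqP K N; last by rewrite [leLHS]big_geq ?(ltnW NK) // sumr_ge0 // => j _;
  rewrite mulr_ge0 ?heat_ge0.
rewrite [leRHS](@big_cat_nat _ _ _ K) //= -[leLHS]add0r lerD //.
  by apply: sumr_ge0 => j _; rewrite mulr_ge0 ?heat_ge0.
apply: ler_sum_nat => j /andP[Kj _].
by rewrite mulrC ler_wpM2r ?heat_ge0 // ler_nat.
Qed.

Lemma sum_if_heat n K : (0 < K)%N ->
  \sum_(j < n) (if (K <= j.+1)%N then heat j.+1 else 0) = \sum_(K <= j < n.+1) heat j.
Proof.
move=> K0; elim: n => [|n IH]; first by rewrite big_ord0 big_geq.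
rewrite big_ord_recr /= IH; case: ifP => [Kn|nK]; first by rewrite [RHS]big_nat_recr //=.
have nK' : (n.+1 < K)%N by rewrite ltnNge nK.
by rewrite addr0 !big_geq // ltnW.
Qed.

End heat_sums.

(** * Avoiding a moving target *)

Section avoidance.
Variables (R : realType) (G : zmodType).
Implicit Types (l : seq G) (t : nat -> G).

(* The walk with steps l, started at 0, is not at [t j] after j.+1 steps. *)
Fixpoint avoids t l : bool :=
  if l is z :: l' then (z != t 0%N) && avoids (fun j => t j.+1 - z) l' else true.

Lemma eq_avoids t t' l : (forall j, (j < size l)%N -> t j = t' j) -> avoids t l = avoids t' l.
Proof.
elim: l t t' => //= z l IH t t' tt'; rewrite tt' //.
by congr (_ && _); apply: IH => j jl; rewrite tt'.
Qed.

Lemma avoids_cat t l l' :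
  avoids t (l ++ l') = avoids t l && avoids (fun j => t (size l + j)%N - \sum_(z <- l) z) l'.
Proof.
elim: l t => [|z l IH] t /=.
  by apply: eq_avoids => j _; rewrite big_nil subr0.
rewrite IH -andbA; congr [&& _, _ & _]; apply: eq_avoids => j _.
by rewrite big_cons addSn opprD addrA addrAC.
Qed.

Lemma avoidsP t l : reflect
  (forall j, (j < size l)%N -> \sum_(z <- take j.+1 l) z != t j) (avoids t l).
Proof.
elim: l t => [|z l IH] t /=; first by apply: (iffP idP).
apply: (iffP andP) => [[zt /IH h] [|j] jl|h].
- by rewrite take0 big_seq1.
- by rewrite /= big_cons; apply: contraNneq (h j jl) => <-; rewrite addrAC subrr add0r.
split; first by have := h 0%N isT; rewrite take0 big_seq1.
apply/IH => j jl; have := h j.+1 jl; rewrite big_cons; apply: contraNneq => ->.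
by rewrite addrC subrK.
Qed.

Variables (s : seq G) (p : G -> R) (pmin : R).
Hypotheses (s_uniq : uniq s) (p_ge0 : forall z, 0 <= p z).
Hypotheses (p_sum : \sum_(z <- s) p z = 1).
Hypotheses (pmin_gt0 : 0 < pmin) (pmin_le : forall z, z \in s -> pmin <= p z).

Definition avoid_prob n t : R := \sum_(l <- words s n) weight p l * (avoids t l)%:R.

Lemma hit_probS n y : hit_prob s p n.+1 y = \sum_(z <- s) p z * hit_prob s p n (y - z).
Proof.
rewrite /hit_prob big_wordsS; apply: eq_bigr => z _; rewrite mulr_sumr.
apply: eq_bigr => l _; rewrite weight_cons big_cons mulrA.
congr (_ * (nat_of_bool _)%:R); apply/eqP/eqP => [<-|->].
  by rewrite addrAC subrr add0r.
by rewrite addrC subrK.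
Qed.

Lemma sum_weight1 n : \sum_(l <- words s n) weight p l = 1.
Proof. by rewrite sum_weight p_sum expr1n. Qed.

Lemma hit_prob0 y : hit_prob s p 0 y = (y == 0)%:R.
Proof. by rewrite /hit_prob big_words0 /weight !big_nil mul1r eq_sym. Qed.

Lemma avoid_prob_ge0 n t : 0 <= avoid_prob n t.
Proof. by apply: sumr_ge0 => l _; rewrite mulr_ge0 ?weight_ge0. Qed.

(** Union bound over the times of a hit. *)
Lemma avoid_prob_ge n t :
  1 - \sum_(j < n) hit_prob s p j.+1 (t j) <= avoid_prob n t.
Proof.
elim: n t => [|n IH] t.
  by rewrite big_ord0 subr0 /avoid_prob big_words0 /weight big_nil mulr1.
rewrite /avoid_prob big_wordsS big_ord_recl.
have -> : \sum_(j < n) hit_prob s p (lift ord0 j).+1 (t (lift ord0 j)) =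
    \sum_(z <- s) p z * \sum_(j < n) hit_prob s p j.+1 (t j.+1 - z).
  under eq_bigr do rewrite hit_probS.
  by rewrite exchange_big; apply: eq_bigr => z _; rewrite -mulr_sumr.
rewrite hit_probS -{1}p_sum opprD addrA -sumrB -sumrB; apply: ler_sum => z _.
rewrite hit_prob0 subr_eq0 [t _ == z]eq_sym /=.
have -> : \sum_(l <- words s n) weight p (z :: l) * ((z != t 0%N) && avoids (fun j => t j.+1 - z) l)%:R
  = p z * ((z != t 0%N)%:R * avoid_prob n (fun j => t j.+1 - z)).
  rewrite /avoid_prob !mulr_sumr; apply: eq_bigr => l _.
  by rewrite weight_cons -mulnb natrM; ring.
rewrite -[X in X - _ - _]mulr1 -!mulrBr ler_wpM2l //.
case: eqP => _ /=; last by rewrite subr0 mul1r IH.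
rewrite subrr sub0r mul0r oppr_le0; apply: sumr_ge0 => j _.
by apply: sumr_ge0 => l _; rewrite mulr_ge0 ?weight_ge0.
Qed.

Lemma avoid_prob_cat n m t : avoid_prob (n + m) t =
  \sum_(l <- words s n) weight p l * (avoids t l)%:R *
    avoid_prob m (fun j => t (n + j)%N - \sum_(z <- l) z).
Proof.
rewrite /avoid_prob big_words_cat; apply: eq_words => l sl.
rewrite mulr_sumr; apply: eq_bigr => l' _.
by rewrite weight_cat avoids_cat sl -mulnb natrM; ring.
Qed.

Lemma avoid_prob_le1 n t : avoid_prob n t <= 1.
Proof.
rewrite -(sum_weight1 n); apply: ler_sum => l _.
by rewrite ler_piMr ?weight_ge0 // lern1; case: (avoids _ _).
Qed.

Lemma avoid_prob_anti n m t : avoid_prob (n + m) t <= avoid_prob n t.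
Proof.
rewrite avoid_prob_cat; apply: ler_sum => l _.
by rewrite ler_piMr ?avoid_prob_le1 // mulr_ge0 ?weight_ge0.
Qed.

Lemma seq_max (X : eqType) (F : X -> R) (r : seq X) : r != [::] ->
  exists2 x, x \in r & forall y, y \in r -> F y <= F x.
Proof.
elim: r => // x [|y r] IH _; first by exists x; rewrite ?mem_head // => y; rewrite inE => /eqP ->.
have [m mr mmax] := IH isT; have [mx|xm] := leP (F m) (F x).
  exists x; first exact: mem_head.
  by move=> w; rewrite inE => /orP[/eqP -> //|/mmax h]; apply: le_trans mx.
exists m; first by rewrite inE mr orbT.
by move=> w; rewrite inE => /orP[/eqP ->|/mmax //]; apply: ltW.
Qed.

Variables (phi : G -> R) (a b c : G).
Hypothesis phiD : {morph phi : x y / x + y}.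
Hypotheses (sa : a \in s) (sb : b \in s) (sc : c \in s).
Hypotheses (phi_ab : phi a < phi b) (phi_bc : phi b < phi c).

(* At each step the endpoints of the avoiding paths gain two points, by
   extending the lowest one by a and the highest one by c, and lose at most
   one, the point to be avoided. *)
Lemma many_avoiding_endpoints N t : exists ws : seq (seq G),
  [/\ {subset ws <= words s N}, all (avoids t) ws,
      uniq [seq \sum_(z <- w) z | w <- ws] & (N < size ws)%N].
Proof.
elim: N => [|N [ws [sub_ws av_ws uniq_ws size_ws]]].
  by exists [:: [::]]; split=> // w; rewrite inE => /eqP ->.
pose total (w : seq G) := \sum_(z <- w) z.
have ws0 : ws != [::] by rewrite -size_eq0 -lt0n (leq_ltn_trans _ size_ws).
have [hi hi_ws hiP] := seq_max (fun w => phi (total w)) ws0.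
have [lo lo_ws loP] := seq_max (fun w => - phi (total w)) ws0.
pose ws' := rcons lo a :: rcons hi c :: [seq rcons w b | w <- ws].
pose ok w := total w != t N.
have total_rcons w z : total (rcons w z) = total w + z.
  by rewrite /total -cats1 big_cat big_seq1.
have uniq_ws' : uniq [seq total w | w <- ws'].
  have uniq_b : uniq [seq total w | w <- [seq rcons w b | w <- ws]].
    rewrite -map_comp (eq_map (g := (fun x => x + b) \o total)) => [|w /=].
      by rewrite map_comp map_inj_uniq //; apply: addIr.
    exact: total_rcons.
  rewrite /= uniq_b andbT inE negb_or !total_rcons -andbA; apply/and3P; split.
  - apply/eqP => /(congr1 phi); rewrite !phiD; apply/eqP; rewrite lt_eqF //.
    by rewrite ler_ltD ?(lt_trans phi_ab) // -lerN2 loP.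
  - apply/mapP => -[w /mapP[v vws ->]]; rewrite total_rcons => /(congr1 phi).
    rewrite !phiD; apply/eqP; rewrite lt_eqF // ler_ltD // -lerN2; exact: loP.
  - apply/mapP => -[w /mapP[v vws ->]]; rewrite total_rcons => /(congr1 phi).
    rewrite !phiD; apply/eqP; rewrite gt_eqF // ler_ltD //; exact: hiP.
have rcons_words w z : w \in words s N -> z \in s -> rcons w z \in words s N.+1.
  by rewrite !mem_words size_rcons eqSS all_rcons => /andP[-> ->] /= ->.
have sub' w : w \in ws' -> exists2 v, v \in ws & exists2 z, z \in s & w = rcons v z.
  rewrite !inE => /or3P[/eqP ->|/eqP ->|/mapP[v vws ->]].
  - by exists lo => //; exists a.
  - by exists hi => //; exists c.
  - by exists v => //; exists b.
exists (filter ok ws'); split.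
- move=> w; rewrite mem_filter => /andP[_ /sub'[v vws [z zs ->]]].
  exact/rcons_words/zs/sub_ws.
- apply/allP => w; rewrite mem_filter => /andP[okw /sub'[v vws [z zs ew]]].
  rewrite ew -cats1 avoids_cat (allP av_ws) //= andbT addn0.
  have /eqP sv : size v == N by have := sub_ws v vws; rewrite mem_words => /andP[].
  rewrite sv; apply: contraTneq okw => ez.
  by rewrite /ok ew total_rcons ez addrC subrK eqxx.
- exact: subseq_uniq (map_subseq _ (filter_subseq _ _)) uniq_ws'.
- have one : (count (predC ok) ws' <= 1)%N.
    rewrite (eq_count (a2 := preim total (pred1 (t N)))); last by move=> w /=; rewrite negbK.
    by rewrite -count_map count_uniq_mem // leq_b1.
  have := count_predC ok ws'; have -> : size ws' = (size ws).+2 by rewrite /ws' /= size_map.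
  rewrite size_filter; move: (count _ ws') (count _ ws') (size ws) one size_ws.
  move=> x y z.
  by clear; lia.
Qed.

(** Any given word leads to y from at most one of the distinct starting points. *)
Lemma sum_hit_distinct n y (r : seq G) : uniq r ->
  \sum_(x <- r) hit_prob s p n (y - x) <= 1.
Proof.
move=> r_uniq; rewrite exchange_big -[leRHS](sum_weight1 n); apply: ler_sum => l _.
rewrite -mulr_sumr ler_piMr ?weight_ge0 //.
rewrite (eq_bigr (fun x => (x == y - \sum_(z <- l) z)%:R)); last first.
  move=> x _; congr ((nat_of_bool _)%:R); apply/eqP/eqP => ->;
    by rewrite opprB addrC subrK.
case: (boolP (y - \sum_(z <- l) z \in r)) => yr.
  by rewrite (bigD1_seq _ yr) //= eqxx big1 ?addr0 // => x /negbTE ->.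
rewrite big1_seq // => x /andP[_ xr]; case: eqP => // e.
by rewrite -e xr in yr.
Qed.

Variable C0 : R.
Hypothesis C0_ge0 : 0 <= C0.
Hypothesis heat_bound : forall n y, hit_prob s p n y <= C0 * heat R n.

(** From one start the early hitting probabilities may exceed 1 in total, so the union bound is
    summed over many distinct starts. The first K times then cost at most K altogether, the later
    ones at most 1/2 per start. *)
Theorem avoidance : exists2 q : R, 0 < q & forall n t, q <= avoid_prob n t.
Proof.
(* K > 4 C0 brings the tail C0 2/K below 1/2. With at least 2K + 1 starts, the sum of the avoidance
   bounds is at least (2K + 1)/2 - K = 1/2. *)
pose K := (Num.truncn (4 * C0)).+1; have [N NE] : exists N, N = (2 * K)%N by exists (2 * K)%N.
have tail n : C0 * \sum_(K <= j < n) heat R j <= 1 / 2.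
  apply: le_trans (ler_wpM2l C0_ge0 (heat_tail R n (ltn0Sn _))) _.
  have : 4 * C0 < K%:R by exact: truncnS_gt.
  rewrite -/K mulrA ler_pdivrMr ?ltr0n //; lra.
exists (pmin ^+ N / 2); first by rewrite divr_gt0 ?exprn_gt0.
move=> n t; apply: le_trans _ (avoid_prob_anti n N t).
rewrite addnC avoid_prob_cat.
have [ws [sub_ws av_ws uniq_ws size_ws]] := many_avoiding_endpoints N t.
pose total (w : seq G) := \sum_(z <- w) z.
pose F l := weight p l * (avoids t l)%:R * avoid_prob n (fun j => t (N + j)%N - total l).
have F0 l : 0 <= F l by rewrite !mulr_ge0 ?weight_ge0 ?avoid_prob_ge0.
apply: (@le_trans _ _ (\sum_(l <- ws) F l)); last first.
  rewrite [leRHS](bigID (fun l => l \in ws)) /= -[leLHS]addr0 lerD //; last by apply: sumr_ge0 => l _; exact: F0.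
  rewrite -[leRHS]big_filter le_eqVlt; apply/orP; left; apply/eqP; apply: perm_big.
  apply: uniq_perm; [exact: map_uniq uniq_ws|exact/filter_uniq/uniq_words|].
  by move=> l; rewrite mem_filter; case: (boolP (l \in ws)) => // /sub_ws ->.
apply: (@le_trans _ _ (\sum_(w <- ws) pmin ^+ N *
    (1 - \sum_(j < n) hit_prob s p j.+1 (t (N + j)%N - total w)))); last first.
  rewrite big_seq [leRHS]big_seq; apply: ler_sum => w wws.
  rewrite /F (allP av_ws) // mulr1.
  have := sub_ws w wws; rewrite mem_words => /andP[/eqP sw /allP allw].
  have wt : pmin ^+ N <= weight p w.
    rewrite -sw /weight; elim: (w) allw => [|z v IH] allw; first by rewrite big_nil.
    rewrite big_cons exprS ler_pM ?exprn_ge0 ?(ltW pmin_gt0) //.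
      by apply: pmin_le; apply: allw; rewrite mem_head.
    by apply: IH => x xv; apply: allw; rewrite inE xv orbT.
  apply: (@le_trans _ _ (pmin ^+ N * avoid_prob n (fun j => t (N + j)%N - total w))).
    by rewrite ler_wpM2l ?exprn_ge0 ?(ltW pmin_gt0) // avoid_prob_ge.
  by rewrite ler_wpM2r ?avoid_prob_ge0.
rewrite -mulr_sumr ler_wpM2l ?exprn_ge0 ?(ltW pmin_gt0) //.
rewrite sumrB exchange_big /=.
have -> : \sum_(w <- ws) 1 = (size ws)%:R :> R by rewrite big_const_seq count_predT iter_addr_0.
have col_le j : \sum_(w <- ws) hit_prob s p j.+1 (t (N + j)%N - total w) <=
    (if (j < K)%N then 1 else 0) + (if (K <= j.+1)%N then (size ws)%:R * (C0 * heat R j.+1) else 0).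
  have [jK|Kj] := ltnP j K.
    rewrite -[leLHS]addr0 lerD //.
      have := sum_hit_distinct j.+1 (t (N + j)%N) uniq_ws; rewrite big_map; exact.
    by case: ifP => // _; rewrite mulr_ge0 // mulr_ge0 // heat_ge0.
  rewrite add0r leqW //; apply: (@le_trans _ _ (\sum_(w <- ws) C0 * heat R j.+1)).
    by apply: ler_sum => w _.
  by rewrite big_const_seq count_predT iter_addr_0 mulr_natl.
have : \sum_(j < n) \sum_(w <- ws) hit_prob s p j.+1 (t (N + j)%N - total w) <=
    K%:R + (size ws)%:R * (1 / 2).
  apply: le_trans (ler_sum _ (fun j _ => col_le (nat_of_ord j))) _.
  rewrite big_split lerD //=.
    rewrite -big_mkcond sumr_const -[_ *+ _]/(_%:R) ler_nat.
    rewrite cardE -(size_map val) -[leqRHS](size_iota 0 K); apply: uniq_leq_size.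
      by rewrite map_inj_uniq ?enum_uniq //; apply: val_inj.
    move=> j /mapP[i]; rewrite mem_enum => iK ->; by rewrite mem_iota.
  apply: le_trans _ (ler_wpM2l (ler0n _ _) (tail n.+1)).
  rewrite -sum_if_heat // !mulr_sumr le_eqVlt; apply/orP; left; apply/eqP.
  by apply: eq_bigr => j _; case: ifP => _; rewrite ?mulr0.
have : N.+1%:R <= (size ws)%:R :> R by rewrite ler_nat.
rewrite -natr1 NE natrM; lra.
Qed.

End avoidance.

(** * Particle traces *)

Section conditional_hitting.
Variables (R : realType) (T : finType) (I : Type) (r : seq I) (W : I -> R) (tau : I -> {set T}).
Hypotheses (W_ge0 : forall i, 0 <= W i) (W_sum : \sum_(i <- r) W i = 1).
Variables (q kappa : R) (Z S : {set T}).
Hypotheses (q_gt0 : 0 < q) (q_le : q <= \sum_(i <- r) W i * (tau i == set0)%:R).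
Hypothesis kappa_ge : \sum_(t in S) \sum_(i <- r) W i * (t \in tau i)%:R <= kappa.

(** The condition has probability at least q, because an empty trace avoids every Z. *)
Definition hit_given_avoid : R :=
  (\sum_(i <- r) W i * ([disjoint tau i & Z] && ~~ [disjoint tau i & S])%:R) /
  (\sum_(i <- r) W i * [disjoint tau i & Z]%:R).

Let avoid := \sum_(i <- r) W i * [disjoint tau i & Z]%:R.
Let avoid_both := \sum_(i <- r) W i * ([disjoint tau i & Z] && [disjoint tau i & S])%:R.

Let avoid_both_ge : q <= avoid_both.
Proof.
apply: le_trans q_le _; apply: ler_sum => i _; rewrite ler_wpM2l // ler_nat.
by case: eqP => // ->; rewrite !disjoints_subset !sub0set.
Qed.

Let avoidE : avoid = avoid_both +
  \sum_(i <- r) W i * ([disjoint tau i & Z] && ~~ [disjoint tau i & S])%:R.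
Proof.
rewrite -big_split; apply: eq_bigr => i _ /=; rewrite -mulrDr; congr (_ * _).
by case: [disjoint _ & Z]; case: [disjoint _ & S]; rewrite /= ?addr0 ?add0r.
Qed.

Let hit_ge0 : 0 <= \sum_(i <- r) W i * ([disjoint tau i & Z] && ~~ [disjoint tau i & S])%:R.
Proof. by apply: sumr_ge0 => i _; rewrite mulr_ge0. Qed.

Let avoid_gt0 : 0 < avoid.
Proof. by rewrite avoidE ltr_wpDr // (lt_le_trans q_gt0). Qed.

Let avoid_le1 : avoid <= 1.
Proof.
by rewrite -W_sum; apply: ler_sum => i _; rewrite ler_piMr // lern1; case: [disjoint _ & _].
Qed.

Lemma hit_given_avoidE :
  \sum_(i <- r) W i * ([disjoint tau i & Z] && ~~ [disjoint tau i & S])%:R =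
  hit_given_avoid * avoid.
Proof. by rewrite /hit_given_avoid divfK // gt_eqF. Qed.

Let one_minus : 1 - hit_given_avoid = avoid_both / avoid.
Proof.
rewrite /hit_given_avoid -/avoid -[X in X - _](divff (lt0r_neq0 avoid_gt0)) -mulrBl.
by rewrite {1}avoidE addrK.
Qed.

Let one_minus_ge : q <= 1 - hit_given_avoid.
Proof.
rewrite one_minus ler_pdivlMr //; apply: le_trans avoid_both_ge.
by rewrite ler_piMr // ltW.
Qed.

Lemma hit_given_avoid_01 : 0 <= hit_given_avoid <= 1.
Proof.
rewrite divr_ge0 ?(ltW avoid_gt0) //= -subr_ge0 (le_trans _ one_minus_ge) //.
exact: ltW.
Qed.

Let kappa_ge0 : 0 <= kappa.
Proof.
apply: le_trans kappa_ge; apply: sumr_ge0 => t _; apply: sumr_ge0 => i _.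
by rewrite mulr_ge0.
Qed.

(** Let c be the conditional probability. A first moment gives c <= kappa/q, and 1 - c >= q, so 1/(1
    - c) = 1 + c/(1 - c) <= 1 + kappa/q^2. The exponential form turns a product over sites into a
    sum of first moments. *)
Lemma one_minus_hit_ge : expR (- (kappa / q ^+ 2)) <= 1 - hit_given_avoid.
Proof.
have hk : hit_given_avoid <= kappa / q.
  rewrite ler_pdivrMr //; apply: (@le_trans _ _ kappa).
    apply: le_trans kappa_ge; rewrite exchange_big; apply: ler_sum => i _ /=.
    rewrite -mulr_sumr ler_wpM2l // -natr_sum ler_nat.
    case: (boolP [disjoint tau i & S]) => [|/pred0Pn[t /andP[t_tau t_S]]].
      by rewrite andbF.
    have tT : t \in tau i := t_tau; have tS : t \in S := t_S.
    by rewrite (bigD1 t) //= tT; case: [disjoint _ & _].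
  rewrite mulrAC ler_pdivlMr // ler_wpM2l //.
  by apply: le_trans avoid_both_ge _; rewrite -/avoid avoidE lerDl.
set c := hit_given_avoid in hk *.
have c1 : 0 < 1 - c by exact: lt_le_trans one_minus_ge.
have /andP[c0 _] := hit_given_avoid_01.
have le1 : (1 - c)^-1 <= expR (kappa / q ^+ 2).
  apply: le_trans (expR_ge1Dx _).
  have -> : (1 - c)^-1 = 1 + c / (1 - c) by field; rewrite gt_eqF.
  rewrite lerD2l ler_pdivrMr //; apply: (le_trans hk).
  rewrite (_ : kappa / q ^+ 2 = kappa / q / q); last by field; rewrite gt_eqF.
  rewrite -[leLHS]mulr1 -[X in _ * X <= _](divff (lt0r_neq0 q_gt0)) mulrA mulrAC.
  have q0 := ltW q_gt0.
  by rewrite ler_wpM2l // divr_ge0 // divr_ge0.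
by rewrite expRN -[leRHS]invrK lef_pV2 ?posrE ?expR_gt0 ?invr_gt0.
Qed.

End conditional_hitting.

(** * Markov property of a trace at one of its times *)

Section past_future.
Variables (R : realType) (T : finType).
Variables (L : seq (R * {set T})) (u : T) (near far : {set T}).
Variables (I J : Type) (r1 : seq I) (r2 : seq J) (W1 : I -> R) (W2 : J -> R).
Variables (tau1 : I -> {set T}) (tau2 : J -> {set T}) (lam : R).
Hypotheses (near_far : forall t, t != u -> (t \in near) = (t \notin far)).
Hypotheses (u_near : u \notin near) (u_far : u \notin far).
Hypothesis product : forall H : {set T} -> {set T} -> R,
  \sum_(e <- L | u \in e.2) e.1 * H (e.2 :&: near) (e.2 :&: far) =
  lam * \sum_(i <- r1) \sum_(j <- r2) W1 i * W2 j * H (tau1 i) (tau2 j).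

Implicit Types S Z K V : {set T}.

Lemma disjoint_split S Z : u \in S ->
  [disjoint S & Z] = [&& u \notin Z, [disjoint S :&: near & Z] & [disjoint S :&: far & Z]].
Proof.
move=> uS; have SE : S = u |: (S :&: near) :|: (S :&: far).
  apply/setP => t; rewrite !inE; case: (t =P u) => [->|/eqP tu] /=; first by rewrite uS.
  by rewrite (near_far tu); case: (t \in S); case: (t \in far).
by rewrite {1}SE !disjoints_subset !subUset sub1set !inE andbA.
Qed.

(** The sets [near] and [far] are the two sides of time u in either order, so past and future are
    served alike. Through u the two sides are independent by [product], and avoidance of Z
    factorises over them. *)
Lemma independent_past_split K Z (S2 : {set T}) p : K \subset near -> S2 \subset far ->
  \sum_(j <- r2) W2 j * ([disjoint tau2 j & Z] && ~~ [disjoint tau2 j & S2])%:R =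
    p * \sum_(j <- r2) W2 j * [disjoint tau2 j & Z]%:R ->
  independent_past [seq x : R * {set T} <- L | [disjoint x.2 & Z]]
    (fun S => ~~ [disjoint S & S2]) K u p.
Proof.
move=> Kn Sf hp V.
pose base (Sn : {set T}) : R := ([&& u \notin Z, [disjoint Sn & Z] & Sn :&: K \subset V])%:R.
have capK S : S :&: near :&: K = S :&: K by rewrite -setIA (setIidPr Kn).
have S2far S : u \in S -> [disjoint S & S2] = [disjoint S :&: far & S2].
  move=> uS; rewrite (disjoint_split _ uS).
  have -> : u \notin S2 by apply: contra u_far => /(subsetP Sf).
  rewrite (_ : [disjoint S :&: near & S2]) // disjoints_subset; apply/subsetP => t.
  rewrite !inE => /andP[_ tn]; apply/negP => /(subsetP Sf) tf.
  have tu : t != u by apply: contraNneq u_far => <-.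
  by move: tn; rewrite near_far // tf.
have -> : \sum_(x <- [seq x : R * {set T} <- L | [disjoint x.2 & Z]] |
      [&& u \in x.2, ~~ [disjoint x.2 & S2] & x.2 :&: K \subset V]) x.1 =
    lam * \sum_(i <- r1) \sum_(j <- r2) W1 i * W2 j *
      (base (tau1 i) * ([disjoint tau2 j & Z] && ~~ [disjoint tau2 j & S2])%:R).
  rewrite -(product (fun Sn Sf0 : {set T} => base Sn * ([disjoint Sf0 & Z] && ~~ [disjoint Sf0 & S2])%:R)).
  rewrite big_filter_cond big_mkcond [RHS]big_mkcond; apply: eq_bigr => -[w S] _ /=.
  case: (boolP (u \in S)) => uS /=; last by rewrite andbF.
  rewrite /base capK (disjoint_split _ uS) (S2far _ uS) -natrM mulnb.
  by case: (u \notin Z); case: [disjoint _ :&: near & Z]; case: [disjoint _ :&: far & Z];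
    case: [disjoint _ :&: far & S2]; case: (_ \subset V); rewrite /= ?mulr0 ?mulr1.
have -> : \sum_(x <- [seq x : R * {set T} <- L | [disjoint x.2 & Z]] |
      (u \in x.2) && (x.2 :&: K \subset V)) x.1 =
    lam * \sum_(i <- r1) \sum_(j <- r2) W1 i * W2 j *
      (base (tau1 i) * [disjoint tau2 j & Z]%:R).
  rewrite -(product (fun Sn Sf0 : {set T} => base Sn * [disjoint Sf0 & Z]%:R)).
  rewrite big_filter_cond big_mkcond [RHS]big_mkcond; apply: eq_bigr => -[w S] _ /=.
  case: (boolP (u \in S)) => uS /=; last by rewrite andbF.
  rewrite /base capK (disjoint_split _ uS) -natrM mulnb.
  by case: (u \notin Z); case: [disjoint _ :&: near & Z]; case: [disjoint _ :&: far & Z];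
    case: (_ \subset V); rewrite /= ?mulr0 ?mulr1.
rewrite mulrCA; congr (_ * _); rewrite mulr_sumr; apply: eq_bigr => i _.
have pull (b : J -> R) : \sum_(j <- r2) W1 i * W2 j * (base (tau1 i) * b j) =
    W1 i * base (tau1 i) * \sum_(j <- r2) W2 j * b j.
  by rewrite mulr_sumr; apply: eq_bigr => j _; ring.
by rewrite !pull hp; ring.
Qed.

End past_future.

Section traces.
Variables (R : realType) (G : zmodType) (s : seq G) (p : G -> R).
Hypothesis p_ge0 : forall z, 0 <= p z.
Hypothesis (p_sum : \sum_(z <- s) p z = 1).
Variables (n : nat) (x : nat -> G) (lam : R).
Implicit Types (l : seq G) (u t : 'I_n) (S U V Z : {set 'I_n}) (y : G).

Definition trace y l : {set 'I_n} := [set t : 'I_n | y + \sum_(z <- take t l) z == x t].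

Definition forward_trace u l : {set 'I_n} :=
  [set t : 'I_n | (u < t)%N && (x u + \sum_(z <- take (t - u) l) z == x t)].

(** The word [l] holds the u steps before time u, so [drop t l] are those between times t and u. *)
Definition backward_trace u l : {set 'I_n} :=
  [set t : 'I_n | (t < u)%N && (x u - \sum_(z <- drop t l) z == x t)].

(** From any other starting point no word meets a site. Each starting point is to be counted once,
    hence [undup]. *)
Definition origins : seq G :=
  undup [seq x t - \sum_(z <- take t l) z | t <- enum 'I_n, l <- words s n].

Definition particle_traces : seq (R * {set 'I_n}) :=
  [seq (lam * weight p l, trace y l) | y <- origins, l <- words s n].

Definition below u : {set 'I_n} := [set t : 'I_n | (t < u)%N].
Definition above u : {set 'I_n} := [set t : 'I_n | (u < t)%N].

Lemma particle_traces_nonneg : 0 <= lam -> nonneg_weights particle_traces.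
Proof.
by move=> lam_ge0; apply/allP => e /allpairsP[[y l] [_ _ ->]] /=; rewrite mulr_ge0 // weight_ge0.
Qed.

(** For each word exactly one starting point makes the trace pass through u, so the particles at
    this site have total mass [lam]; the word then splits at u into independent halves. *)
Lemma particle_traces_product u (H : {set 'I_n} -> {set 'I_n} -> R) :
  \sum_(e <- particle_traces | u \in e.2) e.1 * H (e.2 :&: below u) (e.2 :&: above u) =
  lam * \sum_(l1 <- words s u) \sum_(l2 <- words s (n - u))
    weight p l1 * weight p l2 * H (backward_trace u l1) (forward_trace u l2).
Proof.
rewrite big_mkcond /= big_allpairs_dep /= exchange_big /=.
pose start l := x u - \sum_(z <- take u l) z.
transitivity (\sum_(l <- words s n) lam * weight p l *
    H (trace (start l) l :&: below u) (trace (start l) l :&: above u)).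
  rewrite big_seq [RHS]big_seq; apply: eq_bigr => l ls.
  have start_in : start l \in origins.
    by rewrite mem_undup; apply/allpairsP; exists (u, l); rewrite mem_enum.
  have u_start : u \in trace (start l) l by rewrite inE /start subrK.
  rewrite (bigD1_seq (start l)) ?undup_uniq //= u_start -[RHS]addr0; congr (_ + _).
  apply: big1 => y ny; case: ifP => //; rewrite inE => /eqP e; case/negP: ny.
  by rewrite /start -e addrK.
rewrite -[X in words s X](subnKC (ltnW (ltn_ord u))) big_words_cat mulr_sumr.
apply: eq_words => l1 sl1; rewrite mulr_sumr; apply: eq_bigr => l2 _.
have take_u : take u (l1 ++ l2) = l1 by rewrite -sl1 take_size_cat.
rewrite /start take_u weight_cat -mulrA.
congr (_ * (_ * H _ _)); apply/setP => t; rewrite !inE.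
  case: (ltnP t u) => [tu|]; last by rewrite andbF.
  rewrite andbT /=; congr (_ == _).
  have -> : take t (l1 ++ l2) = take t l1 by rewrite take_cat sl1 tu.
  have -> : \sum_(z <- l1) z = \sum_(z <- take t l1) z + \sum_(z <- drop t l1) z.
    by rewrite -big_cat cat_take_drop.
  by rewrite opprD addrA addrAC subrK.
case: (ltnP u t) => [ut|]; last by rewrite andbF.
rewrite andbT /=; congr (_ == _).
rewrite take_cat sl1 ltnNge (ltnW ut) /= big_cat /=.
by rewrite addrA subrK.
Qed.

Lemma forward_sum1 u : \sum_(l <- words s (n - u)) weight p l = 1.
Proof. by rewrite sum_weight p_sum expr1n. Qed.

Lemma weight_prefix m k (F : seq G -> R) : (m <= k)%N ->
  \sum_(l <- words s k) weight p l * F (take m l) = \sum_(l <- words s m) weight p l * F l.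
Proof.
move=> mk; rewrite -[in LHS](subnKC mk) big_words_cat; apply: eq_words => l sl.
rewrite -[RHS]mul1r -(sum_weight1 p_sum (k - m)) mulr_suml; apply: eq_bigr => l' _.
by rewrite weight_cat -sl take_size_cat //; ring.
Qed.

Lemma forward_empty (q : R) u : (forall m (a : nat -> G), q <= avoid_prob s p m a) ->
  q <= \sum_(l <- words s (n - u)) weight p l * (forward_trace u l == set0)%:R.
Proof.
move=> /(_ (n - u)%N (fun j => x (u + j.+1)%N - x u)) h; apply: le_trans h _.
apply: ler_words => l sl; rewrite ler_wpM2l ?weight_ge0 // ler_nat.
case: avoidsP => //= h; rewrite lt0b; apply/eqP/setP => t; rewrite !inE.
apply/negP => /andP[ut /eqP e].
have tn : (t - u.+1 < size l)%N by rewrite sl; have := ltn_ord t; lia.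
case/negP: (h _ tn); rewrite (_ : (t - u.+1).+1 = t - u)%N; last by lia.
by rewrite subnKC ?(ltnW ut) // -e addrC addKr.
Qed.

Lemma forward_hit u t : (u < t)%N ->
  \sum_(l <- words s (n - u)) weight p l * (t \in forward_trace u l)%:R =
  hit_prob s p (t - u) (x t - x u).
Proof.
move=> ut; have le_tu : (t - u <= n - u)%N by rewrite leq_sub2r // ltnW.
rewrite /hit_prob -(weight_prefix (fun l => (\sum_(z <- l) z == x t - x u)%:R) le_tu).
apply: eq_bigr => l _; rewrite inE ut /= eq_sym -subr_eq addrC.
by rewrite [in RHS]eq_sym [- _ + _]addrC subr_eq addrC -subr_eq.
Qed.

(** Reversing a word keeps its weight. Seen backwards from u, the particle is a walk with the same
    step weights whose steps are subtracted, and the avoidance bound applies to it. *)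
Lemma backward_sumE u (F : {set 'I_n} -> R) :
  \sum_(l <- words s u) weight p l * F (backward_trace u l) =
  \sum_(l <- words s u) weight p l *
    F [set t : 'I_n | (t < u)%N && (x u - \sum_(z <- take (u - t) l) z == x t)].
Proof.
rewrite -big_words_rev; apply: eq_words => l sl; rewrite weight_rev.
congr (_ * F _); apply/setP => t; rewrite !inE.
case: (ltnP t u) => //= tu; congr (_ - _ == _).
by rewrite drop_rev sl (perm_big (take (u - t) l)) // perm_rev.
Qed.

Lemma backward_empty (q : R) u : (forall m (a : nat -> G), q <= avoid_prob s p m a) ->
  q <= \sum_(l <- words s u) weight p l * (backward_trace u l == set0)%:R.
Proof.
move=> /(_ u (fun j => x u - x (u - j.+1)%N)) h; apply: le_trans h _.
rewrite (backward_sumE u (fun S => (S == set0)%:R)).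
apply: ler_words => l sl; rewrite ler_wpM2l ?weight_ge0 // ler_nat.
case: avoidsP => //= h; rewrite lt0b; apply/eqP/setP => t; rewrite !inE.
apply/negP => /andP[tu /eqP e].
have tn : (u - t.+1 < size l)%N by rewrite sl; lia.
case/negP: (h _ tn); rewrite (_ : (u - t.+1).+1 = u - t)%N; last by lia.
by rewrite (_ : u - (u - t) = t)%N; [rewrite -e opprB addrC subrK|lia].
Qed.

Lemma backward_hit u t : (t < u)%N ->
  \sum_(l <- words s u) weight p l * (t \in backward_trace u l)%:R =
  hit_prob s p (u - t) (x u - x t).
Proof.
move=> tu; rewrite (backward_sumE u (fun S => (t \in S)%:R)).
rewrite /hit_prob -(weight_prefix (fun l => (\sum_(z <- l) z == x u - x t)%:R) (leq_subr t u)).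
apply: eq_bigr => l _; rewrite inE tu /=; congr (_ * (nat_of_bool _)%:R).
by apply/eqP/eqP => [<-|->]; rewrite opprB addrC subrK.
Qed.

End traces.

(** At most j pairs u < m <= t have t - u = j, which leads to the sum of j [heat j]. *)
Lemma sum_heat_pairs (R : rcfType) n m :
  \sum_(u : 'I_n | (u < m)%N) \sum_(t : 'I_n | (m <= t)%N) heat R (t - u) <= 2.
Proof.
apply: le_trans _ (sum_mulrn_heat R n).
have h0 := heat_ge0 R.
have count_le j : (\sum_(u : 'I_n | ((u < m) && (m <= u + j))%N) 1 <= j)%N.
  rewrite sum1_card cardE -(size_map val) -[leqRHS](size_iota (m - j) j).
  apply: uniq_leq_size.
    by rewrite map_inj_uniq ?enum_uniq //; apply: val_inj.
  move=> k /mapP[u]; rewrite mem_enum unfold_in => /andP[um mu] ->.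
  rewrite mem_iota; case: u um mu => u' un /=; lia.
apply: (@le_trans _ _ (\sum_(1 <= j < n)
    \sum_(u : 'I_n | ((u < m) && (m <= u + j))%N) heat R j)); last first.
  apply: ler_sum => j _; rewrite sumr_const -[leLHS]mulr_natl ler_wpM2r //.
  by rewrite ler_nat; have := count_le j; rewrite sum1_card.
rewrite [leRHS](exchange_big_dep (fun u : 'I_n => (u < m)%N)) /=; last first.
  by move=> j u; case: (u < m)%N.
apply: ler_sum => u um.
under [leRHS]eq_bigl do rewrite um /=.
rewrite -(big_mkord (fun t => (m <= t)%N) (fun t => heat R (t - u))).
have un := ltn_ord u.
rewrite (@big_cat_nat _ _ _ u.+1) //= big_nat_cond big1 ?add0r; last first.
  by move=> t /andP[/andP[_ tu] mt]; lia.
rewrite -[X in \sum_(X <= _ < n | _) _]add1n big_addn.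
under eq_bigr do rewrite addnK.
under eq_bigl do rewrite addnC.
rewrite [leRHS](@big_cat_nat _ _ _ (n - u)) ?leq_subr ?subn_gt0 //=.
by rewrite lerDl sumr_ge0.
Qed.

(** * Decoupling of past and future patterns *)

Section mixing.
Variables (R : realType) (G : zmodType) (s : seq G) (p : G -> R).
Hypothesis p_ge0 : forall z, 0 <= p z.
Hypothesis (p_sum : \sum_(z <- s) p z = 1).
Variables (C q : R).
Hypotheses (C_ge0 : 0 <= C) (q_gt0 : 0 < q).
Hypothesis hit_le : forall n y, hit_prob s p n y <= C * heat R n.
Hypothesis avoid_ge : forall n (a : nat -> G), q <= avoid_prob s p n a.
Variables (n : nat) (x : nat -> G) (lam : R) (m : nat).
Hypothesis lam_ge0 : 0 <= lam.
Implicit Types (u t : 'I_n).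

Local Notation L := (particle_traces s p n x lam).

Definition initial_times : {set 'I_n} := [set t : 'I_n | (t < m)%N].

Let early := [seq t : 'I_n <- enum 'I_n | (t < m)%N].
(** Decreasing order, so that a prefix lies above its successor: for the future half, the far side
    is the past. *)
Let late := rev [seq t : 'I_n <- enum 'I_n | (m <= t)%N].

Let early_set : [set t in early] = initial_times.
Proof. by apply/setP => t; rewrite !inE mem_filter mem_enum andbT. Qed.

Let late_set : [set t in late] = ~: initial_times.
Proof. by apply/setP => t; rewrite !inE mem_rev mem_filter mem_enum andbT -leqNgt. Qed.

Let pairwise_enum : pairwise (fun u t : 'I_n => (u < t)%N) (enum 'I_n).
Proof.
have := iota_ltn_sorted 0 n; rewrite -val_enum_ord sorted_map => h.
by rewrite -sorted_pairwise // => y z w; apply: ltn_trans.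
Qed.

Let early_pre pre u post : early = pre ++ u :: post -> [set t in pre] \subset below u.
Proof.
move=> e; have : pairwise (fun u t : 'I_n => (u < t)%N) early.
  exact: pairwise_filter pairwise_enum.
rewrite e pairwise_cat => /and3P[/allrelP h _ _].
by apply/subsetP => t; rewrite !inE => tp; apply: h => //; rewrite mem_head.
Qed.

Let late_pre pre u post : late = pre ++ u :: post -> [set t in pre] \subset above u.
Proof.
move=> /(congr1 rev); rewrite revK rev_cat rev_cons -cats1 -catA => e.
have : pairwise (fun u t : 'I_n => (u < t)%N) [seq t : 'I_n <- enum 'I_n | (m <= t)%N].
  exact: pairwise_filter pairwise_enum.
rewrite e catA pairwise_cat => /and3P[/allrelP h _ _].
apply/subsetP => t; rewrite !inE => tp; apply: h; rewrite ?mem_rev //.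
by rewrite mem_cat inE eqxx orbT.
Qed.

(** Given a trace through u whose forward part avoids Z, this is the chance of meeting late times.
    For u outside the early half, 0 is a default value. *)
Let theta1 (Z : {set 'I_n}) u : R := if (u < m)%N then
  hit_given_avoid (words s (n - u)) (weight p) (forward_trace x u) Z (~: initial_times)
  else 0.
Let theta2 (Z : {set 'I_n}) u : R := if (u < m)%N then 0 else
  hit_given_avoid (words s u) (weight p) (backward_trace x u) Z initial_times.

Let weight_nonneg l : 0 <= weight p l. Proof. exact: weight_ge0. Qed.

Let theta1_01 Z u : 0 <= theta1 Z u <= 1.
Proof.
rewrite /theta1; case: ifP => _; last by rewrite lexx ler01.
exact: (hit_given_avoid_01 weight_nonneg (forward_sum1 p_sum u) Z _ q_gt0
  (forward_empty p_ge0 x u avoid_ge)).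
Qed.

Let theta2_01 Z u : 0 <= theta2 Z u <= 1.
Proof.
rewrite /theta2; case: ifP => _; first by rewrite lexx ler01.
exact: (hit_given_avoid_01 weight_nonneg (sum_weight1 p_sum u) Z _ q_gt0
  (backward_empty p_ge0 x u avoid_ge)).
Qed.

Let sum_hits (F : 'I_n -> 'I_n -> R) :
  (forall u t, (u < m)%N -> (m <= t)%N -> F u t <= C * heat R (t - u)) ->
  \sum_(u : 'I_n | (u < m)%N) \sum_(t : 'I_n | (m <= t)%N) F u t <= 2 * C.
Proof.
move=> FC; apply: le_trans _ (ler_wpM2r C_ge0 (sum_heat_pairs R n m)).
rewrite mulr_suml; apply: ler_sum => u um; rewrite mulr_suml.
by apply: ler_sum => t mt; rewrite mulrC FC.
Qed.

Let theta1_prod Z : expR (- (2 * C / q ^+ 2)) <= \prod_(u <- early) (1 - theta1 Z u).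
Proof.
pose kappa u := \sum_(t : 'I_n | (m <= t)%N)
  \sum_(l <- words s (n - u)) weight p l * (t \in forward_trace x u l)%:R.
apply: (@le_trans _ _ (\prod_(u <- early) expR (- (kappa u / q ^+ 2)))).
  rewrite -expR_sum ler_expR sumrN lerN2 -mulr_suml ler_wpM2r ?invr_ge0 ?sqr_ge0 //.
  rewrite big_filter big_enum_cond /=; apply: sum_hits => u t um mt.
  by rewrite forward_hit ?(leq_trans um).
rewrite big_seq [leRHS]big_seq; apply: ler_prod => u.
rewrite mem_filter => /andP[um _]; rewrite expR_ge0 /= /theta1 um.
apply: (one_minus_hit_ge weight_nonneg (forward_sum1 p_sum u) Z q_gt0
  (forward_empty p_ge0 x u avoid_ge)).
by rewrite /kappa le_eqVlt; apply/orP; left; apply/eqP; apply: eq_bigl => t; rewrite !inE -leqNgt.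
Qed.

Let theta2_prod Z : expR (- (2 * C / q ^+ 2)) <= \prod_(u <- late) (1 - theta2 Z u).
Proof.
pose kappa u := \sum_(t : 'I_n | (t < m)%N)
  \sum_(l <- words s u) weight p l * (t \in backward_trace x u l)%:R.
apply: (@le_trans _ _ (\prod_(u <- late) expR (- (kappa u / q ^+ 2)))).
  rewrite -expR_sum ler_expR sumrN lerN2 -mulr_suml ler_wpM2r ?invr_ge0 ?sqr_ge0 //.
  rewrite (perm_big [seq t : 'I_n <- enum 'I_n | (m <= t)%N]) ?perm_rev //=.
  rewrite big_filter big_enum_cond /= exchange_big /=; apply: sum_hits => u t um mt.
  by rewrite backward_hit ?(leq_trans um).
rewrite big_seq [leRHS]big_seq; apply: ler_prod => u.
rewrite mem_rev mem_filter leqNgt => /andP[/negbTE um _]; rewrite expR_ge0 /= /theta2 um.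
apply: (one_minus_hit_ge weight_nonneg (sum_weight1 p_sum u) Z q_gt0
  (backward_empty p_ge0 x u avoid_ge)).
by rewrite /kappa le_eqVlt; apply/orP; left; apply/eqP; apply: eq_bigl => t; rewrite !inE.
Qed.

Let near_far u t : t != u -> (t \in below u) = (t \notin above u).
Proof. by rewrite -(inj_eq val_inj) !inE /= => tu; lia. Qed.

(** First moment: a bridging trace has a pair of visits u < m <= t, and the traces through a given
    pair have mass at most [lam] C [heat (t - u)]. *)
Let both_mass : mass [seq e : R * {set 'I_n} <- L | ~~ [disjoint e.2 & initial_times] &&
    ~~ [disjoint e.2 & ~: initial_times]] <= lam * (2 * C).
Proof.
have L0 : forall e, e \in L -> 0 <= e.1 by apply/allP/particle_traces_nonneg.
pose hits (S : {set 'I_n}) : R := \sum_(t : 'I_n | (m <= t)%N) (t \in S)%:R.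
apply: (@le_trans _ _ (\sum_(u : 'I_n | (u < m)%N)
    \sum_(e <- L | u \in e.2) e.1 * hits (e.2 :&: above u))).
  rewrite /mass big_filter big_mkcond.
  under [leRHS]eq_bigr do rewrite big_mkcond.
  rewrite exchange_big big_seq [leRHS]big_seq; apply: ler_sum => -[w S] /L0 /= w0.
  have nonneg u : 0 <= (if u \in S then w * hits (S :&: above u) else 0).
    by case: ifP => // _; rewrite mulr_ge0 // sumr_ge0.
  case: ifP => [/andP[/pred0Pn[u /andP[uS um]] /pred0Pn[t /andP[tS tm]]]|_]; last first.
    exact: sumr_ge0.
  have {}uS : u \in S := uS; have {}tS : t \in S := tS.
  have {}um : u \in initial_times := um; have {}tm : t \in ~: initial_times := tm.
  rewrite inE in um; rewrite !inE -leqNgt in tm.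
  rewrite (bigD1 u) //= uS -[leLHS]addr0 lerD ?sumr_ge0 //.
  rewrite -[leLHS]mulr1 ler_wpM2l // /hits (bigD1 t) //= !inE tS (leq_trans um tm) /=.
  by rewrite lerDl sumr_ge0.
apply: le_trans _ (ler_wpM2l lam_ge0 (sum_hits (F := fun u t =>
  \sum_(l <- words s (n - u)) weight p l * (t \in forward_trace x u l)%:R) _)); last first.
  by move=> u t um mt; rewrite forward_hit ?(leq_trans um).
rewrite mulr_sumr; apply: ler_sum => u um.
rewrite (particle_traces_product s p x lam u (fun _ S => hits S)).
rewrite le_eqVlt; apply/orP; left; apply/eqP; congr (_ * _).
transitivity (\sum_(l1 <- words s u) weight p l1 *
    \sum_(t : 'I_n | (m <= t)%N) \sum_(l <- words s (n - u)) weight p l * (t \in forward_trace x u l)%:R).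
  apply: eq_bigr => l1 _; rewrite exchange_big mulr_sumr; apply: eq_bigr => l2 _.
  by rewrite -mulr_sumr mulrA.
by rewrite -mulr_suml sum_weight1 // mul1r.
Qed.

(** The three factors stand for the absence of bridging traces and for the truncation costs of the
    past and of the future. *)
Theorem pattern_mixing (V1 V2 : {set 'I_n}) : V1 \subset initial_times -> V2 \subset ~: initial_times ->
  expR (- (lam * (2 * C))) * expR (- (2 * C / q ^+ 2)) * expR (- (2 * C / q ^+ 2)) *
  union_mean L (pattern R initial_times V1) * union_mean L (pattern R (~: initial_times) V2) <=
  union_mean L (fun U => pattern R initial_times V1 U * pattern R (~: initial_times) V2 U).
Proof.
move=> V1S V2S; have L0 : nonneg_weights L by exact: particle_traces_nonneg.
pose Z1 := initial_times :\: V1; pose Z2 := ~: initial_times :\: V2.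
have := pattern_supermultiplicative (L := L) (V1 := V1) (V2 := V2) (c1 := theta1 Z1)
  (c2 := theta2 Z2) (us1 := early) (us2 := late); rewrite early_set late_set /= => main.
apply: le_trans _ (main _ _ _ _ _ _ _ _ _ _) => //.
- have m1 : 0 <= union_mean L (pattern R initial_times V1).
    by apply: union_mean_ge0 => // U; apply: pattern_ge0.
  have m2 : 0 <= union_mean L (pattern R (~: initial_times) V2).
    by apply: union_mean_ge0 => // U; apply: pattern_ge0.
  rewrite !ler_wpM2r // ler_pM ?mulr_ge0 ?expR_ge0 // ler_pM ?expR_ge0 //.
  by rewrite ler_expR lerN2.
- by rewrite filter_uniq ?enum_uniq.
- by rewrite rev_uniq filter_uniq ?enum_uniq.
- move=> pre u post e.
  have um : (u < m)%N.
    have : u \in early by rewrite e mem_cat mem_head orbT.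
    by rewrite mem_filter => /andP[].
  apply: (@independent_past_split _ _ L u (below u) (above u) _ _ (words s u) (words s (n - u))
    (weight p) (weight p) (backward_trace x u) (forward_trace x u) lam) => //.
  + exact: near_far.
  + by rewrite inE ltnn.
  + move=> H; exact: particle_traces_product.
  + exact: early_pre e.
  + by apply/subsetP => t; rewrite !inE -leqNgt; apply: leq_trans.
  + rewrite /theta1 um; exact: (hit_given_avoidE weight_nonneg Z1 _ q_gt0
      (forward_empty p_ge0 x u avoid_ge)).
- move=> pre u post e.
  have um : (u < m)%N = false.
    have : u \in late by rewrite e mem_cat mem_head orbT.
    by rewrite mem_rev mem_filter leqNgt => /andP[/negbTE].
  apply: (@independent_past_split _ _ L u (above u) (below u) _ _ (words s (n - u)) (words s u)
    (weight p) (weight p) (forward_trace x u) (backward_trace x u) lam) => //.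
  + by move=> t tu; rewrite near_far // negbK.
  + by rewrite inE ltnn.
  + move=> H; rewrite (particle_traces_product s p x lam u (fun A B => H B A)).
    congr (_ * _); rewrite exchange_big; apply: eq_bigr => l2 _; apply: eq_bigr => l1 _.
    by rewrite [weight p l1 * _]mulrC.
  + exact: late_pre e.
  + apply/subsetP => t; rewrite !inE => tm; apply: leq_trans tm _.
    by rewrite leqNgt um.
  + rewrite /theta2 um; exact: (hit_given_avoidE weight_nonneg Z2 _ q_gt0
      (backward_empty p_ge0 x u avoid_ge)).
Qed.

End mixing.

(** * Laws of unions and stationarity *)

Section union_law.
Variables (R : realType) (T : finType).
Implicit Types (L : seq (R * {set T})) (V W : {set T}) (f : {set T} -> R).

Definition meeting_mass L V : R := \sum_(e <- L | ~~ (e.2 \subset V)) e.1.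

Lemma union_mean_subset L V :
  union_mean L (fun U => (U \subset V)%:R) = expR (- meeting_mass L V).
Proof.
rewrite /union_mean union_sum_subset -expRD; congr expR.
rewrite /mass (bigID (fun e : R * {set T} => e.2 \subset V)) /=.
by rewrite opprD addrAC addNr add0r.
Qed.

Lemma union_mean_expand L f :
  union_mean L f = \sum_(W : {set T}) f W * union_mean L (fun U => (U == W)%:R).
Proof.
rewrite /union_mean union_sum_expand mulr_sumr.
by apply: eq_bigr => W _; rewrite mulrCA.
Qed.

Lemma union_mean_subset_sum L V :
  \sum_(W : {set T} | W \subset V) union_mean L (fun U => (U == W)%:R) =
  expR (- meeting_mass L V).
Proof.
rewrite -union_mean_subset /union_mean -mulr_sumr -union_sum_sum; congr (_ * _).
by apply: eq_union_sum => U; apply: sum_subset_indicator.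
Qed.

Lemma union_mean_law L1 L2 f : (forall V, meeting_mass L1 V = meeting_mass L2 V) ->
  union_mean L1 f = union_mean L2 f.
Proof.
move=> LL; rewrite !union_mean_expand; apply: eq_bigr => W _; congr (_ * _).
by move: W; apply: subset_sums_inj => V; rewrite !union_mean_subset_sum LL.
Qed.

End union_law.

Section stationarity.
Variables (R : realType) (G : zmodType) (s : seq G) (p : G -> R).
Hypothesis p_sum : \sum_(z <- s) p z = 1.
Variable lam : R.

(* A particle that visits a time outside V has a last such visit. *)
Lemma meeting_massE n (x : nat -> G) (V : {set 'I_n}) :
  meeting_mass (particle_traces s p n x lam) V =
  lam * \sum_(u : 'I_n | u \notin V)
    \sum_(l <- words s (n - u)) weight p l * (forward_trace x u l \subset V)%:R.
Proof.
set L := particle_traces s p n x lam.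
have last_visit (S : {set 'I_n}) : (~~ (S \subset V))%:R =
    \sum_(u : 'I_n | u \notin V) (if u \in S then (S :&: above u \subset V)%:R else 0) :> R.
  case: (boolP (S \subset V)) => SV.
    rewrite big1 // => u uV; case: ifP => // uS.
    by rewrite (subsetP SV u uS) in uV.
  have /subsetPn[u0 u0S u0V] := SV.
  case: (@arg_maxnP _ u0 (fun u : 'I_n => (u \in S) && (u \notin V)) val) => [|u /andP[uS uV] umax].
    by rewrite u0S.
  rewrite (bigD1 u) //= uS.
  have -> : S :&: above u \subset V.
    apply/subsetP => t; rewrite !inE => /andP[tS ut]; apply/negPn/negP => tV.
    by have := umax t; rewrite tS tV /= => /(_ isT); rewrite leqNgt ut.
  rewrite big1 ?addr0 // => t /andP[tV tu]; case: ifP => // tS.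
  rewrite (_ : _ \subset _ = false) //; apply/negP => /subsetP/(_ u); rewrite !inE uS (negbTE uV) /=.
  have := umax t; rewrite tS tV => /(_ isT) /= le_tu.
  suff -> : (t < u)%N by move/(_ isT).
  by rewrite ltn_neqAle le_tu andbT.
rewrite /meeting_mass big_mkcond /=.
transitivity (\sum_(e <- L) \sum_(u : 'I_n | u \notin V)
    (if u \in e.2 then e.1 * (e.2 :&: above u \subset V)%:R else 0)).
  apply: eq_bigr => e _; transitivity (e.1 * (~~ (e.2 \subset V))%:R).
    by case: ifP => _; rewrite ?mulr1 ?mulr0.
  rewrite last_visit mulr_sumr; apply: eq_bigr => u _.
  by case: ifP => _; rewrite ?mulr0.
rewrite exchange_big mulr_sumr; apply: eq_bigr => u _ /=.
rewrite -big_mkcond (particle_traces_product s p x lam u (fun _ S => (S \subset V)%:R)).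
congr (_ * _); rewrite -[RHS]mul1r -(sum_weight1 p_sum u) mulr_suml.
by apply: eq_bigr => l1 _; rewrite mulr_sumr; apply: eq_bigr => l2 _; rewrite mulrA.
Qed.

Definition shift_set m k (U : {set 'I_(m + k)}) : {set 'I_k} := [set t | rshift m t \in U].

(** Stationarity: the last-visit formula involves only the steps after a visit, so it is unchanged
    by time shifts and translations. The times before m are neutralised by putting them all into
    [V']. *)
Lemma shift_law m k (x y : nat -> G) (c : G) (f : {set 'I_k} -> R) :
  (forall t, y t = x (m + t)%N - c) ->
  union_mean (particle_traces s p (m + k) x lam) (fun U => f (shift_set U)) =
  union_mean (particle_traces s p k y lam) f.
Proof.
move=> yx; set L := particle_traces s p (m + k) x lam.
have -> : union_mean L (fun U => f (shift_set U)) =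
    union_mean [seq (e.1, shift_set e.2) | e <- L] f.
  rewrite /union_mean union_sum_map /mass ?big_map //.
    by apply/setP => t; rewrite !inE.
  by move=> S U; apply/setP => t; rewrite !inE.
apply: union_mean_law => V.
pose V' : {set 'I_(m + k)} := ~: [set rshift m t | t in ~: V].
have V'P t : (rshift m t \in V') = (t \in V).
  by rewrite inE mem_imset ?inE ?negbK //; apply: rshift_inj.
have V'm (t : 'I_(m + k)) : (t < m)%N -> t \in V'.
  move=> tm; rewrite inE; apply/imsetP => -[t' _ e].
  by move: tm; rewrite e /= ltnNge leq_addr.
have V'shift (S : {set 'I_(m + k)}) : (shift_set S \subset V) = (S \subset V').
  apply/subsetP/subsetP => h t tS; last by rewrite -V'P; apply: h; rewrite inE in tS.
  have [tm|mt] := ltnP t m; first exact: V'm.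
  have tk : (t - m < k)%N by rewrite ltn_subLR.
  have te : t = rshift m (Ordinal tk) by apply: val_inj; rewrite /= subnKC.
  by rewrite te V'P; apply: h; rewrite inE -te.
have -> : meeting_mass [seq (e.1, shift_set e.2) | e <- L] V = meeting_mass L V'.
  by rewrite /meeting_mass big_map; apply: eq_bigl => e; rewrite V'shift.
rewrite !meeting_massE; congr (_ * _).
rewrite big_split_ord /= big_pred0 ?add0r; last first.
  by move=> t; rewrite V'm //= ltn_ord.
apply: eq_big => [u|u _]; first by rewrite V'P.
rewrite (_ : m + k - (m + u) = k - u)%N; last by rewrite subnDl.
apply: eq_bigr => l _; rewrite -V'shift.
have -> // : shift_set (forward_trace x (rshift m u) l) = forward_trace y u l.
apply/setP => t; rewrite !inE /= ltn_add2l subnDl !yx.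
by rewrite addrAC (inj_eq (addIr _)).
Qed.

End stationarity.

From mathcomp Require Import finmap all_classical all_reals all_analysis measurable_realfun.

(** * Non-degenerate step laws *)

Section nondegenerate_directions.
Variables (R : realType) (d : nat) (p : 'rV[int]_d -> R).
Implicit Types (z : 'rV[int]_d) (F : 'rV[int]_d -> R).

Lemma finite_range_support : finite_range_distribution p ->
  exists s : seq 'rV[int]_d,
    [/\ uniq s, forall z, (z \in s) = (0 < p z), \sum_(z <- s) p z = 1 &
        forall F, \sum_(z \in [set z | 0 < p z]%classic) F z = \sum_(z <- s) F z].
Proof.
move=> [_ fin sum1].
have E F : \sum_(z \in [set z | 0 < p z]%classic) F z =
    \sum_(z <- fset_set [set z | 0 < p z]%classic) F z by rewrite fsbig_finite.
exists (fset_set [set z | 0 < p z]%classic); split=> //.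
- exact: fset_uniq.
- by move=> z; rewrite in_fset_set //; apply/idP/idP => [/set_mem|h]; last exact/mem_set.
- by rewrite -E.
Qed.

Definition dual_coordinate (E : 'M[R]_d) (i : 'I_d) z : R :=
  (map_mx intr z *m invmx E) 0 i.

Lemma dual_coordinate_is_additive E i : zmod_morphism (dual_coordinate E i).
Proof. by move=> x y; rewrite /dual_coordinate map_mxB mulmxBl !mxE. Qed.

HB.instance Definition _ E i := GRing.isZmodMorphism.Build _ _ (dual_coordinate E i)
  (dual_coordinate_is_additive E i).

(** If the differences z - a of support points did not span, the covariance matrix would kill a
    nonzero vector orthogonal to them. So d of them are the rows of an invertible [E], whose dual
    basis gives the functionals. *)
Lemma covariance_directions (s : seq 'rV[int]_d) :
  (forall z, (z \in s) = (0 < p z)) -> \sum_(z <- s) p z = 1 ->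
  (forall F, \sum_(z \in [set z | 0 < p z]%classic) F z = \sum_(z <- s) F z) ->
  covariance_mx p \in unitmx ->
  exists (a : 'rV[int]_d) (b : 'I_d -> 'rV[int]_d) (phi : 'I_d -> {additive 'rV[int]_d -> R}),
    [/\ a \in s, forall i, b i \in s, forall i, phi i (b i) != phi i a &
        forall i j, i != j -> phi i (b j) = phi i a].
Proof.
move=> mem_s sum_s fsum unit_cov.
have s0 : s != [::].
  by apply/eqP => s0; have := sum_s; rewrite s0 big_nil => /esym/eqP; rewrite oner_eq0.
pose a := head 0 s.
have sa : a \in s by rewrite /a; case: (s) s0 => // z s' _; rewrite mem_head.
pose V : 'M[R]_(size s, d) := \matrix_(k, j) ((nth 0 s k) 0 j - a 0 j)%:~R.
have full : row_full V.
  rewrite -cokermx_eq0; apply/eqP; set X := cokermx V.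
  have VX : V *m X = 0 by exact: mulmx_coker.
  suff covX : covariance_mx p *m X = 0 by rewrite -[X](mulKmx unit_cov) covX mulmx0.
  have row_const z k : z \in s -> \sum_j ((z 0 j)%:~R : R) * X j k = \sum_j (a 0 j)%:~R * X j k.
    move=> zs; have idx : (index z s < size s)%N by rewrite index_mem.
    move/matrixP/(_ (Ordinal idx) k): VX.
    rewrite !mxE => /eqP; under eq_bigr do rewrite mxE /= nth_index // rmorphB mulrBl.
    by rewrite sumrB subr_eq0 => /eqP.
  have mean_const k : \sum_j mean p j * X j k = \sum_j (a 0 j)%:~R * X j k.
    rewrite /mean; under eq_bigr do rewrite fsum mulr_suml.
    rewrite exchange_big /= -[RHS]mul1r -[X in X * _]sum_s [RHS]mulr_suml big_seq [RHS]big_seq.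
    apply: eq_bigr => z zs; rewrite -(row_const z k zs) mulr_sumr.
    by apply: eq_bigr => j _; rewrite mulrA.
  apply/matrixP => i k; rewrite !mxE.
  under eq_bigr do rewrite mxE fsum mulr_suml.
  rewrite exchange_big /= big_seq big1 // => z zs.
  transitivity (p z * ((z 0 i)%:~R - mean p i) *
    (\sum_j (z 0 j)%:~R * X j k - \sum_j mean p j * X j k)).
    rewrite -sumrB mulr_sumr; apply: eq_bigr => j _.
    by rewrite -mulrBl !mulrA.
  by rewrite mean_const row_const // subrr mulr0.
pose f := fullrankfun full; pose E := rowsub f V.
have unitE : E \in unitmx by exact: fullrowsub_unit.
pose b (i : 'I_d) := nth 0 s (f i).
have phiB i j : dual_coordinate E i (b j) - dual_coordinate E i a = (i == j)%:R.
  rewrite -raddfB /= /dual_coordinate.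
  have -> : map_mx intr (b j - a) = row j E.
    by apply/rowP => k; rewrite !mxE.
  by rewrite -row_mul mulmxV // !mxE eq_sym.
exists a, b, (fun i => dual_coordinate E i : {additive 'rV[int]_d -> R}); split=> //.
- by move=> i; rewrite mem_nth.
- by move=> i; rewrite -subr_eq0 phiB eqxx oner_eq0.
- by move=> i j ij; apply/eqP; rewrite -subr_eq0 phiB (negbTE ij).
Qed.

End nondegenerate_directions.

Lemma positive_lower_bound (R : realFieldType) (X : eqType) (F : X -> R) (s : seq X) :
  (forall x, x \in s -> 0 < F x) -> exists2 m, 0 < m & forall x, x \in s -> m <= F x.
Proof.
elim: s => [_|x s IH F0]; first by exists 1.
have [m m0 mF] := IH (fun y ys => F0 y (mem_behead (s := x :: s) ys)).
exists (Num.min m (F x)); first by rewrite lt_min m0 F0 ?mem_head.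
by move=> y; rewrite inE => /orP[/eqP ->|/mF h]; rewrite ge_min ?lexx ?orbT ?h.
Qed.

Theorem walk_bounds (R : realType) (d : nat) (p : 'rV[int]_d -> R) (s : seq 'rV[int]_d) :
  (5 <= d)%N -> finite_range_distribution p -> covariance_mx p \in unitmx ->
  uniq s -> (forall z, (z \in s) = (0 < p z)) -> \sum_(z <- s) p z = 1 ->
  (forall F : 'rV[int]_d -> R, \sum_(z \in [set z | 0 < p z]%classic) F z = \sum_(z <- s) F z) ->
  exists C q : R, [/\ 0 <= C, 0 < q,
    forall n y, hit_prob s p n y <= C * heat R n &
    forall n t, q <= avoid_prob s p n t].
Proof.
move=> d5 [p0 _ _] unit_cov s_uniq mem_s sum_s fsum.
have [a [b [phi [sa sb phi_ii phi_ij]]]] := covariance_directions mem_s sum_s fsum unit_cov.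
have [th th0 thP] : exists2 th, 0 < th & forall z, z \in s -> th <= p z.
  by apply: positive_lower_bound => z; rewrite mem_s.
have th1 : th <= 1.
  apply: le_trans (thP a sa) _; rewrite -sum_s (bigD1_seq a) //= lerDl.
  by apply: sumr_ge0.
have half z : z \in s -> th / 2 <= p z.
  move=> zs; apply: le_trans (thP z zs).
  by rewrite ler_pdivrMr // mulr_natr mulr2n lerDl ltW.
pose w (i : 'I_5) := widen_ord d5 i.
have th01 : 0 < th <= 1 by rewrite th0 th1.
have heat_le := heat_kernel_bound s_uniq p0 sum_s th01 (a := fun=> a) (b := b \o w)
  (phi := phi \o w).
pose C := rsqrt (th / 10) ^+ 5.
have C0 : 0 <= C by rewrite exprn_ge0 // rsqrt_ge0.
have {}heat_le n y : hit_prob s p n y <= C * heat R n.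
  apply: heat_le => [i|i|i j ij] /=; last 2 first.
  - exact: phi_ii.
  - by apply: phi_ij; rewrite -(inj_eq val_inj) /= in ij *.
  by split=> //; apply: half.
pose i0 : 'I_5 := inord 0; pose i1 : 'I_5 := inord 1.
have i01 : w i0 != w i1 by rewrite -(inj_eq val_inj) /= !inordK.
pose t i := phi (w i) (b (w i)) - phi (w i) a.
have t0 i : t i != 0 by rewrite subr_eq0 phi_ii.
(* Avoidance requires three support points at distinct levels of one functional. Normalised dual
   coordinates with weights 1 and 2 put a and two of the points b at three consecutive levels. *)
pose psi z := phi (w i0) z / t i0 + 2 * (phi (w i1) z / t i1).
have psiD : {morph psi : x y / x + y} by move=> x y; rewrite /psi !raddfD; ring.
have psi0 : psi (b (w i0)) = psi a + 1.
  rewrite /psi (phi_ij (w i1) (w i0)) 1?eq_sym //.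
  rewrite -[phi (w i0) (b _)](subrK (phi (w i0) a)) -/(t i0).
  by field; rewrite !t0.
have psi1 : psi (b (w i1)) = psi a + 2.
  rewrite /psi (phi_ij (w i0) (w i1)) //.
  rewrite -[phi (w i1) (b _)](subrK (phi (w i1) a)) -/(t i1).
  by field; rewrite !t0.
have lt1 : psi a < psi (b (w i0)) by rewrite psi0 ltrDl.
have lt2 : psi (b (w i0)) < psi (b (w i1)) by rewrite psi0 psi1 ltrD2l; lra.
have [q q0 qP] := avoidance s_uniq p0 sum_s th0 thP psiD sa (sb (w i0)) (sb (w i1))
  lt1 lt2 C0 heat_le.
by exists C, q.
Qed.

Import numFieldNormedType.Exports.
Local Open Scope classical_set_scope.
Local Open Scope ring_scope.

(** * The Poisson system of particles *)

Section discrete_variables.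
Context {disp : measure_display} {T : measurableType disp}.

Lemma measurable_preimage_discrete (I : countType) (X : T -> I) (B : set I) :
  discrete_rv X -> measurable (X @^-1` B).
Proof.
move=> mX; rewrite (_ : X @^-1` B = \bigcup_i (if `[< B i >] then X @^-1` [set i] else set0)).
  by apply: (countable_bigcupT_measurable (countableP _)) => i; case: ifP => // _; apply: mX.
apply/seteqP; split=> [om BX|om [i _]]; first by exists (X om) => //; rewrite asboolT.
by case: asboolP => // Bi; rewrite /preimage /= => ->.
Qed.

Context {R : realType} (mu : probability T R).

Lemma null_countable_bigcup (I : countType) (F : I -> set T) :
  (forall i, measurable (F i)) -> (forall i, mu (F i) = 0%E) -> mu (\bigcup_i F i) = 0%E.
Proof.
move=> mF F0; apply/negligibleP; first exact: (countable_bigcupT_measurable (countableP _)).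
rewrite (_ : \bigcup_i F i = \bigcup_k (oapp F set0 (choice.unpickle k))).
  apply: negligible_bigcup => k; case: choice.unpickle => [i|]; last exact: negligible_set0.
  by apply/negligibleP; [exact: mF|exact: F0].
apply/seteqP; split=> [om [i _ iF]|om [k _]].
  by exists (choice.pickle i) => //; rewrite choice.pickleK.
by case: choice.unpickle => // i iF; exists i.
Qed.

Lemma measure_split_seq (U : eqType) (X : T -> U) (A : set T) (S : seq U) :
  measurable A -> discrete_rv X -> uniq S ->
  mu (A `&` [set om | X om \in S]) = (\sum_(e <- S) mu (A `&` X @^-1` [set e]))%E.
Proof.
move=> mA mX; elim: S => [_|e S IH /= /andP[eS uS]].
  rewrite big_nil (_ : _ `&` _ = set0) ?measure0 //.
  by apply/seteqP; split=> om // -[].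
rewrite big_cons -IH // -measureU.
- congr (mu _); apply/seteqP; split=> om /=; rewrite inE.
    by case=> Aom /orP[/eqP|] h; [left|right].
  by case=> -[Aom h]; split=> //; rewrite h ?eqxx ?orbT.
- by apply: measurableI => //; apply: mX.
- apply: measurableI => //; elim: {IH eS uS} S => [|e' S IH].
    by rewrite (_ : [set om | _] = set0) //; apply/seteqP; split.
  rewrite (_ : [set om | _] = X @^-1` [set e'] `|` [set om | X om \in S]).
    by apply: measurableU => //; apply: mX.
  apply/seteqP; split=> om /=; rewrite inE; first by case/orP => [/eqP|]; [left|right].
  by case=> -> ; rewrite ?eqxx ?orbT.
- apply/seteqP; split=> om //= -[[_ h] [_]]; rewrite /preimage /= in h.
  by rewrite h (negbTE eS).
Qed.

End discrete_variables.

Lemma cvg_prod_seq (R : realType) (I : eqType) (r : seq I) (f : I -> nat -> R) (a : I -> R) :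
  (forall i, f i k @[k --> \oo] --> a i) ->
  \prod_(i <- r) f i k @[k --> \oo] --> \prod_(i <- r) a i.
Proof.
move=> fa; elim: r => [|i r IH].
  by rewrite big_nil; under eq_fun do rewrite big_nil; apply: cvg_cst.
rewrite big_cons; under eq_fun do rewrite big_cons.
exact: cvgM.
Qed.

Section particle_words.
Context {disp : measure_display} {T : measurableType disp} {R : realType} {d : nat}.
Variables (N0 : 'rV[int]_d -> T -> nat)
  (xi : 'rV[int]_d -> nat -> nat -> T -> 'rV[int]_d).
Variables (p : 'rV[int]_d -> R) (lambda : R) (mu : probability T R).
Hypothesis driving : particle_driving N0 xi p lambda mu.
Variable n : nat.
Local Notation G := 'rV[int]_d.
Implicit Types (y : G) (ys : seq G) (om : T) (cc : G -> seq (seq G)).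

(** The history up to time n of all particles from y becomes a single value in a countable type, so
    every event about it is measurable. *)
Definition particle_words y om : seq (seq G) :=
  mkseq (fun i => mkseq (fun r => xi y i r om) n) (N0 y om).

Definition coordinate_event cc (j : G + G * nat * nat) : set T :=
  match j with
  | inl y => N0 y @^-1` [set size (cc y)]
  | inr (y, i, r) => xi y i r @^-1` [set nth 0 (nth [::] (cc y) i) r]
  end.

(** Only steps of existing particles are listed, so independence is applied to a finite family. *)
Definition coordinates ys cc : seq (G + G * nat * nat) :=
  map inl ys ++ map inr [seq (e, r) |
    e <- [seq (y, i) | y <- ys, i <- iota 0 (size (cc y))], r <- iota 0 n].

Lemma particle_words_event ys cc : {in ys, forall y, all (fun l => size l == n) (cc y)} ->
  [set om | {in ys, forall y, particle_words y om = cc y}] =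
  \bigcap_(j in [set` coordinates ys cc]) coordinate_event cc j.
Proof.
move=> size_cc; apply/seteqP; split=> om /= h.
  move=> j /=; rewrite mem_cat => /orP[/mapP[y yys ->]|/mapP[e]].
    by rewrite /= /preimage /= -h // size_mkseq.
  case/allpairsP=> -[e' r] /= [/allpairsPdep[y [i [yys]]] ].
  rewrite !mem_iota /= !add0n => ic -> rn -> {j}->.
  have sN : size (cc y) = N0 y om by rewrite -h // size_mkseq.
  by rewrite /= /preimage /= -h // nth_mkseq -?sN // nth_mkseq.
move=> y yys.
have sN : N0 y om = size (cc y).
  by apply: (h (inl y)); rewrite /= mem_cat map_f.
apply: (@eq_from_nth _ [::]); first by rewrite size_mkseq.
move=> i; rewrite size_mkseq => iN; rewrite nth_mkseq //.
have ic : (i < size (cc y))%N by rewrite -sN.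
have/eqP sl := all_nthP [::] (size_cc _ yys) i ic.
apply: (@eq_from_nth _ 0); first by rewrite size_mkseq.
move=> r; rewrite size_mkseq => rn; rewrite nth_mkseq //.
apply: (h (inr (y, i, r))); rewrite /= mem_cat; apply/orP; right.
apply: map_f; apply/allpairsP; exists ((y, i), r); split=> //=; last by rewrite mem_iota.
by apply/allpairsPdep; exists y, i; rewrite mem_iota.
Qed.

Lemma measurable_coordinate_event cc j : measurable (coordinate_event cc j).
Proof.
case: driving => mN mxi _ _ _.
by case: j => [y|[[y i] r]]; [apply: mN|apply: mxi].
Qed.

Lemma discrete_particle_words y : discrete_rv (particle_words y).
Proof.
move=> c; case: (boolP (all (fun l => size l == n) c)) => hc.
  rewrite (_ : _ @^-1` _ = [set om | {in [:: y], forall y', particle_words y' om = (fun=> c) y'}]).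
    rewrite particle_words_event //; apply: fin_bigcap_measurable => // j _.
    exact: measurable_coordinate_event.
  apply/seteqP; split=> om /= h; first by move=> y'; rewrite inE => /eqP ->.
  by apply: h; rewrite inE.
rewrite (_ : _ @^-1` _ = set0) //; apply/seteqP; split=> om //= h.
case/negP: hc; rewrite -h; apply/allP => l /mapP[i _ ->].
by rewrite size_mkseq.
Qed.

Definition poisson_mass (k : nat) : R := lambda ^+ k / k`!%:R * expR (- lambda).

Definition words_mass (c : seq (seq G)) : R := poisson_mass (size c) * \prod_(l <- c) weight p l.

Lemma uniq_coordinates ys cc : uniq ys -> uniq (coordinates ys cc).
Proof.
move=> uys; rewrite cat_uniq map_inj_uniq ?uys; last by move=> ? ? [].
rewrite map_inj_uniq; last by move=> ? ? [].
apply/and3P; split=> //; first by apply/hasPn => j /mapP[e _ ->]; apply/mapP => -[].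
apply: allpairs_uniq; rewrite ?iota_uniq //; last by move=> [? ?] [? ?] _ _ [-> ->].
apply: allpairs_uniq_dep => // [y _|]; first exact: iota_uniq.
by move=> [? ?] [? ?] _ _ /= [-> ->].
Qed.

Lemma particle_words_prob ys cc : uniq ys ->
  {in ys, forall y, all (fun l => size l == n) (cc y)} ->
  mu [set om | {in ys, forall y, particle_words y om = cc y}] =
  (\prod_(y <- ys) words_mass (cc y))%:E.
Proof.
move=> uys size_cc; rewrite particle_words_event //.
case: driving => _ _ prN prxi indep.
pose J := [fset j in coordinates ys cc]%fset.
have JE j : (j \in J) = (j \in coordinates ys cc) by rewrite /J in_fset.
have mJ : [set` coordinates ys cc] = [set` J] by apply/seteqP; split=> j /=; rewrite JE.
rewrite mJ indep; last first.
  case=> [y|[[y i] r]] _ /=; first by exists [set size (cc y)].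
  by exists [set nth 0 (nth [::] (cc y) i) r].
rewrite (perm_big (coordinates ys cc)) /=; last first.
  by apply: uniq_perm; rewrite ?fset_uniq ?uniq_coordinates.
rewrite big_cat /= !big_map /=.
under eq_bigr do rewrite prN.
rewrite big_allpairs_dep /= big_allpairs_dep /=.
under [X in (_ * X)%E]eq_bigr do under eq_bigr do under eq_bigr do rewrite prxi.
under [X in (_ * X)%E]eq_bigr do under eq_bigr do rewrite prodEFin.
under [X in (_ * X)%E]eq_bigr do rewrite prodEFin.
rewrite !prodEFin -EFinM -big_split /=; congr (_%:E).
rewrite big_seq [RHS]big_seq; apply: eq_bigr => y yys; congr (_ * _).
rewrite [RHS](big_nth [::]) /index_iota subn0 big_seq [RHS]big_seq.
apply: eq_bigr => i; rewrite mem_iota add0n => /= ic.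
have/eqP sl := all_nthP [::] (size_cc _ yys) i ic.
by rewrite /weight [RHS](big_nth 0) /index_iota subn0 sl.
Qed.

Local Notation Z := particle_words.
Local Notation wm := words_mass.
Local Notation fixed ys cc := [set om | {in ys, forall y, Z y om = cc y}].
Local Notation among ys S := [set om | {in ys, forall y, Z y om \in S y}].
Let valid (c : seq (seq G)) := all (fun l => size l == n) c.

Lemma measurable_particle_words ys (B : G -> set (seq (seq G))) :
  measurable [set om | {in ys, forall y, B y (Z y om)}].
Proof.
rewrite (_ : [set om | _] = \bigcap_(y in [set` ys]) Z y @^-1` B y).
  apply: fin_bigcap_measurable => // y _; apply: measurable_preimage_discrete.
  exact: discrete_particle_words.
by apply/seteqP; split=> om /= h y; apply: h.
Qed.

(** Starting points are fixed one at a time to exact values, where the product formula is known;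
    summing back gives a product of sums. *)
Lemma particle_words_prob_seq ys1 ys2 cc (S : G -> seq (seq (seq G))) :
  uniq (ys1 ++ ys2) -> {in ys1, forall y, valid (cc y)} ->
  {in ys2, forall y, uniq (S y) && all valid (S y)} ->
  mu (fixed ys1 cc `&` among ys2 S) =
  ((\prod_(y <- ys1) wm (cc y)) * \prod_(y <- ys2) \sum_(c <- S y) wm c)%:E.
Proof.
elim: ys2 ys1 cc => [|y ys2 IH] ys1 cc uys v1 v2.
  rewrite big_nil mulr1 (_ : [set om | {in [::], _}] = setT) ?setIT.
    by rewrite cats0 in uys; rewrite particle_words_prob.
  by apply/seteqP; split.
have yS : y \in y :: ys2 by rewrite mem_head.
have /andP[uS vS] := v2 y yS.
rewrite (_ : _ `&` _ = (fixed ys1 cc `&` among ys2 S) `&` [set om | Z y om \in S y]); last first.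
  apply/seteqP; split=> om /=.
    by move=> [h1 h2]; split; [split=> // z zS|]; apply: h2; rewrite // inE zS orbT.
  by move=> [[h1 h2] h3]; split=> // z; rewrite inE => /orP[/eqP ->//|]; apply: h2.
rewrite measure_split_seq //; last 2 first.
- apply: measurableI; last exact: (measurable_particle_words ys2 (fun y => [set c | c \in S y])).
  exact: (measurable_particle_words ys1 (fun y => [set c | c = cc y])).
- exact: discrete_particle_words.
pose cc' e z := if z == y then e else cc z.
have uys' : uniq ((y :: ys1) ++ ys2).
  have pe : perm_eq (ys1 ++ y :: ys2) ((y :: ys1) ++ ys2) by rewrite -(cat1s y ys2) perm_catCA.
  by rewrite -(perm_uniq pe).
have y1 : y \notin ys1 by move: uys'; rewrite /= mem_cat negb_or => /andP[/andP[]].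
have piece e : e \in S y -> mu ((fixed ys1 cc `&` among ys2 S) `&` Z y @^-1` [set e]) =
    (wm e * ((\prod_(y <- ys1) wm (cc y)) * \prod_(y <- ys2) \sum_(c <- S y) wm c))%:E.
  move=> eS; rewrite (_ : _ `&` _ = fixed (y :: ys1) (cc' e) `&`
      among ys2 S); last first.
    apply/seteqP; split=> om /=.
      move=> [[h1 h2] h3]; split=> // z; rewrite inE /cc'.
      by case: eqP => [->//|_]; apply: h1.
    move=> [h1 h2]; split; [split=> // z z1|].
      have := h1 z; rewrite inE z1 orbT /cc' => ->//.
      by case: eqP z1 y1 => // -> ->.
    by have := h1 y; rewrite mem_head /cc' eqxx => ->.
  rewrite IH //; last 2 first.
  - move=> z; rewrite inE /cc'; case: eqP => [_ _|_ /=]; last exact: v1.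
    exact: (allP vS).
  - by move=> z z2; apply: v2; rewrite inE z2 orbT.
  rewrite big_cons /cc' eqxx mulrA; congr (_ * _ * _)%:E.
  by apply: eq_big_seq => z z1; case: eqP z1 y1 => // -> ->.
rewrite big_seq (eq_bigr _ piece) -big_seq sumEFin; congr (_%:E).
by rewrite -mulr_suml big_cons mulrCA.
Qed.

(* The words of k particles contribute the k-th term of an exponential series. *)
Lemma particle_words_within ys (W : G -> seq (seq G)) :
  uniq ys -> (forall y, uniq (W y)) -> (forall y, valid (W y)) ->
  mu [set om | {in ys, forall y, all (mem (W y)) (Z y om)}] =
  (\prod_(y <- ys) expR (- (lambda * (1 - \sum_(l <- W y) weight p l))))%:E.
Proof.
(* Fewer than M particles per starting point leave finitely many configurations; continuity of the
   measure lets M tend to infinity. *)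
move=> uys uW vW; pose S M y := flatten [seq words (W y) k | k <- iota 0 M].
have memS M y c : (c \in S M y) = (size c < M)%N && all (mem (W y)) c.
  apply/flatten_mapP/andP => [[k]|[cM cW]].
    by rewrite mem_iota mem_words /= add0n => kM /andP[/eqP -> ->].
  by exists (size c); rewrite ?mem_iota // mem_words eqxx.
have uS M y : uniq (S M y).
  elim: M => [//|M IH]; rewrite /S -[M.+1]addn1 iotaD map_cat flatten_cat /= add0n cats0.
  rewrite cat_uniq IH uniq_words ?uW // andbT; apply/hasPn => c.
  rewrite mem_words => /andP[/eqP sc _]; rewrite -[flatten _]/(S M y) memS sc ltnn //.
have vS M y : all valid (S M y).
  apply/allP => c; rewrite memS => /andP[_ /allP cW]; apply/allP => l /cW.
  exact: (allP (vW y)).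
pose F M := [set om | {in ys, forall y, Z y om \in S M y}].
have FE M : mu (F M) = (\prod_(y <- ys) \sum_(c <- S M y) wm c)%:E.
  have := @particle_words_prob_seq [::] ys (fun=> [::]) (S M).
  rewrite big_nil mul1r /= => <- //; last by move=> y _; rewrite uS vS.
  by congr (mu _); apply/seteqP; split=> om //= [].
have mF M : measurable (F M).
  exact: (measurable_particle_words ys (fun y => [set c | c \in S M y])).
have UF : [set om | {in ys, forall y, all (mem (W y)) (Z y om)}] = \bigcup_M F M.
  apply/seteqP; split=> om /=.
    move=> h; exists (\max_(y <- ys) size (Z y om)).+1 => // y yys.
    by rewrite memS h // andbT ltnS; apply: leq_bigmax_seq.
  by move=> [M _ h] y yys; have := h y yys; rewrite memS => /andP[].
have h1 : (mu \o F) M @[M --> \oo] --> mu (\bigcup_M F M).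
  apply: nondecreasing_cvg_mu => //; first by rewrite -UF;
    exact: (measurable_particle_words ys (fun y => [set c | all (mem (W y)) c])).
  move=> M M' MM'; apply/subsetPset => om /= h y yys; have := h y yys.
  by rewrite !memS => /andP[cM ->]; rewrite (leq_trans cM).
have h2 : (mu \o F) M @[M --> \oo] -->
    (\prod_(y <- ys) expR (- (lambda * (1 - \sum_(l <- W y) weight p l))))%:E.
  rewrite (_ : mu \o F = fun M => (\prod_(y <- ys) \sum_(c <- S M y) wm c)%:E); last first.
    by apply/funext => M /=; rewrite FE.
  apply: cvg_EFin; first by near=> M.
  apply: cvg_prod_seq => y.
  set rho := \sum_(l <- W y) _.
  rewrite (_ : (fun M => _) = (fun M => expR (- lambda) * series (exp_coeff (lambda * rho)) M)).
    rewrite (_ : expR (- (lambda * _)) = expR (- lambda) * expR (lambda * rho)).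
      by apply: cvgM; [exact: cvg_cst|exact: is_cvg_series_exp_coeff].
    by rewrite -expRD; congr expR; ring.
  apply/funext => M; rewrite /series /= mulr_sumr /S big_flatten /= big_map /index_iota subn0.
  apply: eq_bigr => k _; rewrite /words_mass /poisson_mass.
  transitivity (lambda ^+ k / k`!%:R * expR (- lambda) * rho ^+ k).
    rewrite -sum_weight mulr_sumr; apply: eq_words => c sc.
    by rewrite sc.
  by rewrite /exp_coeff /= exprMn; ring.
by rewrite UF; apply: (cvg_unique _ h1 h2).
Unshelve. all: by end_near.
Qed.

Variable s : seq G.
Hypotheses (s_uniq : uniq s) (p_ge0 : forall z, 0 <= p z).
Hypotheses (mem_s : forall z, (z \in s) = (0 < p z)) (p_sum : \sum_(z <- s) p z = 1).
Local Notation occ := (occupation (R := R) N0 xi).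

Lemma occupationP om t y :
  reflect (exists x i, (i < N0 x om)%N /\ particle_position xi om x i t = y) (occ om t y).
Proof.
rewrite /occupation /particle_count; set D := [set _ | _].
apply: (iffP idP) => [|[x [i [iN e]]]].
  case: (pselect (D !=set0)) => [[[x i] [/= iN e]] _|]; first by exists x, i.
  move=> /set0P/negP; rewrite negbK => /eqP ->.
  by rewrite esum_set0 lee_fin ler10.
apply: esum_ge; exists [set (x, i)]; last by rewrite fsbig_set1.
by split; [exact: finite_set1|move=> _ /= ->].
Qed.

Variable x : nat -> G.

(** A site is empty when no trace contains its time, so a condition on the field becomes one on each
    starting point separately. *)
Lemma unoccupiedP om (V : {set 'I_n}) :
  (forall t : 'I_n, t \notin V -> ~~ occ om t (x t)) <->
  (forall y, all (fun l => trace n x y l \subset V) (Z y om)).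
Proof.
have pos y i (t : 'I_n) : y + \sum_(z <- take t (mkseq (fun r => xi y i r om) n)) z =
    particle_position xi om y i t.
  rewrite /particle_position /mkseq -map_take take_iota (minn_idPl (ltnW (ltn_ord t))).
  have -> : iota 0 t = index_iota 0 t by rewrite /index_iota subn0.
  by rewrite big_map big_mkord.
split=> [h y|h t tV].
  apply/allP => l /mapP[i]; rewrite mem_iota add0n => /= iN ->.
  apply/fintype.subsetP => t; rewrite inE pos => /eqP e; apply: contraT => /h.
  by case/occupationP; exists y, i.
apply/occupationP => -[y [i [iN e]]].
have /allP/(_ (mkseq (fun r => xi y i r om) n)) := h y.
have iZ : mkseq (fun r => xi y i r om) n \in Z y om by apply: map_f; rewrite mem_iota.
move=> /(_ iZ) /fintype.subsetP/(_ t); rewrite inE pos e eqxx => /(_ isT) tV'.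
by rewrite tV' in tV.
Qed.

Lemma measurable_unoccupied (V : {set 'I_n}) :
  measurable [set om | forall t : 'I_n, t \notin V -> ~~ occ om t (x t)].
Proof.
rewrite (_ : [set om | _] =
  \bigcap_y Z y @^-1` [set c | all (fun l => trace n x y l \subset V) c]).
  rewrite -[X in measurable X]setCK; apply: measurableC; rewrite setC_bigcap.
  apply: (countable_bigcupT_measurable (countableP _)) => y; apply: measurableC.
  by apply: measurable_preimage_discrete; exact: discrete_particle_words.
apply/seteqP; split=> om /=; first by move/unoccupiedP => h y _; apply: h.
by move=> h; apply/unoccupiedP => y; apply: (h y I).
Qed.

(** Almost surely all increments lie in [s]. Then only particles from [origins] can meet a site, and
    the event concerns finitely many independent Poisson families. *)
Lemma unoccupied_prob (V : {set 'I_n}) :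
  mu [set om | forall t : 'I_n, t \notin V -> ~~ occ om t (x t)] =
  (expR (- meeting_mass (particle_traces s p n x lambda) V))%:E.
Proof.
pose W y := [seq l <- words s n | trace n x y l \subset V].
pose ys := origins s n x.
have uW y : uniq (W y) by rewrite filter_uniq ?uniq_words.
have vW y : all (fun l => size l == n) (W y).
  by apply/allP => l; rewrite mem_filter mem_words => /and3P[].
have := particle_words_within (ys := ys) (undup_uniq _) uW vW.
have -> : \prod_(y <- ys) expR (- (lambda * (1 - \sum_(l <- W y) weight p l))) =
    expR (- meeting_mass (particle_traces s p n x lambda) V).
  rewrite -expR_sum sumrN; congr (expR (- _)).
  rewrite /meeting_mass [RHS]big_mkcond big_allpairs_dep /=; apply: eq_bigr => y _.
  rewrite -[X in X - _](expr1n _ n) -p_sum -sum_weight (bigID (fun l => trace n x y l \subset V)) /=.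
  by rewrite big_filter addrAC subrr add0r mulr_sumr -big_mkcond.
move=> <-.
(* The union of these countably many null events is the event that some increment leaves the
   support. *)
pose bad (j : G * nat * nat * G) :=
  if j.2 \in s then set0 else xi j.1.1.1 j.1.1.2 j.1.2 @^-1` [set j.2].
case: (driving) => _ mxi _ prxi _.
have mbad j : measurable (bad j) by rewrite /bad; case: ifP => // _; apply: mxi.
have null : mu (\bigcup_j bad j) = 0%E.
  apply: null_countable_bigcup => // -[[[y i] r] z]; rewrite /bad /=.
  case: ifP => [_|zs]; first by rewrite measure0.
  rewrite prxi; congr (_%:E); apply/eqP; rewrite eq_le p_ge0 andbT leNgt -mem_s zs //.
have mnull : measurable (\bigcup_j bad j) by apply: (countable_bigcupT_measurable (countableP _)).
have words_in om y : ~ (\bigcup_j bad j) om -> all (mem (words s n)) (Z y om).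
  move=> nb; apply/allP => l /mapP[i _ ->]; rewrite /= mem_words size_mkseq eqxx /=.
  apply/allP => z /mapP[r _ ->]; apply: contraT => zs; case: nb.
  by exists (y, i, r, xi y i r om) => //; move/negbTE: zs => zs; rewrite /bad /=; move: zs => /= ->.
set E1 := [set om | _]; set E2 := [set om | _].
have mE1 : measurable E1 by exact: measurable_unoccupied.
have mE2 : measurable E2.
  exact: (measurable_particle_words ys (fun y => [set c | all (mem (W y)) c])).
have E12 : E1 `<=` E2 `|` \bigcup_j bad j.
  move=> om /unoccupiedP h; case: (pselect ((\bigcup_j bad j) om)) => [|nb]; [by right|left].
  move=> y _; apply/allP => l lZ; rewrite /= mem_filter.
  by rewrite (allP (h y)) //; apply: (allP (words_in om y nb)).
have E21 : E2 `<=` E1 `|` \bigcup_j bad j.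
  move=> om h; case: (pselect ((\bigcup_j bad j) om)) => [|nb]; [by right|left].
  apply/unoccupiedP => y; apply/allP => l lZ.
  case: (boolP (y \in ys)) => yys.
    by have := allP (h y yys) l lZ; rewrite /= mem_filter => /andP[].
  apply/fintype.subsetP => t; rewrite inE => /eqP e; case/negP: yys.
  rewrite mem_undup; apply/allpairsP; exists (t, l); rewrite mem_enum; split=> //=.
    exact: (allP (words_in om y nb)).
  by rewrite -e addrK.
have le A B : measurable A -> measurable B -> A `<=` B `|` \bigcup_j bad j -> (mu A <= mu B)%E.
  move=> mA mB AB; apply: (@le_trans _ _ (mu (B `|` \bigcup_j bad j))).
    by apply: le_measure => //; rewrite inE //; apply: measurableU.
  by rewrite measureU0.
by apply/eqP; rewrite eq_le !le.
Qed.

End particle_words.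

Section environment_law.

(** * Occupation patterns of the environment along words *)

Variables (R : realType) (d : nat) (p : 'rV[int]_d -> R) (lambda : R).
Variable (P : probability (env d) R).
Hypothesis law : rwrw_law p lambda P.
Local Notation G := 'rV[int]_d.
Variable s : seq G.
Hypotheses (s_uniq : uniq s) (p_ge0 : forall z, 0 <= p z).
Hypotheses (mem_s : forall z, (z \in s) = (0 < p z)) (p_sum : \sum_(z <- s) p z = 1).

Definition occupied n (x : nat -> G) (w : env d) : {set 'I_n} := [set t : 'I_n | w t (x t)].

Lemma measurable_site t y (b : bool) : measurable [set w : env d | w t y = b].
Proof.
have m1 : measurable [set w : env d | w t y].
  by apply: sub_sigma_algebra; exists t, y.
case: b; first exact: m1.
rewrite (_ : [set _ | _] = ~` [set w : env d | w t y]); first exact: measurableC.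
by apply/seteqP; split=> w /=; [move=> -> | move/negP/negbTE].
Qed.

Lemma discrete_occupied n (x : nat -> G) : discrete_rv (occupied n x).
Proof.
move=> V; rewrite (_ : _ @^-1` _ = \bigcap_(t in [set: 'I_n]) [set w : env d | w t (x t) = (t \in V)]).
  by apply: fin_bigcap_measurable => // t _; apply: measurable_site.
apply/seteqP; split=> w /=; first by move=> <- t _; rewrite /= inE.
by move=> h; apply/setP => t; rewrite inE h.
Qed.

(* The probabilities of [occupied n x w \subset V] determine the law, by Moebius inversion. *)
Lemma occupied_prob n (x : nat -> G) (f : pred {set 'I_n}) :
  P [set w | f (occupied n x w)] =
  (union_mean (particle_traces s p n x lambda) (fun U => (f U)%:R))%:E.
Proof.
have split (g : pred {set 'I_n}) : P [set w | g (occupied n x w)] =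
    (\sum_(V : {set 'I_n} | g V) fine (P (occupied n x @^-1` [set V])))%:E.
  have := measure_split_seq P (measurableT : measurable (setT : set (env d)))
    (discrete_occupied x) (enum_uniq (fun V : {set 'I_n} => g V)).
  rewrite setTI (_ : [set om | _] = [set w | g (occupied n x w)]); last first.
    by apply/seteqP; split=> w /=; rewrite mem_enum.
  move=> ->; rewrite big_enum /= -sumEFin; apply: eq_bigr => V _.
  by rewrite setTI fineK // fin_num_measure //; apply: discrete_occupied.
rewrite split; congr (_%:E).
have subset_prob (V : {set 'I_n}) : P [set w | occupied n x w \subset V] =
    (expR (- meeting_mass (particle_traces s p n x lambda) V))%:E.
  have [disp [T [mu [N0 [xi [driving PE]]]]]] := law.
  rewrite PE; last first.
    exact: (measurable_preimage_discrete (X := occupied n x) (fun U : {set _} => is_true (U \subset V)) (discrete_occupied x)).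
  rewrite -(unoccupied_prob driving s_uniq p_ge0 mem_s p_sum x V).
  congr (mu _); apply/seteqP; split=> om /= h.
    by move=> t; apply: contra => ot; apply: (fintype.subsetP h); rewrite inE.
  apply/fintype.subsetP => t; rewrite inE => ot; apply: contraT => /h.
  by rewrite ot.
have atom : (fun V => fine (P (occupied n x @^-1` [set V]))) =1
    (fun V => union_mean (particle_traces s p n x lambda) (fun U => (U == V)%:R)).
  apply: subset_sums_inj => V; rewrite union_mean_subset_sum.
  have := subset_prob V; rewrite (split (fun U => U \subset V)) => -[] //.
rewrite (eq_bigr _ (fun V _ => atom V)) union_mean_expand big_mkcond /=.
by apply: eq_bigr => V _; case: (f V); rewrite ?mul1r ?mul0r.
Qed.

Implicit Types l : seq (bool * G).

(* A letter is the occupation value seen by the walk together with its next step. *)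
Definition site l t : G := \sum_(e <- take t l) e.2.

Definition label l t : bool := (nth (false, 0) l t).1.

Definition follows l : set (env d) :=
  [set w | forall t, (t < size l)%N -> w t (site l t) = label l t].

Lemma site_size l : site l (size l) = \sum_(e <- l) e.2.
Proof. by rewrite /site take_size. Qed.

Lemma site_cat l l' t : (t <= size l)%N -> site (l ++ l') t = site l t.
Proof. by move=> tl; rewrite /site takel_cat. Qed.

Lemma site_catr l l' t : site (l ++ l') (size l + t) = \sum_(e <- l) e.2 + site l' t.
Proof. by rewrite /site take_cat ltnNge leq_addr /= addKn big_cat. Qed.

Lemma follows_nil : follows [::] = setT.
Proof. by apply/seteqP; split. Qed.

Lemma follows_cat l l' : follows (l ++ l') `<=` follows l.
Proof.
move=> w h t tl; have := h t; rewrite size_cat ltn_addr // site_cat ?(ltnW tl) //.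
by rewrite /label nth_cat tl; apply.
Qed.

Lemma follows_rcons l e : follows (rcons l e) =
  follows l `&` [set w : env d | w (size l) (\sum_(e <- l) e.2) = e.1].
Proof.
rewrite -cats1; apply/seteqP; split=> [w h|w [h he] t].
  split; first exact: follows_cat h.
  have := h (size l); rewrite size_cat addn1 ltnSn site_cat // site_size.
  by rewrite /label nth_cat ltnn subnn; apply.
rewrite size_cat addn1 ltnS leq_eqVlt => /orP[/eqP ->|tl].
  by rewrite site_cat // site_size /label nth_cat ltnn subnn.
by rewrite site_cat ?(ltnW tl) // /label nth_cat tl; apply: h.
Qed.

Lemma measurable_follows l : measurable (follows l).
Proof.
elim/last_ind: l => [|l e IH]; first by rewrite follows_nil; exact: measurableT.
by rewrite follows_rcons; apply: measurableI => //; apply: measurable_site.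
Qed.

(** Beyond the end of [l] the default label is [false], so only times below [size l] occur. *)
Definition label_set n l : {set 'I_n} := [set t : 'I_n | label l t].

Lemma followsE n (x : nat -> G) l : (size l <= n)%N ->
  (forall t, (t < size l)%N -> x t = site l t) ->
  follows l = [set w | occupied n x w :&: initial_times n (size l) == label_set n l].
Proof.
move=> ln xl; apply/seteqP; split=> w /=.
  move=> h; apply/eqP/setP => t; rewrite !inE.
  case: (ltnP t (size l)) => tl; first by rewrite andbT xl // h.
  by rewrite andbF /label nth_default.
move=> /eqP/setP h t tl; have := h (Ordinal (leq_trans tl ln)).
by rewrite !inE /= tl andbT xl.
Qed.

(** The sites may continue freely beyond [l], so a word and its extension can be read on one list of
    traces. *)
Lemma follows_prob n (x : nat -> G) l : (size l <= n)%N ->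
  (forall t, (t < size l)%N -> x t = site l t) ->
  P (follows l) = (union_mean (particle_traces s p n x lambda)
    (pattern R (initial_times n (size l)) (label_set n l)))%:E.
Proof.
move=> ln xl; rewrite (followsE ln xl).
by rewrite (occupied_prob x
  (fun U => U :&: initial_times n (size l) == label_set n l)).
Qed.

Variables (C q : R).
Hypotheses (lambda_ge0 : 0 <= lambda) (C_ge0 : 0 <= C) (q_gt0 : 0 < q).
Hypothesis hit_le : forall n y, hit_prob s p n y <= C * heat R n.
Hypothesis avoid_ge : forall n (a : nat -> G), q <= avoid_prob s p n a.

(** Along the sites of [l ++ l'] the required pattern splits at time m. Its second half lies at
    sites displaced by the total step of [l]; [shift_law] with this displacement identifies it with
    [follows l']. *)
Lemma follows_mixing l l' :
  expR (- (lambda * (2 * C))) * expR (- (2 * C / q ^+ 2)) * expR (- (2 * C / q ^+ 2)) *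
  fine (P (follows l)) * fine (P (follows l')) <= fine (P (follows (l ++ l'))).
Proof.
set m := size l; set k := size l'; pose x := site (l ++ l').
set V := label_set (m + k) (l ++ l').
set I0 := initial_times (m + k) m.
have V1E : V :&: I0 = label_set (m + k) l.
  apply/setP => t; rewrite !inE /label nth_cat -/m; case: ifP => tm; rewrite ?andbT //.
  by rewrite andbF nth_default // leqNgt tm.
have init : fine (P (follows l)) =
    union_mean (particle_traces s p (m + k) x lambda) (pattern R I0 (V :&: I0)).
  rewrite V1E (@follows_prob (m + k) x) ?leq_addr // => t tl.
  by rewrite /x site_cat // ltnW.
have late : fine (P (follows l')) =
    union_mean (particle_traces s p (m + k) x lambda) (pattern R (~: I0) (V :&: ~: I0)).
  rewrite (@follows_prob k (site l')) //=.
  rewrite -(shift_law p_sum (m := m) (x := x) lambda (c := \sum_(e <- l) e.2)); last first.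
    by move=> t; rewrite /x site_catr [_ + site _ _]addrC addrK.
  rewrite /union_mean; congr (_ * _); apply: eq_union_sum => U.
  rewrite /pattern; congr (nat_of_bool _)%:R.
  apply/eqP/eqP => /setP h; apply/setP => t; last first.
    have := h (rshift m t); rewrite !inE /= ltnNge leq_addr ltn_ord /= !andbT => ->.
    by rewrite /label nth_cat ltnNge leq_addr /= addKn.
  rewrite !inE; case: (ltnP t m) => tm; rewrite ?andbF // !andbT.
  have tk : (t - m < k)%N by rewrite ltn_subLR // ltn_ord.
  have := h (Ordinal tk); rewrite !inE /= tk andbT.
  rewrite (_ : rshift m (Ordinal tk) = t); last by apply: val_inj; rewrite /= subnKC.
  by move=> ->; rewrite /label nth_cat ltnNge tm.
have joint : fine (P (follows (l ++ l'))) =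
    union_mean (particle_traces s p (m + k) x lambda)
      (fun U => pattern R I0 (V :&: I0) U * pattern R (~: I0) (V :&: ~: I0) U).
  rewrite (@follows_prob (m + k) x) ?size_cat //=.
  rewrite /union_mean; congr (_ * _); apply: eq_union_sum => U.
  rewrite /pattern -natrM mulnb; congr (nat_of_bool _)%:R.
  have -> : initial_times (m + k) (m + k) = (finset.setTfor 'I_(m + k)).
    by apply/setP => t; rewrite !inE ltn_ord.
  rewrite finset.setIT -/V; apply/eqP/andP => [-> //|[/eqP h1 /eqP h2]].
  by rewrite -(finset.setID U I0) -[RHS](finset.setID V I0) h1 !finset.setDE h2.
rewrite init late joint.
by apply: (pattern_mixing p_ge0 p_sum C_ge0 q_gt0 hit_le avoid_ge x lambda_ge0);
  rewrite finset.subsetIr.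
Qed.

End environment_law.

(** * The walk *)

Section step_process.
Variables (R : realType) (d : nat) (alpha : bool -> 'rV[int]_d -> R).
Variable (P : probability (env d) R).
Local Notation G := 'rV[int]_d.
Hypothesis alpha_ge0 : forall b z, 0 <= alpha b z.
Variable supp : bool -> seq G.
Hypotheses (supp_uniq : forall b, uniq (supp b))
  (mem_supp : forall b z, (z \in supp b) = (0 < alpha b z))
  (sum_supp : forall b, \sum_(z <- supp b) alpha b z = 1).
Implicit Types (l : seq (bool * G)) (w : env d) (wX : env d * walk_path d).

Definition letters : seq (bool * G) := [seq (b, z) | b <- [:: false; true], z <- supp b].

Lemma uniq_letters : uniq letters.
Proof.
apply: allpairs_uniq_dep => [//|b _|]; first exact: supp_uniq.
by move=> [? ?] [? ?] _ _ /= [-> ->].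
Qed.

Definition step_weight l : R := \prod_(e <- l) alpha e.1 e.2.

Definition step_law l : R := fine (P (follows l)) * step_weight l.

Lemma step_weight_ge0 l : 0 <= step_weight l.
Proof. by rewrite prodr_ge0. Qed.

Lemma alpha_le1 b z : alpha b z <= 1.
Proof.
have [a0|] := leP (alpha b z) 0; first exact: le_trans a0 ler01.
rewrite -mem_supp => zs; rewrite -(sum_supp b) (bigD1_seq z) //= lerDl.
exact: sumr_ge0.
Qed.

(** The next label splits [follows l] in two, and for each label the step probabilities sum to 1. *)
Lemma step_law_process : word_process letters step_law.
Proof.
have fine_ge0 l : 0 <= fine (P (follows l)) by exact: fine_ge0.
split=> [l||l|l l'].
- by rewrite mulr_ge0 // step_weight_ge0.
- by rewrite /step_law /step_weight big_nil follows_nil probability_setT mulr1.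
- pose B b := [set w : env d | w (size l) (\sum_(e <- l) e.2) = b].
  have mB b : measurable (B b) by exact: measurable_site.
  rewrite /letters big_allpairs_dep /=.
  transitivity (\sum_(b <- [:: false; true]) fine (P (follows l `&` B b)) * step_weight l).
    apply: eq_bigr => b _; rewrite -[RHS]mulr1 -(sum_supp b) mulr_sumr.
    apply: eq_bigr => z _; rewrite /step_law follows_rcons -/(B b) /step_weight.
    by rewrite -cats1 big_cat big_seq1 /= mulrA.
  rewrite -mulr_suml big_cons big_seq1; congr (_ * _).
  have mf := measurable_follows l.
  rewrite -fineD ?fin_num_measure //; try exact: measurableI.
  rewrite -measureU //; try exact: measurableI.
    rewrite -setIUr (_ : _ `|` _ = setT) ?setIT //.
    by apply/seteqP; split=> w // _; rewrite /B /=; case: (w _ _); [right|left].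
  by apply/seteqP; split=> w //= -[[_ h] [_]]; rewrite /B /= in h *; rewrite h.
- rewrite /step_law ler_pM ?step_weight_ge0 //.
    rewrite fine_le ?fin_num_measure //; try exact: measurable_follows.
    apply: le_measure; rewrite ?inE; try exact: measurable_follows.
    exact: follows_cat.
  rewrite /step_weight big_cat /= ler_piMr ?step_weight_ge0 //.
  by apply: prodr_ile1 => e _; rewrite alpha_ge0 alpha_le1.
Qed.

Lemma step_law_mixing delta : (forall l l', delta * fine (P (follows l)) * fine (P (follows l')) <=
    fine (P (follows (l ++ l')))) ->
  forall l l', delta * step_law l * step_law l' <= step_law (l ++ l').
Proof.
move=> mix l l'; rewrite /step_law.
rewrite (_ : step_weight (l ++ l') = step_weight l * step_weight l'); last first.
  by rewrite /step_weight big_cat.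
have := ler_wpM2r (mulr_ge0 (step_weight_ge0 l) (step_weight_ge0 l')) (mix l l').
by apply: le_trans; rewrite le_eqVlt; apply/orP; left; apply/eqP; ring.
Qed.

Variables (K : R.-pker env d ~> walk_path d) (PP : probability (env d * walk_path d)%type R).
Hypotheses (hK : forall w : env d, quenched_law alpha w (K w)) (hPP : annealed_law P K PP).

Definition walk_along (x : nat -> G) t : set (walk_path d) :=
  [set X | forall r, (r <= t)%N -> X r = x r].

Lemma measurable_position t y : measurable [set X : walk_path d | X t = y].
Proof. by apply: sub_sigma_algebra; exists t, y. Qed.

Lemma measurable_walk_along x t : measurable (walk_along x t).
Proof.
rewrite (_ : walk_along x t = \bigcap_(r in [set r | (r <= t)%N]) [set X : walk_path d | X r = x r]).
  apply: bigcap_measurableType => r _; exact: measurable_position.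
by apply/seteqP; split.
Qed.

Lemma quenched_prob w (x : nat -> G) t : x 0%N = 0 ->
  K w (walk_along x t) = (\prod_(r < t) alpha (w r (x r)) (x r.+1 - x r))%:E.
Proof.
move=> x0; have [K0 KS] := hK w; elim: t => [|t IH].
  rewrite big_ord0 -K0; congr (K w _); apply/seteqP; split=> X /=.
    by move=> /(_ 0%N (leqnn _)) ->.
  by move=> X0 r; rewrite leqn0 => /eqP ->; rewrite X0 x0.
by rewrite [LHS]KS IH big_ord_recr /= EFinM.
Qed.

Definition step_word t wX : seq (bool * G) :=
  mkseq (fun r => (wX.1 r (wX.2 r), wX.2 r.+1 - wX.2 r)) t.

Definition at_origin : set (env d * walk_path d) := [set wX | wX.2 0%N = 0].

Lemma position_site t wX r : at_origin wX -> (r <= t)%N -> wX.2 r = site (step_word t wX) r.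
Proof.
move=> X0 rt; rewrite /site /step_word /mkseq -map_take take_iota (minn_idPl rt) big_map /=.
have -> : iota 0 r = index_iota 0 r by rewrite /index_iota subn0.
by rewrite telescope_sumr // (X0 : wX.2 0%N = 0) subr0.
Qed.

Lemma step_word_event l : at_origin `&` step_word (size l) @^-1` [set l] =
  follows l `*` walk_along (site l) (size l).
Proof.
apply/seteqP; split=> -[w X] /=.
  move=> [X0 e]; have pos r : (r <= size l)%N -> X r = site l r.
    by move=> rl; rewrite -[in RHS]e -(position_site X0 rl).
  split=> // t tl; rewrite -(pos t (ltnW tl)) -[in RHS]e.
  by rewrite /label nth_mkseq.
move=> [fw pos]; split; first by rewrite /at_origin /= (pos 0%N) // /site take0 big_nil.
apply: (@eq_from_nth _ (false, 0)); first by rewrite size_mkseq.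
move=> r; rewrite size_mkseq => rl; rewrite nth_mkseq //= !pos // ?(ltnW rl) // fw //.
rewrite [RHS]surjective_pairing; congr (_, _).
by rewrite /site (take_nth (false, 0)) // -cats1 big_cat big_seq1 /= [X in X - _]addrC addrK.
Qed.

(** On [follows l] the quenched probability of the path is the constant [step_weight l]: the word
    fixes the sites, and the labels there fix the transitions. *)
Lemma step_word_prob l : PP (at_origin `&` step_word (size l) @^-1` [set l]) = (step_law l)%:E.
Proof.
have mf := measurable_follows l; have mw := measurable_walk_along (site l) (size l).
rewrite step_word_event hPP //.
rewrite (eq_integral (fun=> (step_weight l)%:E)); last first.
  move=> w /set_mem fw; rewrite quenched_prob; last by rewrite /site take0 big_nil.
  congr (_%:E); rewrite /step_weight (big_nth (false, 0)) big_mkord; apply: eq_bigr => r _.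
  rewrite fw // /site (take_nth (false, 0)) // -cats1 big_cat big_seq1 /=.
  by rewrite [X in X - _]addrC addrK.
by rewrite integral_cst // /step_law muleC EFinM fineK // fin_num_measure.
Qed.

Lemma discrete_position t : discrete_rv (fun wX => wX.2 t).
Proof.
move=> y; rewrite (_ : _ @^-1` _ = snd @^-1` [set X : walk_path d | X t = y]) //.
rewrite -[X in measurable X]setTI; apply: measurable_snd => //.
exact: measurable_position.
Qed.

(** A label is the environment at a random site; a countable union over the position y reduces it to
    fixed sites. *)
Lemma discrete_step_word t : discrete_rv (step_word t).
Proof.
move=> l; rewrite (_ : step_word t @^-1` [set l] = [set wX | size l = t /\
    forall r, (r < t)%N -> exists y, wX.2 r = y /\ wX.2 r.+1 = y + (nth (false, 0) l r).2 /\
      wX.1 r y = (nth (false, 0) l r).1]); last first.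
  apply/seteqP; split=> wX /=.
    move=> <-; rewrite size_mkseq; split=> // r rt; exists (wX.2 r).
    by rewrite nth_mkseq //= addrC subrK.
  move=> [lt h]; apply: (@eq_from_nth _ (false, 0)); first by rewrite size_mkseq.
  move=> r; rewrite size_mkseq => rt; rewrite nth_mkseq //=.
  have [y [-> [-> ->]]] := h r rt.
  by rewrite addrC addKr -surjective_pairing.
case: (eqVneq (size l) t) => lt; last first.
  by rewrite (_ : [set _ | _] = set0) //; apply/seteqP; split=> wX //= -[/eqP]; rewrite (negbTE lt).
rewrite (_ : [set _ | _] = \bigcap_(r in [set r | (r < t)%N]) \bigcup_y
   ([set wX | wX.2 r = y] `&` ([set wX | wX.2 r.+1 = y + (nth (false, 0) l r).2] `&`
    [set wX | wX.1 r y = (nth (false, 0) l r).1]))).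
  apply: bigcap_measurableType => r _.
  apply: (countable_bigcupT_measurable (countableP _)) => y.
  apply: measurableI; first exact: discrete_position.
  apply: measurableI; first exact: discrete_position.
  rewrite (_ : [set _ | _] = fst @^-1` [set w : env d | w r y = (nth (false, 0) l r).1]) //.
  rewrite -[X in measurable X]setTI; apply: measurable_fst => //.
  exact: measurable_site.
apply/seteqP; split=> wX /=.
  by move=> [_ h] r /h [y hy]; exists y.
by move=> h; split=> // r /h [y _ hy]; exists y.
Qed.

(** An event of probability one on which the recorded word belongs to a finite list. *)
Definition admissible t : set (env d * walk_path d) :=
  at_origin `&` [set wX | step_word t wX \in words letters t].

Lemma measurable_admissible t : measurable (admissible t).
Proof.
apply: measurableI; first exact: (discrete_position 0%N 0).
exact: (measurable_preimage_discrete [set l | l \in words letters t] (@discrete_step_word t)).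
Qed.

Lemma step_word_law t (f : pred (seq (bool * G))) :
  PP (admissible t `&` [set wX | f (step_word t wX)]) =
  (\sum_(l <- words letters t | f l) step_law l)%:E.
Proof.
rewrite (_ : _ `&` _ =
  at_origin `&` [set wX | step_word t wX \in [seq l <- words letters t | f l]]); last first.
  apply/seteqP; split=> wX /=.
    by move=> [[X0 h] fh]; split=> //; rewrite mem_filter fh.
  by move=> [X0]; rewrite mem_filter => /andP[].
rewrite measure_split_seq; last first.
- by rewrite filter_uniq // uniq_words // uniq_letters.
- exact: discrete_step_word.
- exact: (discrete_position 0%N 0).
rewrite big_filter -sumEFin big_seq_cond [RHS]big_seq_cond; apply: eq_bigr => l /andP[].
rewrite mem_words => /andP[/eqP lt _] _.
by rewrite -lt step_word_prob.
Qed.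

Lemma admissible_full t : PP (admissible t) = 1%E.
Proof.
have := step_word_law t predT; rewrite (_ : [set _ | _] = setT) ?setIT; last first.
  by apply/seteqP; split.
move=> ->; congr (_%:E).
have := sum_continuations [::] t step_law_process.
by case: step_law_process => _ -> _ _.
Qed.

Lemma inadmissible_null t : PP (~` admissible t) = 0%E.
Proof.
by rewrite probability_setC ?admissible_full ?subee //; exact: measurable_admissible.
Qed.

Lemma step_word_le t (f : pred (seq (bool * G))) (B : set (env d * walk_path d)) :
  measurable B -> (forall wX, admissible t wX -> B wX -> f (step_word t wX)) ->
  (PP B <= (\sum_(l <- words letters t | f l) step_law l)%:E)%E.
Proof.
move=> mB Bf; rewrite -step_word_law.
have mf : measurable (admissible t `&` [set wX | f (step_word t wX)]).
  apply: measurableI; first exact: measurable_admissible.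
  exact: (measurable_preimage_discrete [set l | f l] (@discrete_step_word t)).
have mC : measurable (~` admissible t) by apply: measurableC; exact: measurable_admissible.
have <- : PP ((admissible t `&` [set wX | f (step_word t wX)]) `|` ~` admissible t) =
    PP (admissible t `&` [set wX | f (step_word t wX)]).
  by apply: measureU0 => //; exact: inadmissible_null.
apply: le_measure; rewrite ?inE //; first exact: measurableU.
move=> wX BX; case: (pselect (admissible t wX)) => [a|]; [left|by right].
by split=> //; apply: Bf.
Qed.

End step_process.

(** * From exponential tails to almost sure convergence *)

Lemma exponential_bound_sum (R : realType) (I : Type) (r : seq I) (f : I -> nat -> R) :
  (forall i, exists C c : R, [/\ 0 < C, 0 < c & forall t, f i t <= C * expR (- c * t%:R)]) ->
  exists C c : R, [/\ 0 < C, 0 < c & forall t, \sum_(i <- r) f i t <= C * expR (- c * t%:R)].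
Proof.
move=> fC; elim: r => [|i r [C [c [C0 c0 IH]]]].
  by exists 1, 1; split=> // t; rewrite big_nil mul1r expR_ge0.
have [C' [c' [C'0 c'0 fi]]] := fC i.
have m0 : 0 < Num.min c' c by rewrite lt_min c0 c'0.
exists (C' + C), (Num.min c' c); split=> // [|t]; first exact: addr_gt0.
rewrite big_cons mulrDl lerD //.
  apply: le_trans (fi t) _; rewrite ler_wpM2l ?(ltW C'0) // ler_expR !mulNr lerN2.
  by rewrite ler_wpM2r // ge_min lexx.
apply: le_trans (IH t) _; rewrite ler_wpM2l ?(ltW C0) // ler_expR !mulNr lerN2.
by rewrite ler_wpM2r // ge_min lexx orbT.
Qed.

Lemma row_norm_gt (R : realType) (d : nat) (M : 'rV[R]_d) (eps : R) : 0 <= eps -> eps < `|M| ->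
  exists j, eps < `|M 0 j|.
Proof.
move=> eps0 M_gt; have M0 : mx_norm M != 0 by rewrite gt_eqF // (le_lt_trans eps0).
have [[i j] /= Mij] := mx_norm_neq0 M0; exists j.
by rewrite -[0](ord1 i) -Mij.
Qed.

Section borel_cantelli.
Context {disp : measure_display} {T : measurableType disp} {R : realType} (mu : probability T R).

(** Borel-Cantelli with a geometric series of ratio exp(-c). *)
Lemma exponential_limsup_null (F : nat -> set T) (C c : R) :
  (forall t, measurable (F t)) -> 0 < C -> 0 < c ->
  (forall t, (mu (F t) <= (C * expR (- c * t%:R))%:E)%E) -> mu (lim_sup_set F) = 0%E.
Proof.
move=> mF C0 c0 muF; apply: lim_sup_set_cvg0 => //.
set z := expR (- c).
have z1 : z < 1 by rewrite /z -expR0 ltr_expR oppr_lt0.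
have z0 : 0 < z by exact: expR_gt0.
apply: (@le_lt_trans _ _ (C / (1 - z))%:E); last exact: ltry.
apply: lime_le; first by apply: is_cvg_nneseries.
apply: nearW => n.
apply: (@le_trans _ _ (\sum_(0 <= k < n) (C * z ^+ k)%:E)%E).
  apply: lee_sum => k _; apply: le_trans (muF k) _.
  by rewrite lee_fin /z -expRM_natr.
rewrite sumEFin lee_fin -mulr_sumr ler_pM2l // -[leRHS]div1r ler_pdivlMr ?subr_gt0 //.
have := subrX1 z n; rewrite big_mkord => e.
rewrite -[leLHS]opprK -mulrN opprB mulrC -e opprB lerBlDr lerDl.
by rewrite exprn_ge0 // ltW.
Qed.

Lemma ae_cvg0_of_tails (Y : nat -> T -> R) :
  (forall t om, 0 <= Y t om) -> (forall t eps, measurable [set om | eps < Y t om]) ->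
  (forall eps, 0 < eps -> exists C c : R, [/\ 0 < C, 0 < c &
     forall t, (mu [set om | (eps < Y t om)%R] <= (C * expR (- c * t%:R))%:E)%E]) ->
  {ae mu, forall om, Y t om @[t --> \oo] --> 0}.
Proof.
move=> Y0 mY tail.
pose F k t := [set om | k.+1%:R^-1 < Y t om].
have null k : mu.-negligible (lim_sup_set (F k)).
  have k0 : 0 < k.+1%:R^-1 :> R by rewrite invr_gt0.
  have [C [c [C0 c0 muF]]] := tail _ k0.
  apply/negligibleP; last by apply: (exponential_limsup_null _ C0 c0 muF) => t; exact: mY.
  apply: bigcap_measurableType => n _; apply: bigcup_measurable => j _; exact: mY.
apply: negligibleS (negligible_bigcup null) => om /= ncv.
apply: contrapT => h; apply: ncv.
apply/cvgrPdist_le => /= eps eps0.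
have [k keps] : exists k : nat, k.+1%:R^-1 < eps.
  by have [k] := ltr_add_invr eps0; rewrite add0r; exists k.
have [n nP] : exists n, forall t, (n <= t)%N -> Y t om <= k.+1%:R^-1.
  apply: contrapT => nn; apply: h; exists k => // n _.
  apply: contrapT => nF; apply: nn; exists n => t nt; rewrite leNgt; apply/negP => lt.
  by apply: nF; exists t.
exists n => // t /= nt; rewrite sub0r normrN ger0_norm //.
by apply: le_trans (nP t nt) (ltW keps).
Qed.

End borel_cantelli.

Unset Implicit Arguments.

Theorem theorem2p1 (R : realType) (d : nat) (p : 'rV[int]_d -> R) (lambda : R)
    (alpha : bool -> 'rV[int]_d -> R)
    (P : probability (env d) R)
    (K : R.-pker env d ~> walk_path d)
    (PP : probability (env d * walk_path d)%type R)
    (hd : (5 <= d)%N)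
    (hp : finite_range_distribution p)
    (hcov : covariance_mx p \in unitmx)
    (hlambda : 0 <= lambda)
    (halpha : forall i, finite_range_distribution (alpha i))
    (hP : rwrw_law p lambda P)
    (hK : forall w : env d, quenched_law alpha w (K w))
    (hPP : annealed_law P K PP) :
  exists v : 'rV[R]_d,
    [/\ {ae PP, forall wX : env d * walk_path d,
           empirical_velocity (R := R) wX.2 t @[t --> \oo] --> v},
        (\int[PP]_wX (`|empirical_velocity wX.2 t - v|)%:E)%E
           @[t --> \oo] --> (0 : \bar R) &
        forall eps : R, 0 < eps -> exists C c : R,
          [/\ 0 < C, 0 < c & forall t : nat,
           (PP [set wX : env d * walk_path d |
                 (eps < `|empirical_velocity wX.2 t - v|)%R]
              <= (C * expR (- c * t%:R))%:E)%E]].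
Proof.
have [s [s_uniq mem_s sum_s fsum_s]] := finite_range_support hp.
have [p_ge0 _ _] := hp.
have [C [q [C0 q0 hit_le avoid_ge]]] := walk_bounds hd hp hcov s_uniq mem_s sum_s fsum_s.
have [supp suppP] := choice (fun b => finite_range_support (halpha b)).
have supp_uniq b : uniq (supp b) by have [] := suppP b.
have mem_supp b z : (z \in supp b) = (0 < alpha b z) by have [] := suppP b.
have sum_supp b : \sum_(z <- supp b) alpha b z = 1 by have [] := suppP b.
have alpha_ge0 b z : 0 <= alpha b z by have [] := halpha b.
pose delta := expR (- (lambda * (2 * C))) * expR (- (2 * C / q ^+ 2)) * expR (- (2 * C / q ^+ 2)).
have delta0 : 0 < delta by rewrite !mulr_gt0 // expR_gt0.
have mixing := step_law_mixing alpha_ge0 (delta := delta)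
  (follows_mixing hP s_uniq p_ge0 mem_s sum_s hlambda C0 q0 hit_le avoid_ge).
have process := step_law_process P alpha_ge0 supp_uniq mem_supp sum_supp.
pose A := letters supp; rewrite -/A in process.
(* One functional per coordinate; the value 0 off the finite alphabet makes it bounded on all
   letters. *)
pose g j (e : bool * 'rV[int]_d) : R := if e \in A then (e.2 0 j)%:~R else 0.
pose B := \sum_(j < d) \sum_(e <- A) `|g j e|.
have B0 : 0 <= B by rewrite sumr_ge0 // => j _; rewrite sumr_ge0.
have gB j e : `|g j e| <= B.
  case: (boolP (e \in A)) => eA; last by rewrite /g (negbTE eA) normr0.
  rewrite /B (bigD1 j) //= (bigD1_seq e) //=; last exact: uniq_letters.
  by rewrite -addrA lerDl addr_ge0 // sumr_ge0 // => j' _; rewrite sumr_ge0.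
have [vel velP] := choice (fun j => word_concentration process B0 (gB j) delta0 mixing).
pose v : 'rV[R]_d := \row_j vel j.
pose Y t (wX : env d * walk_path d) : R := `|empirical_velocity wX.2 t - v|.
have mY t (D : set R) : measurable [set wX | D (Y t wX)].
  apply: (measurable_preimage_discrete
    [set y : 'rV[int]_d | D `|t%:R^-1 *: map_mx intr y - v|] (@discrete_position d t)).
have velocityE t wX j : admissible supp t wX ->
    empirical_velocity (R := R) wX.2 t 0 j = t%:R^-1 * additive_sum (g j) (step_word t wX).
  move=> [X0 wA]; rewrite !mxE; congr (_ * _).
  rewrite (position_site X0 (leqnn t)) /site take_oversize ?size_mkseq // summxE rmorph_sum /=.
  rewrite /additive_sum big_seq [RHS]big_seq; apply: eq_bigr => e eW.
  rewrite /g; case: ifP => // /negP[].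
  by move: wA; rewrite /= mem_words => /andP[_ /allP]; apply.
have tail eps : 0 < eps -> exists C c : R, [/\ 0 < C, 0 < c &
    forall t, (PP [set wX | (eps < Y t wX)%R] <= (C * expR (- c * t%:R))%:E)%E].
  move=> eps0.
  have [D [c [D0 c0 Dc]]] := exponential_bound_sum (index_enum 'I_d) (fun j => velP j eps eps0).
  (* At t = 0 the velocity is 0 by convention and may be far from v; the added 1 covers this
     case. *)
  exists (D + 1), c; split=> //; first exact: addr_gt0.
  case=> [|t].
    rewrite mulr0 expR0 mulr1; apply: le_trans (probability_le1 _ _) _.
      exact: (mY 0%N [set r | eps < r]).
    by rewrite lee_fin lerDr ltW.
  (* In the maximum norm some coordinate deviates; multiplication by the time makes this a deviation
     of an additive sum. *)
  pose far j (l : seq (bool * 'rV[int]_d)) :=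
    t.+1%:R * eps < `|additive_sum (g j) l - t.+1%:R * vel j|.
  apply: le_trans (step_word_le alpha_ge0 supp_uniq mem_supp sum_supp hK hPP
    (t := t.+1) (f := fun l => [exists j, far j l]) _ _) _.
  - exact: (mY t.+1 [set r | eps < r]).
  - move=> wX adm /= /(row_norm_gt (ltW eps0)) [j].
    rewrite !mxE -[t.+1%:R^-1 * _](_ : empirical_velocity wX.2 t.+1 0 j = _) ?mxE // => h.
    apply/existsP; exists j; rewrite /far.
    have t0 : 0 < t.+1%:R :> R by rewrite ltr0n.
    rewrite -ltr_pdivlMl //; apply: lt_le_trans h _.
    have := velocityE t.+1 wX j adm; rewrite !mxE => ->.
    rewrite -[X in X * `|_|](gtr0_norm (_ : 0 < t.+1%:R^-1)) ?invr_gt0 // -normrM mulrBr mulKf ?gt_eqF //.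
  - rewrite lee_fin; apply: (@le_trans _ _ (D * expR (- c * t.+1%:R))); last first.
      by rewrite ler_wpM2r ?expR_ge0 // lerDl.
    apply: le_trans (Dc t.+1).
    rewrite big_mkcond [leRHS](exchange_big_dep xpredT) //.
    apply: ler_sum => l _.
    have [r0 _ _ _] := process.
    case: ifP => [/existsP[j jl]|_]; last by rewrite sumr_ge0.
    rewrite (bigD1 j) //= lerDl sumr_ge0 //.
have Y_cvg : {ae PP, forall wX, Y t wX @[t --> \oo] --> 0}.
  apply: ae_cvg0_of_tails tail => [t wX|t eps]; first exact: normr_ge0.
  exact: (mY t [set r | eps < r]).
exists v; split=> //.
- apply: filterS Y_cvg => wX /= h; apply/cvgrPdist_le => eps eps0.
  move/cvgrPdist_le: h => /(_ eps eps0); apply: filterS => t.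
  by rewrite sub0r normrN normr_id distrC.
(* If the path is admissible at all times, every coordinate of its velocity is at most B in absolute
   value, which gives the dominating constant. *)
- have adm : {ae PP, forall wX, forall t, admissible supp t wX}.
    have : PP.-negligible (\bigcup_t ~` admissible supp t).
      apply: negligible_bigcup => t; apply/negligibleP; last first.
        exact: (inadmissible_null alpha_ge0 supp_uniq mem_supp sum_supp hK hPP).
      by apply: measurableC; apply: measurable_admissible.
    apply: negligibleS => wX /= h; apply: contrapT => h'; apply: h => t.
    by apply: contrapT => nt; apply: h'; exists t.
  have dominated : {ae PP, forall wX t, setT wX -> (`|(Y t wX)%:E| <= (B + `|v|)%:E)%E}.
    apply: filterS adm => wX adm t _; rewrite lee_fin normr_id.
    apply: le_trans (ler_normB _ _) _; rewrite lerD2r leNgt; apply/negP.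
    move=> /(row_norm_gt B0) [j]; rewrite velocityE // ltNge => /negP; apply.
    rewrite normrM ger0_norm ?invr_ge0 //.
    case: t => [|t]; first by rewrite invr0 mul0r.
    have t0 : 0 < t.+1%:R :> R by rewrite ltr0n.
    rewrite ler_pdivrMl //.
    by have := additive_sum_norm (step_word t.+1 wX) (gB j); rewrite size_mkseq.
  have mf t : measurable_fun setT (EFin \o Y t).
    by apply/measurable_EFinP => _ D mD; rewrite setTI; exact: mY.
  have Y_cvgE : {ae PP, forall wX, setT wX -> (Y t wX)%:E @[t --> \oo] --> 0%E}.
    apply: filterS Y_cvg => wX h _; apply: cvg_EFin; [exact: nearW|exact: h].
  have ig : PP.-integrable setT (EFin \o cst (B + `|v|)).
    exact: finite_measure_integrable_cst.
  have [_ _] := dominated_convergence measurableT mf (measurable_cst 0%E) Y_cvgE ig dominated.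
  by rewrite integral0.
Qed.
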